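(* There exists a constant $k>0$ such that the following holds. If $p\colon\mathbb{N}\to(0,1)$ and $\epsilon>0$ are such that $$\sqrt{\frac{k\log n}{n}}\le p(n)\le 1-\frac{(1+\epsilon)\log n}{n}$$ for all sufficiently large $n$, then for $\Gamma\in\mathcal{G}(n,p)$ the right-angled Coxeter group $W_\Gamma$ is asymptotically almost surely thick of order exactly $1$, and hence has quadratic divergence.
   Context: $\mathcal{G}(n,p)$ is the random graph on $n$ labelled vertices in which each of the $\binom n2$ possible edges is included independently with probability $p=p(n)$. A property holds asymptotically almost surely if its probability tends to $1$ as $n\to\infty$. For a finite simple graph $\Gamma$, the right-angled Coxeter group $W_\Gamma$ is the group generated by the vertices of $\Gamma$ subject to the relations $w^2=1$ for each vertex $w$ and $uv=vu$ for each edge $\{u,v\}$. Thickness: in the present setting, a finitely generated group $G$ is thick of order $0$ if and only if it decomposes as the direct product of two infinite subgroups. $G$ is thick of order at most $n$ ($n\ge1$) if there is a finite collection $\mathcal{H}$ of undistorted (quasi-isometrically embedded) subgroups of $G$, each thick of order (at most) $n-1$, whose union generates a finite-index subgroup of $G$, and such that for all $g,g'\in G$ there is a finite sequence of cosets $g_1H_1,\dots,g_mH_m$ with each $H_i\in\mathcal{H}$, $g\in g_1H_1$, $g'\in g_mH_m$, and consecutive cosets having infinite coarse intersection (for some $r\ge0$, the intersection of the $r$-neighbourhoods of $g_iH_i$ and $g_{i+1}H_{i+1}$ in a word metric is infinite). Thick of order exactly $1$ means thick of order at most $1$ but not thick of order $0$. Divergence: for a finitely generated group, take a Cayley graph $X$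 for a finite generating set. For $0<\delta<1$, $\gamma\ge0$ and points $a,b,c\in X$ with $r=d(c,\{a,b\})>0$, let $\mathrm{div}_\gamma(a,b,c;\delta)$ be the infimum of the lengths of paths from $a$ to $b$ avoiding the ball of radius $\delta r-\gamma$ about $c$ (a ball of non-positive radius being empty), and let $\mathrm{Div}_\gamma(n;\delta)$ be the supremum of $\mathrm{div}_\gamma(a,b,c;\delta)$ over all such $a,b,c$ with $d(a,b)\le n$. The group has quadratic divergence if, for all sufficiently small $\delta$ and sufficiently large $\gamma$, $\mathrm{Div}_\gamma(n;\delta)$ is equivalent to $n^2$ (each function is bounded above by the other up to rescaling the function and its argument by constants and adding affine terms). *)

(* Defs.v *)
From HB Require Import structures.
From mathcomp Require Import all_boot all_order all_algebra.
From mathcomp Require Import all_classical all_reals all_analysis.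
Set Implicit Arguments.
Unset Strict Implicit.
Unset Printing Implicit Defensive.
Import Order.TTheory GRing.Theory Num.Theory numFieldNormedType.Exports.

Local Open Scope quotient_scope.
Local Open Scope classical_set_scope.

Section Presentation.
Variables (V : choiceType).

(* The letter [(v, true)] stands for [v] and [(v, false)] for its inverse. *)
Definition word : Type := seq (V * bool).
HB.instance Definition _ := Choice.on word.

Definition word_inv (u : word) : word := rev [seq (x.1, ~~ x.2) | x <- u].

Variable rels : word -> word -> Prop.

Inductive pres_eq : word -> word -> Prop :=
| pres_refl u : pres_eq u u
| pres_sym u v : pres_eq u v -> pres_eq v u
| pres_trans u v w : pres_eq u v -> pres_eq v w -> pres_eq u w
| pres_cat u u' v v' :
    pres_eq u u' -> pres_eq v v' -> pres_eq (u ++ v) (u' ++ v')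
| pres_cancel x b : pres_eq [:: (x, b); (x, ~~ b)] [::]
| pres_rel u v : rels u v -> pres_eq u v.

Definition pres_eqb : rel word := fun u v => `[< pres_eq u v >].

Lemma pres_eqb_refl : reflexive pres_eqb.
Proof. by move=> u; apply/asboolP; exact: pres_refl. Qed.

Lemma pres_eqb_sym : symmetric pres_eqb.
Proof. by move=> u v; apply/asboolP/asboolP => h; exact: pres_sym. Qed.

Lemma pres_eqb_trans : transitive pres_eqb.
Proof.
move=> v u w /asboolP uv /asboolP vw; apply/asboolP; exact: pres_trans uv vw.
Qed.

Canonical pres_equiv :=
  EquivRel pres_eqb pres_eqb_refl pres_eqb_sym pres_eqb_trans.

Definition presented : Type := {eq_quot pres_eqb}.
HB.instance Definition _ := Choice.on presented.

Definition pres_pi (u : word) : presented := \pi_{eq_quot pres_eqb} u.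
Definition pres_repr (x : presented) : word := repr (x : {eq_quot pres_eqb}).

Lemma pres_reprK x : pres_pi (pres_repr x) = x.
Proof. exact: reprK. Qed.

Lemma pres_piP u v : (pres_pi u = pres_pi v) <-> pres_eq u v.
Proof.
by split=> [/eqmodP/asboolP//|uv]; apply/eqmodP/asboolP.
Qed.

Lemma pres_reprP u : pres_eq (pres_repr (pres_pi u)) u.
Proof. by apply/pres_piP; rewrite pres_reprK. Qed.

Lemma word_inv_cat u v : word_inv (u ++ v) = word_inv v ++ word_inv u.
Proof. by rewrite /word_inv map_cat rev_cat. Qed.

Lemma word_invK : involutive word_inv.
Proof.
move=> u; rewrite /word_inv map_rev revK -map_comp map_id_in //.
by move=> [x b] _ /=; rewrite negbK.
Qed.

Lemma pres_mulV u : pres_eq (u ++ word_inv u) [::].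
Proof.
elim/last_ind: u => [|u [x b] ih]; first exact: pres_refl.
rewrite -cats1 word_inv_cat -catA; apply: pres_trans ih.
apply: pres_cat; first exact: pres_refl.
rewrite catA -[X in pres_eq _ X]cat0s.
by apply: pres_cat; [exact: pres_cancel | exact: pres_refl].
Qed.

Lemma pres_Vmul u : pres_eq (word_inv u ++ u) [::].
Proof. by have := pres_mulV (word_inv u); rewrite word_invK. Qed.

Lemma pres_inv u v : pres_eq u v -> pres_eq (word_inv u) (word_inv v).
Proof.
move=> uv; apply: (@pres_trans _ (word_inv u ++ (v ++ word_inv v))).
  rewrite -[X in pres_eq X _]cats0; apply: pres_cat; first exact: pres_refl.
  exact/pres_sym/pres_mulV.
rewrite catA -[X in pres_eq _ X]cat0s; apply: pres_cat; last exact: pres_refl.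
apply: pres_trans (pres_Vmul u).
by apply: pres_cat; [exact: pres_refl | exact: pres_sym].
Qed.

Definition pres_one : presented := pres_pi [::].
Definition pres_mul (x y : presented) : presented :=
  pres_pi (pres_repr x ++ pres_repr y).
Definition pres_invg (x : presented) : presented :=
  pres_pi (word_inv (pres_repr x)).

Lemma pres_mulE u v : pres_mul (pres_pi u) (pres_pi v) = pres_pi (u ++ v).
Proof. by apply/pres_piP/pres_cat; exact: pres_reprP. Qed.

Lemma pres_invgE u : pres_invg (pres_pi u) = pres_pi (word_inv u).
Proof. by apply/pres_piP/pres_inv/pres_reprP. Qed.

Lemma pres_mulA : associative pres_mul.
Proof.
move=> x y z; rewrite -[x]pres_reprK -[y]pres_reprK -[z]pres_reprK.
by rewrite !pres_mulE catA.
Qed.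

Lemma pres_mul1g : left_id pres_one pres_mul.
Proof. by move=> x; rewrite -[x]pres_reprK pres_mulE. Qed.

Lemma pres_mulg1 : right_id pres_one pres_mul.
Proof. by move=> x; rewrite -[x]pres_reprK pres_mulE cats0. Qed.

Lemma pres_mulVg : left_inverse pres_one pres_invg pres_mul.
Proof.
move=> x; rewrite -[x]pres_reprK pres_invgE pres_mulE.
exact/pres_piP/pres_Vmul.
Qed.

Lemma pres_mulgV : right_inverse pres_one pres_invg pres_mul.
Proof.
move=> x; rewrite -[x]pres_reprK pres_invgE pres_mulE.
exact/pres_piP/pres_mulV.
Qed.

HB.instance Definition _ := isGroup.Build presented
  pres_mulA pres_mul1g pres_mulg1 pres_mulVg pres_mulgV.

Definition pres_gen (v : V) : presented := pres_pi [:: (v, true)].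

End Presentation.

Record sgraph (V : finType) := SGraph {
  edges :> {set {set V}};
  edges_card2 : [forall e in edges, #|e| == 2]
}.
HB.instance Definition _ (V : finType) := [isSub for @edges V].
HB.instance Definition _ (V : finType) := [Finite of sgraph V by <:].

Definition sgraph_adj (V : finType) (Gam : sgraph V) : rel V :=
  fun u v => [set u; v]%SET \in edges Gam.

Inductive racg_rels (V : finType) (Gam : sgraph V) : word V -> word V -> Prop :=
| racg_sqr w : racg_rels Gam [:: (w, true); (w, true)] [::]
| racg_comm u v : sgraph_adj Gam u v ->
    racg_rels Gam [:: (u, true); (v, true)] [:: (v, true); (u, true)].

Definition racg (V : finType) (Gam : sgraph V) : groupType :=
  presented (racg_rels Gam).

(* Thickness is recursive over subgroups, which are handled as classical sets
   in a fixed ambient group [G]; a notion intrinsic to a group is therefore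
   stated relative to a subgroup [H] of [G] and a finite generating set [S] of
   [H], whose choice does not matter. *)

Section Thickness.
Variable G : groupType.
Implicit Types (x y g h : G) (H K A B S T : set G).
Local Open Scope group_scope.

Definition subgroup H : Prop :=
  [/\ H 1, forall x y, H x -> H y -> H (x * y) & forall x, H x -> H x^-1].

Definition gen_subgroup A : set G := smallest subgroup A.

Definition fin_generating S H : Prop := finite_set S /\ gen_subgroup S = H.

Definition fin_generated H : Prop := exists S, fin_generating S H.

Definition has_word S x (n : nat) : Prop := exists w : seq G,
  [/\ size w = n, forall g, g \in w -> S g \/ S g^-1 & \prod_(g <- w) g = x].

(* Junk value [0] outside of the subgroup generated by [S]. *)
Definition word_length S x : nat :=
  if pselect (exists n, `[< has_word S x n >]) is left ex then ex_minn ex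
  else 0%N.

Definition word_dist S x y : nat := word_length S (x^-1 * y).

Definition left_coset g K : set G := [set g * k | k in K].

Definition finite_index K H : Prop :=
  subgroup K /\ K `<=` H /\ finite_set [set left_coset g K | g in H].

Definition direct_product A B H : Prop :=
  [/\ subgroup A, subgroup B, A `&` B = [set 1],
      forall a b, A a -> B b -> a * b = b * a
    & [set a * b | a in A & b in B] = H].

(* Quasi-isometric embedding of [K] for the word metrics; rounding the constants
   up to natural numbers and clearing the denominator is harmless. *)
Definition undistorted S K : Prop := exists T, fin_generating T K /\
  exists C c : nat, forall x y, K x -> K y ->
    (word_dist S x y <= C * word_dist T x y + c /\
     word_dist T x y <= C * word_dist S x y + c)%N.

Definition neighbourhood S H (r : nat) A : set G :=
  [set x | H x /\ exists2 a, A a & (word_dist S a x <= r)%N].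

Definition infinite_coarse_intersection S H A B : Prop := exists r : nat,
  infinite_set (neighbourhood S H r A `&` neighbourhood S H r B).

Definition thickly_connected S H (HH : set (set G)) : Prop :=
  forall x y, H x -> H y ->
  exists (m : nat) (g : nat -> G) (K : nat -> set G),
    [/\ forall i, (i <= m)%N -> H (g i) /\ HH (K i),
        left_coset (g 0%N) (K 0%N) x,
        left_coset (g m) (K m) y
      & forall i, (i < m)%N -> infinite_coarse_intersection S H
          (left_coset (g i) (K i)) (left_coset (g i.+1) (K i.+1))].

Fixpoint thick_at_most (n : nat) H : Prop :=
  if n is n'.+1 then
    exists S (HH : set (set G)),
      [/\ fin_generating S H,
          finite_set HH,
          forall K, HH K -> [/\ subgroup K, K `<=` H, undistorted S K
                              & thick_at_most n' K],
          finite_index (gen_subgroup (\bigcup_(K in HH) K)) H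
        & thickly_connected S H HH]
  else
    fin_generated H /\
    exists A B, [/\ infinite_set A, infinite_set B & direct_product A B H].

Definition thick_exactly_one : Prop :=
  thick_at_most 1 [set: G] /\ ~ thick_at_most 0 [set: G].

End Thickness.

Local Open Scope ring_scope.

Section Divergence.
Variables (R : realType) (X : Type) (d : X -> X -> R).

Definition continuous_path (f : R -> X) : Prop :=
  forall s, 0 <= s <= 1 -> forall e, 0 < e ->
  exists2 eta, 0 < eta &
    forall t, 0 <= t <= 1 -> `|s - t| < eta -> d (f s) (f t) < e.

Definition path_length (f : R -> X) : \bar R :=
  ereal_sup [set (\sum_(0 <= i < size s)
                    d (f (nth 1 (0 :: s) i)) (f (nth 1 (0 :: s) i.+1)))%:E
            | s in itv_partition (0 : R) 1].

Definition dist_to_pair (c a b : X) : R := Num.min (d c a) (d c b).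

(* The ball is open, so that it is empty when its radius is non-positive; paths
   of infinite length do not affect the infimum, which is [+oo] if no rectifiable
   path avoids the ball. *)
Definition div_pts (gam delta : R) (a b c : X) : \bar R :=
  ereal_inf [set path_length f | f in
    [set f : R -> X | [/\ continuous_path f, f 0 = a, f 1 = b &
       forall t, 0 <= t <= 1 ->
         ~ (d c (f t) < delta * dist_to_pair c a b - gam)]]].

Definition Div (gam delta : R) (x : R) : \bar R :=
  ereal_sup [set z | exists a b c, [/\ 0 < dist_to_pair c a b, d a b <= x
                                     & z = div_pts gam delta a b c]].

End Divergence.

Definition asymp_le (R : realType) (f g : R -> \bar R) : Prop :=
  exists2 C : R, 0 < C & forall x, 0 <= x ->
    (f x <= C%:E * g (C * x + C)%R + (C * x + C)%R%:E)%E.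

Definition asymp_eq (R : realType) (f g : R -> \bar R) : Prop :=
  asymp_le f g /\ asymp_le g f.

Section CayleyGraph.
Variables (R : realType) (G : groupType) (S : set G).

Definition cayley_adj (g h : G) : Prop :=
  g <> h /\ (S (g^-1 * h)%g \/ S (h^-1 * g)%g).

(* The point at distance [cpos] from [csrc] on the edge joining [csrc] to
   [ctgt].  A point may have several such descriptions (an edge can be travelled
   both ways, a vertex lies on several edges); they are at [cayley_dist] 0 from
   each other, so [cayley_dist] is a pseudometric whose metric quotient is the
   geometric realization with edges of length 1.  The degenerate case
   [csrc = ctgt] makes every vertex a point even if it has no neighbour. *)
Record cayley_point := CayleyPoint {
  csrc : G;
  ctgt : G;
  cpos : R;
  cpos_itv : 0 <= cpos <= 1;
  cpos_edge : cayley_adj csrc ctgt \/ (csrc = ctgt /\ cpos = 0)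
}.

Definition cayley_dist_vertex (x : cayley_point) (v : G) : R :=
  Num.min (cpos x + (word_dist S (csrc x) v)%:R)
          (1 - cpos x + (word_dist S (ctgt x) v)%:R).

Definition cayley_dist (x y : cayley_point) : R :=
  if (csrc x == csrc y) && (ctgt x == ctgt y) then `|cpos x - cpos y|
  else if (csrc x == ctgt y) && (ctgt x == csrc y) then
    `|cpos x - (1 - cpos y)|
  else Num.min (cpos y + cayley_dist_vertex x (csrc y))
               (1 - cpos y + cayley_dist_vertex x (ctgt y)).

End CayleyGraph.

Definition quadratic_divergence (R : realType) (G : groupType) : Prop :=
  fin_generated [set: G] /\
  forall S : set G, fin_generating S [set: G] ->
  exists delta0 gam0 : R, [/\ 0 < delta0, delta0 < 1, 0 <= gam0 &
    forall delta gam, 0 < delta <= delta0 -> gam0 <= gam ->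
      asymp_eq (Div (@cayley_dist R G S) gam delta)
               (fun x => (x ^+ 2)%:E)].

Section RandomGraph.
Variable R : realType.

Definition gnp_weight (n : nat) (p : R) (Gam : sgraph 'I_n) : R :=
  \prod_(e : {set 'I_n} | #|e| == 2) (if e \in edges Gam then p else 1 - p).

Definition gnp_prob (n : nat) (p : R) (P : sgraph 'I_n -> Prop) : R :=
  \sum_(Gam : sgraph 'I_n | `[< P Gam >]) gnp_weight p Gam.

Definition gnp_aas (p : nat -> R) (P : forall n, sgraph 'I_n -> Prop) : Prop :=
  (fun n => gnp_prob (p n) (P n)) @ \oo --> (1 : R).

End RandomGraph.

(* Main.v *)
(** A graph [Gam] whose complement is connected, and some component of whose
    graph of induced squares (two squares being adjacent if they share a
    diagonal) covers all the vertices, satisfies both conclusions.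

    A square generates a product of two infinite dihedral groups, and squares
    which share a diagonal meet in an infinite dihedral group; this gives
    thickness of order at most 1.  Pushing a path outwards along these dihedral
    lines replaces each of its letters by a detour of length linear in the
    radius, hence the quadratic upper bound on divergence.  A closed walk in the
    complement that visits every vertex spells an element with a geodesic axis.
    No wall can cross two walls of this axis which are a full period apart, as
    its type would be adjacent to every vertex; therefore a path that avoids a
    large ball about the axis has to travel about the radius between any two such
    walls, hence the quadratic lower bound, and the powers of the element have a
    centralizer which is too small for the group to split as a product of two
    infinite subgroups.

    It remains to find the squares.  For [p] bounded away from 0, any three
    vertices have linearly many common neighbours, which are not all adjacent to
    each other.  For small [p], fix a vertex [a] and split the other vertices into
    three parts [V1], [V2], [V3].  Link two non-neighbours [z], [w] of [a] in [V3]
    through [Vi] if they span squares with [a] which share a diagonal contained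
    in [Vi].  By expansion, the sets closed under the links through [V1] have more
    than about [1 / p] elements, so that there are only [2 ^ (n p)] of them; the
    edges between [V2] and [V3] are independent of this family, and a union bound
    over it shows that the links through [V2] connect it. *)
Require Import Defs.
From mathcomp Require Import all_boot all_order all_algebra.
From mathcomp Require Import all_classical all_reals all_analysis.
From mathcomp Require Import zify ring lra.
Import Order.TTheory GRing.Theory Num.Theory numFieldNormedType.Exports.
Set Implicit Arguments.
Unset Strict Implicit.
Unset Printing Implicit Defensive.

(** * Walls of a right-angled Coxeter group *)

(** Maps out of [racg Gam] are all obtained by letting the vertices act by involutions that commute
    along edges: on reflections with a sign, on the integers, on [bool], on the group itself. This
    replaces normal forms; lengths are bounded below by counting separating walls or by moving a
    point of a line.

    One obstacle shapes the sparse case. For [p] near [sqrt (log n / n)], three given vertices have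
    about [n p^3] common neighbours, which tends to 0, so two given diagonals through [a] usually
    lie opposite to no common diagonal, and connectedness must come from expansion. Expansion is
    linear only up to sets of size [1 / p]. A set of that size yields about [c1 / p] disjoint pairs,
    and a linear set of vertices misses them all with probability [exp (- C c1 n p)] for a constant
    [C]. This cannot pay for [2 ^ n] vertex sets, but it pays for [2 ^ (n p)] closed ones once [c1]
    is a large constant. Choosing the pairs costs a factor whose logarithm is again proportional to
    their number, which is why [k] can be fixed independently of [c1]. The condition [c1 p <= 1]
    separates the sparse range from the dense one. *)

Section InvolutionAction.
Variables (V : finType) (Gam : sgraph V) (M : Type) (act : V -> M -> M).
Hypothesis act_inv : forall v, involutive (act v).
Hypothesis act_adj : forall u v, sgraph_adj Gam u v ->
  forall m, act u (act v m) = act v (act u m).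

Definition word_act (u : word V) (m : M) : M :=
  foldr (fun x m => act x.1 m) m u.

Lemma word_act_cat u v m : word_act (u ++ v) m = word_act u (word_act v m).
Proof. by rewrite /word_act foldr_cat. Qed.

Lemma word_act_eq u v : pres_eq (racg_rels Gam) u v -> word_act u =1 word_act v.
Proof.
elim=> {u v} [u|u v _ IH|u v w _ IH1 _ IH2|u u' v v' _ IH1 _ IH2|x b|u v uv] m //.
- by rewrite IH1 IH2.
- by rewrite !word_act_cat IH2 IH1.
- by rewrite /= act_inv.
- by case: uv => [w|a b ab] /=; [rewrite act_inv | rewrite act_adj].
Qed.

Definition racg_act (g : racg Gam) (m : M) : M := word_act (pres_repr g) m.

Lemma racg_act1 m : racg_act 1%g m = m.
Proof. exact: (word_act_eq (pres_reprP _ _)). Qed.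

Lemma racg_actM g h m : racg_act (g * h)%g m = racg_act g (racg_act h m).
Proof.
by rewrite /racg_act -word_act_cat; apply: word_act_eq; exact: pres_reprP.
Qed.

Lemma racg_act_gen v m : racg_act (pres_gen (racg_rels Gam) v) m = act v m.
Proof. exact: (word_act_eq (pres_reprP _ _)). Qed.

End InvolutionAction.

Section Racg.
Variables (V : finType) (Gam : sgraph V).
Local Notation W := (racg Gam).
Local Notation adj := (sgraph_adj Gam).
Local Open Scope group_scope.
Implicit Types (g h r x y z : W) (s t v : V) (u w : seq V).

Definition gen v : W := pres_gen (racg_rels Gam) v.

Definition el u : W := foldr (fun v g => gen v * g) 1 u.

Lemma adj_sym s t : adj s t = adj t s.
Proof. by rewrite /sgraph_adj finset.setUC. Qed.

Lemma adj_irr s : adj s s = false.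
Proof.
apply/negP => /(forall_inP (edges_card2 Gam)).
by rewrite finset.setUid cards1.
Qed.

Lemma gen_sqr v : gen v * gen v = 1.
Proof. by rewrite [LHS]pres_mulE; apply/pres_piP/pres_rel/racg_sqr. Qed.

Lemma genV v : (gen v)^-1 = gen v.
Proof. by apply: mulg1_eq; exact: gen_sqr. Qed.

Lemma genK v : involutive ( *%g (gen v)).
Proof. by move=> g; rewrite mulgA gen_sqr mul1g. Qed.

Lemma mulg_genK g v : g * gen v * gen v = g.
Proof. by rewrite -mulgA gen_sqr mulg1. Qed.

Lemma gen_adj s t : adj s t -> gen s * gen t = gen t * gen s.
Proof.
by move=> st; rewrite [LHS]pres_mulE [RHS]pres_mulE; apply/pres_piP/pres_rel/racg_comm.
Qed.

Lemma el_cat u w : el (u ++ w) = el u * el w.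
Proof. by elim: u => [|v u IH] /=; rewrite ?mul1g // IH mulgA. Qed.

Lemma el1 v : el [:: v] = gen v. Proof. by rewrite /= mulg1. Qed.

Lemma el_rcons u v : el (rcons u v) = el u * gen v.
Proof. by rewrite -cats1 el_cat el1. Qed.

Lemma el_rev u : el (rev u) = (el u)^-1.
Proof.
elim: u => [|v u IH]; first by rewrite invg1.
by rewrite rev_cons el_rcons IH /= invgM genV.
Qed.

Lemma el_surj g : exists u, g = el u.
Proof.
rewrite -[g]pres_reprK; elim: (pres_repr g) => [|[v b] u [w ew]]; first by exists [::].
exists (v :: w); rewrite -cat1s -pres_mulE ew /=; congr (_ * _).
case: b => //; rewrite -[RHS]genV.
by rewrite [RHS]pres_invgE.
Qed.

Lemma len_ex g : exists n, `[< exists2 u, size u = n & g = el u >].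
Proof. by have [u ->] := el_surj g; exists (size u); apply/asboolP; exists u. Qed.

Definition len g : nat := ex_minn (len_ex g).

Lemma len_word g : exists2 u, size u = len g & g = el u.
Proof. by rewrite /len; case: ex_minnP => n /asboolP. Qed.

Lemma len_el u : (len (el u) <= size u)%N.
Proof.
rewrite /len; case: ex_minnP => n _; apply; apply/asboolP; by exists u.
Qed.

Lemma lenM g h : (len (g * h) <= len g + len h)%N.
Proof.
have [u <- {1}->] := len_word g; have [w <- {1}->] := len_word h.
by rewrite -el_cat -size_cat len_el.
Qed.

Lemma lenV g : len g^-1 = len g.
Proof.
suff H h : (len h^-1 <= len h)%N by apply/eqP; rewrite eqn_leq H -{1}[g]invgK H.
by have [u <- {1}->] := len_word h; rewrite -el_rev -(size_rev u) len_el.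
Qed.

Lemma len1 : len 1 = 0%N.
Proof. by apply/eqP; rewrite -leqn0 (len_el [::]). Qed.

Lemma len_gen v : (len (gen v) <= 1)%N.
Proof. by rewrite -el1 len_el. Qed.

Lemma len_tri x y z : (len (x^-1 * z) <= len (x^-1 * y) + len (y^-1 * z))%N.
Proof. by have := lenM (x^-1 * y) (y^-1 * z); rewrite mulgA mulgK. Qed.

Lemma len_sym x y : len (x^-1 * y) = len (y^-1 * x).
Proof. by rewrite -lenV invgM invgK. Qed.

(* The action of [W] on [W * bool] records, in the second component, the parity
   of the number of times a gallery crosses the wall of the reflection in the
   first component. *)
Definition wall_act v (m : W * bool) : W * bool :=
  (gen v * m.1 * gen v, m.2 (+) (m.1 == gen v)).

Lemma conj_gen_eq v x y : (gen v * x * gen v == y) = (x == gen v * y * gen v).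
Proof.
apply/eqP/eqP => [<-|->]; rewrite -!mulgA gen_sqr mulg1 !mulgA gen_sqr mul1g //.
Qed.

Lemma wall_act_inv v : involutive (wall_act v).
Proof.
case=> x b; rewrite /wall_act /=; congr (_, _).
  by rewrite -!mulgA gen_sqr mulg1 !mulgA gen_sqr mul1g.
by rewrite conj_gen_eq gen_sqr mul1g addbK.
Qed.

Lemma wall_act_adj s t : adj s t ->
  forall m, wall_act s (wall_act t m) = wall_act t (wall_act s m).
Proof.
move=> /gen_adj st [x b]; rewrite /wall_act /=; congr (_, _).
  by rewrite !mulgA st -!mulgA st.
by rewrite !conj_gen_eq -st -mulgA gen_sqr mulg1 st -mulgA gen_sqr mulg1 addbAC.
Qed.

Local Notation wact := (racg_act wall_act).

(* [side r g] tells whether the wall of [r] separates [1] from [g]. *)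
Definition side r g : bool := (wact g^-1 (r, false)).2.

Definition sep r x y : bool := side r x (+) side r y.

Let wM := @racg_actM _ Gam _ _ wall_act_inv wall_act_adj.
Let w1 := @racg_act1 _ Gam _ _ wall_act_inv wall_act_adj.
Let wg := @racg_act_gen _ Gam _ _ wall_act_inv wall_act_adj.

Lemma wact_fst g m b : (wact g (m, b)).1 = g * m * g^-1.
Proof.
have [u ->] := el_surj g.
elim: u => [|v u IH] /=; first by rewrite w1 mul1g invg1 mulg1.
by rewrite wM wg /= IH invgM genV !mulgA.
Qed.

Lemma wact_snd g m b : (wact g (m, b)).2 = (wact g (m, false)).2 (+) b.
Proof.
have [u ->] := el_surj g.
elim: u => [|v u IH] /=; first by rewrite !w1.
by rewrite !wM !wg /= IH !wact_fst addbAC.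
Qed.

Lemma side1 r : side r 1 = false.
Proof. by rewrite /side invg1 (racg_act1 wall_act_inv wall_act_adj). Qed.

(** The gallery of [g * h] is that of [g] followed by the [g]-translate of that of [h], so for the
    second half the wall is carried back by [g]. *)
Lemma sideM r g h : side r (g * h) = side r g (+) side (g^-1 * r * g) h.
Proof.
rewrite /side invgM wM.
case E: (wact g^-1 (r, false)) => [x c]; have := wact_fst g^-1 r false.
by rewrite E /= invgK => ->; rewrite wact_snd addbC.
Qed.

Lemma side_gen r v : side r (gen v) = (r == gen v).
Proof.
by rewrite /side genV (racg_act_gen wall_act_inv wall_act_adj).
Qed.

Lemma sep_refl r x : sep r x x = false. Proof. exact: addbb. Qed.
Lemma sep_sym r x y : sep r x y = sep r y x. Proof. exact: addbC. Qed.
Lemma sepD r x y z : sep r x z = sep r x y (+) sep r y z.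
Proof. by rewrite /sep -addbA addKb. Qed.

Lemma sepE r x y : sep r x y = side (x^-1 * r * x) (x^-1 * y).
Proof. by rewrite /sep -[y in LHS](mulVKg x) sideM addKb. Qed.

Lemma sep_gen r x v : sep r x (x * gen v) = (r == x * gen v * x^-1).
Proof.
rewrite sepE mulKg side_gen -(inj_eq (mulgI x)) -(inj_eq (mulIg x^-1)).
by rewrite !mulgA mulgV mul1g mulgK.
Qed.

Lemma sepJ h r x y : sep (h * r * h^-1) (h * x) (h * y) = sep r x y.
Proof. by rewrite !sepE invgM !mulgA !mulgVK. Qed.

Lemma sep_conj x h y : sep (x * h * x^-1) x y = side h (x^-1 * y).
Proof. by rewrite sepE !mulgA mulVg mul1g mulgVK. Qed.

Lemma side_sep r g : side r g = sep r 1 g.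
Proof. by rewrite /sep side1. Qed.

Fixpoint walls x u : seq W :=
  if u is v :: u' then x * gen v * x^-1 :: walls (x * gen v) u' else [::].

Lemma size_walls x u : size (walls x u) = size u.
Proof. by elim: u x => //= v u IH x; rewrite IH. Qed.

Lemma walls_cat x u w : walls x (u ++ w) = walls x u ++ walls (x * el u) w.
Proof. by elim: u x => [|v u IH] x /=; rewrite ?mulg1 // IH mulgA. Qed.

Lemma sep_count r x u : sep r x (x * el u) = odd (count_mem r (walls x u)).
Proof.
elim: u x => [|v u IH] x /=; first by rewrite mulg1 sep_refl.
by rewrite (sepD _ _ (x * gen v)) sep_gen mulgA IH oddD eq_sym oddb.
Qed.

Lemma sep_mem r x u : sep r x (x * el u) -> r \in walls x u.
Proof. by rewrite sep_count -has_pred1 has_count; case: (count _ _). Qed.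

(** The exchange condition: reflecting the initial part of a gallery, up to the point where it
    crosses the wall, deletes the crossing letter. *)
Lemma walls_exchange r x u : r \in walls x u ->
  exists u1 v u2, [/\ u = u1 ++ v :: u2, r = (x * el u1) * gen v * (x * el u1)^-1
    & r * (x * el u) = x * el (u1 ++ u2)].
Proof.
elim: u x => //= v u IH x; rewrite inE => /orP[/eqP ->|/IH].
  exists [::], v, u; split=> //=; first by rewrite mulg1.
  by rewrite !mulgA mulgVK mulg_genK.
case=> u1 [v' [u2 [-> rE E]]]; exists (v :: u1), v', u2; split=> //=.
  by rewrite mulgA.
by rewrite [x * _]mulgA E mulgA.
Qed.

Lemma side_len r g : side r g -> (len (r * g) < len g)%N.
Proof.
rewrite side_sep; have [u <- ->] := len_word g; rewrite -[el u]mul1g => /sep_mem.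
case/walls_exchange => u1 [v [u2 [-> _ ->]]]; rewrite mul1g.
by apply: leq_ltn_trans (len_el _) _; rewrite !size_cat /= addnS.
Qed.

Definition reduced u := size u = len (el u).

(** A wall crossed twice allows two letters to be deleted: the exchange removes the second crossing,
    and the same reflection absorbs the first. *)
Lemma reduced_uniq x u : reduced u -> uniq (walls x u).
Proof.
move=> red; apply/negPn/negP => nu.
have [w sw ew] : exists2 w, (size w < size u)%N & x * el w = x * el u; last first.
  by have := len_el w; rewrite (mulgI _ _ _ ew) -red leqNgt sw.
elim: u x nu {red} => //= v u IH x; rewrite negb_and negbK.
case/orP=> [|/IH[w sw ew]]; last first.
  by exists (v :: w); rewrite //= mulgA ew mulgA.
case/walls_exchange => u1 [v' [u2 [-> _ E]]].
exists (u1 ++ u2); first by rewrite !size_cat /= !addnS ltnS leqnSn.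
have {E}-> : el (u1 ++ v' :: u2) = gen v * el (u1 ++ u2); last by rewrite genK.
by apply: (mulgI x); rewrite mulgA -E !mulgA mulgVK mulg_genK.
Qed.

Lemma reduced_sep r x u : reduced u -> (r \in walls x u) = sep r x (x * el u).
Proof.
move=> /(reduced_uniq x) uu; rewrite sep_count count_uniq_mem //.
by case: (r \in _).
Qed.

(** Any gallery must cross each wall that separates its ends. This is the source of the lower bounds
    on distances to and along the axis. *)
Lemma uniq_sep_len (rs : seq W) x y : uniq rs -> {in rs, forall r, sep r x y} ->
  (size rs <= len (x^-1 * y))%N.
Proof.
move=> urs Hrs; have [u eu xy] := len_word (x^-1 * y).
have yE : y = x * el u by rewrite -xy mulVKg.
rewrite -eu -(size_walls x); apply: uniq_leq_size => // r /Hrs.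
by rewrite yE => /sep_mem.
Qed.

Lemma geodesic x y : exists u, [/\ y = x * el u, size u = len (x^-1 * y) & reduced u].
Proof.
have [u eu xy] := len_word (x^-1 * y); exists u; split=> //.
  by rewrite -xy mulVKg.
by rewrite /reduced -xy.
Qed.

Lemma reducedP u1 u2 : reduced (u1 ++ u2) -> reduced u1 /\ reduced u2.
Proof.
rewrite /reduced size_cat el_cat => H.
have := lenM (el u1) (el u2); have := len_el u1; have := len_el u2; lia.
Qed.

End Racg.

(** * The line of an infinite dihedral subgroup *)

Fixpoint alt (V : Type) n (s t : V) : seq V :=
  if n is n'.+1 then s :: alt n' t s else [::].

Section Dihedral.
Variables (V : finType) (Gam : sgraph V) (s t : V).
Local Notation W := (racg Gam).
Local Notation adj := (sgraph_adj Gam).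
Local Notation gen := (gen Gam).
Local Notation el := (el Gam).
Local Open Scope group_scope.
Hypothesis st_neq : s != t.
Hypothesis st_nadj : ~~ adj s t.

(* The action of [W] on the line of the infinite dihedral group [<s, t>]. *)
Definition dih_act (v : V) (x : int) : int :=
  (if v == s then - x else if v == t then 1 - x else x)%R.

Lemma dih_act_inv v : involutive (dih_act v).
Proof. by move=> x; rewrite /dih_act; case: (v == s); [|case: (v == t)]; lia. Qed.

Lemma dih_act_adj u v : adj u v ->
  forall m, dih_act u (dih_act v m) = dih_act v (dih_act u m).
Proof.
move=> uv m; rewrite /dih_act.
case: (eqVneq u s) => [us|us]; case: (eqVneq v s) => [vs|vs] //.
- case: (eqVneq v t) => [vt|//]; by move: st_nadj; rewrite -us -vt uv.
- case: (eqVneq u t) => [ut|//]; by move: st_nadj; rewrite -vs -ut adj_sym uv.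
- by case: (u == t); case: (v == t).
Qed.

Definition dih (g : W) (x : int) : int := racg_act dih_act g x.

Lemma dihM g h x : dih (g * h) x = dih g (dih h x).
Proof. exact: (racg_actM dih_act_inv dih_act_adj). Qed.

Lemma dih1 x : dih 1 x = x.
Proof. exact: (racg_act1 dih_act_inv dih_act_adj). Qed.

Lemma dih_gen v x : dih (gen v) x = dih_act v x.
Proof. exact: (racg_act_gen dih_act_inv dih_act_adj). Qed.

Lemma dih_isom g x y : `|(dih g x - dih g y)%R|%N = `|(x - y)%R|%N.
Proof.
have [u ->] := el_surj g; elim: u x y => [|v u IH] x y /=; first by rewrite !dih1.
rewrite !dihM !dih_gen -(IH x y) /dih_act; case: (v == s); [|case: (v == t)]; lia.
Qed.

Definition lin g : int := dih g 0%R.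

Lemma lin_len g : (`|lin g| <= len g)%N.
Proof.
have [u <- {1}->] := len_word g; rewrite /lin.
elim: u => [|v u IH] /=; first by rewrite dih1.
by rewrite dihM dih_gen /dih_act; case: (v == s); [|case: (v == t)]; lia.
Qed.

Lemma lin_lip x y : (`|(lin x - lin y)%R| <= len (x^-1 * y))%N.
Proof.
apply: leq_trans (lin_len _); rewrite -(dih_isom x^-1) /lin -!dihM mulVg dih1.
by rewrite -abszN opprB subr0.
Qed.

(** The base point [0] is fixed by [s] and moved to [1] by [t]. Hence a unit step costs two letters,
    and the words starting with [s] and those starting with [t] run along opposite rays. *)
Lemma lin_alt n : lin (el (alt n s t)) = (- Posz n./2)%R /\
                  lin (el (alt n t s)) = Posz (uphalf n).
Proof.
rewrite /lin; elim: n => [|n [IH1 IH2]] /=; first by rewrite !dih1.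
rewrite !dihM !dih_gen IH1 IH2 /dih_act eqxx eqxx.
by rewrite eq_sym (negbTE st_neq); split; lia.
Qed.

Lemma lin_other u : {in u, forall v, v != s /\ v != t} -> forall x, dih (el u) x = x.
Proof.
elim: u => [|v u IH] Hu x /=; first by rewrite dih1.
rewrite dihM IH; last by move=> w wu; apply: Hu; rewrite inE wu orbT.
by rewrite dih_gen /dih_act; have [/negbTE-> /negbTE->] := Hu v (mem_head _ _).
Qed.

End Dihedral.

(** * Crossing walls and their types *)

Section Walls.
Variables (V : finType) (Gam : sgraph V).
Local Notation W := (racg Gam).
Local Notation adj := (sgraph_adj Gam).
Local Notation gen := (gen Gam).
Local Notation el := (el Gam).
Local Open Scope group_scope.
Implicit Types (g h r x y z : W) (s t v : V) (u w : seq V).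

Lemma alt_even_rcons n s t : el (alt n.*2.+1 s t) = el (alt n.*2 s t) * gen s.
Proof.
elim: n => [|n IH]; first by rewrite /= mulg1 mul1g.
by rewrite doubleS; move: IH => /= ->; by rewrite !mulgA.
Qed.

Lemma side_alt r n s t : side r (el (alt n s t)) ->
  exists i, r = el (alt i.*2.+1 s t).
Proof.
elim: n r s t => [|n IH] r s t /=; first by rewrite side1.
rewrite sideM side_gen; case: eqVneq => [-> _|_ /=].
  by exists 0; rewrite /= mulg1.
rewrite genV => /IH[i E]; exists i.+1.
rewrite -[RHS]/(el (alt i.+1.*2.+1 s t)) alt_even_rcons doubleS.
have -> : el (alt i.*2.+2 s t) = gen s * el (alt i.*2.+1 t s) by [].
by rewrite -E !mulgA gen_sqr mul1g mulg_genK.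
Qed.

Lemma word2_alt s t w : all (pred2 s t) w ->
  exists n, el w = el (alt n s t) \/ el w = el (alt n t s).
Proof.
elim: w => [|v w IH] /=; first by exists 0; left.
case/andP => vst /IH[n [E|E]]; rewrite E.
- case/pred2P: vst => ->; last by exists n.+1; right.
  case: n {E} => [|n]; first by exists 1%N; left.
  by exists n; right; rewrite /= genK.
- case/pred2P: vst => ->; first by exists n.+1; left.
  case: n {E} => [|n]; first by exists 1%N; right.
  by exists n; left; rewrite /= genK.
Qed.

(* Take [g0] of minimal length in the coset [<s, t> g]: no reflection of
   [<s, t>] separates it from [1], so [s] and [t] separate [1] from [g] iff they
   separate [1] from the dihedral factor [g g0^-1]. *)
Lemma side_nadj s t g : s != t -> ~~ adj s t ->
  side (gen s) g -> side (gen t) g -> False.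
Proof.
move=> neq nadj sg tg.
pose P n := `[< exists g0 w, [/\ len g0 = n, all (pred2 s t) w & g = el w * g0] >].
have exP : exists n, P n.
  by exists (len g); apply/asboolP; exists g, [::]; rewrite mul1g.
case: (ex_minnP exP) => n /asboolP[g0 [w [g0n wst gE]]] nmin {exP}.
have g0side w' : all (pred2 s t) w' -> side (el w') g0 = false.
  move=> w'st; apply/negP => /side_len; rewrite g0n ltnNge => /negP; apply.
  apply: nmin; apply/asboolP; exists (el w' * g0), (w ++ rev w'); split=> //.
    by rewrite all_cat wst all_rev.
  by rewrite el_cat el_rev mulgA mulgVK.
have key v : v \in [:: s; t] -> side (gen v) (el w).
  move=> vst; have : side (gen v) g by move: vst; rewrite !inE => /pred2P[]->.
  rewrite gE sideM => /idP; have -> : side ((el w)^-1 * gen v * el w) g0 = false.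
    have -> : (el w)^-1 * gen v * el w = el (rev w ++ [:: v] ++ w).
      by rewrite !el_cat el_rev el1 mulgA.
    apply: g0side; rewrite !all_cat all_rev wst /= andbT andbT.
    by move: vst; rewrite !inE.
  by rewrite addbF.
have [m [E|E]] := word2_alt wst; rewrite E in key.
  have /side_alt[i Ei] := key t (mem_last s [:: t]).
  have := lin_alt neq nadj i.*2.+1; rewrite -Ei /lin dih_gen // /dih_act.
  by rewrite eq_sym (negbTE neq) eqxx => -[]; lia.
have /side_alt[i Ei] := key s (mem_head s [:: t]).
have := lin_alt neq nadj i.*2.+1; rewrite -Ei /lin dih_gen // /dih_act.
by rewrite eqxx => -[]; lia.
Qed.

(** This action gives the character of the group to the integers modulo 2 that counts the letter
    [v]. It is constant on conjugates, which makes the type of a wall well defined. *)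
Definition type_act (v u : V) (b : bool) := b (+) (u == v).

Lemma type_act_inv v s : involutive (type_act v s).
Proof. by move=> b; rewrite /type_act addbK. Qed.

Lemma type_act_adj v s t : adj s t ->
  forall b, type_act v s (type_act v t b) = type_act v t (type_act v s b).
Proof. by move=> _ b; rewrite /type_act addbAC. Qed.

Definition parity v g : bool := racg_act (type_act v) g false.

Lemma parity_gen v s : parity v (gen s) = (s == v).
Proof. by rewrite /parity (racg_act_gen (type_act_inv v) (type_act_adj v)). Qed.

Lemma parityM v g h : parity v (g * h) = parity v g (+) parity v h.
Proof.
rewrite /parity (racg_actM (type_act_inv v) (type_act_adj v)).
move: (racg_act _ h false) => b; have [u ->] := el_surj g.
elim: u b => [|s u IH] b /=.
  by rewrite !(racg_act1 (type_act_inv v) (type_act_adj v)).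
rewrite !(racg_actM (type_act_inv v) (type_act_adj v)).
rewrite !(racg_act_gen (type_act_inv v) (type_act_adj v)) IH.
by rewrite /type_act addbAC.
Qed.

Lemma parity1 v : parity v 1 = false.
Proof. exact: (racg_act1 (type_act_inv v) (type_act_adj v)). Qed.

Lemma parityV v g : parity v g^-1 = parity v g.
Proof.
have := parityM v g^-1 g; rewrite mulVg parity1.
by case: (parity v g); case: (parity v g^-1).
Qed.

Definition wall_of r s := exists h, r = h * gen s * h^-1.

Lemma wall_of_inj r s t : wall_of r s -> wall_of r t -> s = t.
Proof.
case=> h ->; case=> h' E; have {E} := congr1 (parity t) E.
rewrite !parityM !parityV !parity_gen addbAC addbb addbAC addbb eqxx.
by move/eqP.
Qed.

Lemma gen_inj : injective gen.
Proof.
by move=> s t /(congr1 (parity t)); rewrite !parity_gen eqxx => /eqP.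
Qed.

(** Let [t] be the first letter of [u]. As [gen s] commutes with the element, both [s] and [t]
    separate [1] from [gen s * el (t :: u)], and [side_nadj] forces [s] and [t] to be adjacent; then
    [t] can be stripped off. *)
Lemma centralizer_letters s u : reduced Gam u ->
  gen s * el u = el u * gen s -> side (gen s) (el u) = false -> all (adj s) u.
Proof.
elim: u => //= t u IH red comm ns.
have tu : side (gen t) (el (t :: u)).
  rewrite side_sep -[el _]mul1g -reduced_sep //= inE.
  by rewrite invg1 mul1g mulg1 eqxx.
have ts : s != t by apply: contraFneq ns => ->.
have st : adj s t.
  apply: contraT => nst; case: (@side_nadj s t (gen s * el (t :: u)) ts nst).
    by rewrite sideM side_gen eqxx genV gen_sqr mul1g ns.
  move: comm tu; rewrite -[gen t * el u]/(el (t :: u)); move: (el (t :: u)) => c comm tu.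
  rewrite comm sideM tu side_gen.
  suff -> : (c^-1 * gen t * c == gen s) = false by [].
  apply: contraNF ts => /eqP E; have : gen t = c * gen s * c^-1.
    by rewrite -E !mulgA mulgV mul1g mulgK.
  by rewrite -comm mulgK => /gen_inj ->.
have st' := gen_adj st.
rewrite st /=; apply: IH; first by case: (@reducedP _ Gam [:: t] u red).
  by apply: (mulgI (gen t)); rewrite mulgA -st' -mulgA comm mulgA.
have := ns; rewrite sideM side_gen (inj_eq gen_inj) (negbTE ts) genV /=.
by rewrite -st' mulg_genK.
Qed.

(** Vertices [y] and [z] on the same side of the carrier of [r] differ by an element commuting with
    [gen s], so every letter between them is adjacent to [s]; one of these letters crosses [r']. *)
Lemma cross_adj r r' y z s s' : r = y * gen s * y^-1 -> r = z * gen s' * z^-1 ->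
  sep r y z = false -> sep r' y z -> exists2 v, adj s v & wall_of r' v.
Proof.
move=> ry rz nr r'yz; have [u [zE uE red]] := geodesic y z.
have ss : s' = s by apply: (@wall_of_inj r); [exists z | exists y].
subst s'; have uyz : el u = y^-1 * z by rewrite zE mulKg.
have /allP adju : all (adj s) u.
  apply: centralizer_letters => //; rewrite uyz.
    have E1 : gen s = y^-1 * r * y by rewrite ry !mulgA mulVg mul1g mulgVK.
    have E2 : gen s = z^-1 * r * z by rewrite rz !mulgA mulVg mul1g mulgVK.
    by rewrite [in LHS]E1 [in RHS]E2 !mulgA !mulgK.
  by move: nr; rewrite sepE ry !mulgA mulVg mul1g mulgVK.
move: r'yz; rewrite zE => /sep_mem /walls_exchange[u1 [v [u2 [uu r'E _]]]].
exists v; first by apply: adju; rewrite uu mem_cat inE eqxx orbT.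
by exists (y * el u1).
Qed.

Lemma crossing_vertex r r' x y : sep r x y -> sep r' x y = false ->
  exists z s, [/\ r = z * gen s * z^-1, sep r' x z = false & sep r x z = false].
Proof.
have [u [-> uE red]] := geodesic x y => rxy r'xy.
have := rxy; rewrite -reduced_sep // => /walls_exchange[u1 [v [u2 [uu rE _]]]].
exists (x * el u1), v; split=> //.
  apply: contraFF r'xy => /sep_mem r'1.
  by rewrite -reduced_sep // uu walls_cat mem_cat r'1.
apply/negP => /sep_mem r1; have := reduced_uniq x red.
by rewrite uu walls_cat cat_uniq /= -rE r1 /= andbF.
Qed.

(** Two walls that meet in all four quadrants cross. A geodesic from [x1] to [x2] and one from [x3]
    to [x4] provide vertices on the carrier of [r] on the two sides of [r'], and [cross_adj] applies
    between them. *)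
Lemma quadrants_adj r r' x1 x2 x3 x4 :
  sep r x1 x2 -> sep r' x1 x2 = false -> sep r x3 x4 -> sep r' x3 x4 = false ->
  sep r' x1 x3 -> exists s v, [/\ wall_of r s, wall_of r' v & adj s v].
Proof.
move=> r12 n12 r34 n34 r13.
have [y [s [ry r'y _]]] := crossing_vertex r12 n12.
have [z0 [s0 [rz0 r'z0 _]]] := crossing_vertex r34 n34.
have [z [s' [rz r'z nyz]]] : exists z s', [/\ r = z * gen s' * z^-1,
    sep r' x3 z = false & sep r y z = false].
  (* If [z0] lies on the wrong side of [r], its neighbour across [r] is taken instead; it is on the
     same side of [r'] because [r] and [r'] are distinct. *)
  case E: (sep r y z0); last by exists z0, s0.
  exists (z0 * gen s0), s0; split.
  - by rewrite mulg_genK invgM genV mulgA.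
  - rewrite (sepD _ _ z0) r'z0 sep_gen -rz0; apply/eqP => r'r.
    by move: r12; rewrite -r'r n12.
  - by rewrite (sepD _ _ z0) E sep_gen -rz0 eqxx.
have r'yz : sep r' y z by rewrite (sepD _ _ x1) (sepD _ x1 x3) r13 r'z sep_sym r'y.
have [v sv r'v] := cross_adj ry rz nyz r'yz.
by exists s, v; split=> //; exists y.
Qed.

End Walls.

(** * The axis of an element of full support *)

Section Axis.
Variables (V : finType) (Gam : sgraph V).
Local Notation W := (racg Gam).
Local Notation adj := (sgraph_adj Gam).
Local Notation gen := (gen Gam).
Local Notation el := (el Gam).
Local Open Scope group_scope.
Implicit Types (g h r x y z : W) (s t v : V) (u w : seq V).

Variables (letter : nat -> V) (m : nat).
Hypothesis m_gt0 : (0 < m)%N.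
Hypothesis letter_period : forall i, letter (i + m) = letter i.
Hypothesis letter_onto : forall i v, exists k, (i < k <= i + m)%N /\ letter k = v.
Hypothesis letter_nadj : forall i,
  letter i != letter i.+1 /\ ~~ adj (letter i) (letter i.+1).

Fixpoint axis (i : nat) : W :=
  if i is j.+1 then axis j * gen (letter j) else 1.

Definition axis_wall i : W := axis i * gen (letter i) * (axis i)^-1.

Definition beyond i g := sep (axis_wall i) (axis i) g.

Lemma axis_wallE i :
  axis_wall i = axis i.+1 * gen (letter i) * (axis i.+1)^-1.
Proof. by rewrite /axis_wall /= mulg_genK invgM genV mulgA. Qed.

Lemma axis_wall_type i : wall_of (axis_wall i) (letter i).
Proof. by exists (axis i). Qed.

Lemma beyondS i g : beyond i.+1 g -> beyond i g.
Proof.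
rewrite /beyond; have [neq nadj] := letter_nadj i.
rewrite (sepD _ (axis i) (axis i.+1) g) [sep _ (axis i) _]sep_gen eqxx addTb.
rewrite (axis_wallE i) /axis_wall !sep_conj => H.
by apply/negP => H'; exact: (side_nadj neq nadj H' H).
Qed.

Lemma beyond_le i j g : (i <= j)%N -> beyond j g -> beyond i g.
Proof.
move=> /subnK <-; elim: (j - i)%N => //= k IH; rewrite addSn => /beyondS //.
Qed.

Lemma beyond_axis i j : beyond i (axis j) = (i < j)%N.
Proof.
case: ltnP => [ij|ji].
  case: j ij => // j; rewrite ltnS => ij; apply: (beyond_le ij).
  by rewrite /beyond /= sep_gen eqxx.
by apply/negP => /(beyond_le ji); rewrite /beyond sep_refl.
Qed.

Lemma sep_axis i j k :
  sep (axis_wall i) (axis j) (axis k) = ((i < j) (+) (i < k))%N.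
Proof. by rewrite -!beyond_axis (sepD _ _ (axis i)) sep_sym. Qed.

Lemma axis_wall_inj : injective axis_wall.
Proof.
suff H i j : (i < j)%N -> axis_wall i <> axis_wall j.
  by move=> i j E; case: (ltngtP i j) => // /H //; rewrite E.
move=> ij E; have := sep_axis i i i.+1.
by rewrite E sep_axis ltnn ltnSn [(j < i)%N]ltnNge (ltnW ij) ltnS leqNgt ij.
Qed.

Lemma sep_axis_wall r i k : sep r (axis i) (axis (i + k)) ->
  exists j, [/\ (i <= j)%N, (j < i + k)%N & r = axis_wall j].
Proof.
elim: k => [|k IH]; first by rewrite addn0 sep_refl.
rewrite addnS (sepD _ _ (axis (i + k))) /= sep_gen.
case: eqVneq => [rE _|_]; last first.
  by rewrite addbF => /IH[j [ij jk ->]]; exists j; split=> //; rewrite ltnS ltnW.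
by exists (i + k)%N; rewrite leq_addr ltnS leqnn.
Qed.

Lemma len_axis_le i k : (len ((axis i)^-1 * axis (i + k)) <= k)%N.
Proof.
elim: k => [|k IH]; first by rewrite addn0 mulVg len1.
rewrite addnS /= mulgA; apply: leq_trans (lenM _ _) _.
by rewrite -addn1 leq_add // len_gen.
Qed.

Lemma len_axis i k : len ((axis i)^-1 * axis (i + k)) = k.
Proof.
apply/eqP; rewrite eqn_leq len_axis_le /=.
have := @uniq_sep_len _ Gam [seq axis_wall j | j <- iota i k] (axis i) (axis (i + k)).
rewrite size_map size_iota; apply.
  by rewrite map_inj_uniq ?iota_uniq //; exact: axis_wall_inj.
move=> r /mapP[j]; rewrite mem_iota => /andP[ij jk] ->.
by rewrite sep_axis jk ltnNge ij.
Qed.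

Lemma axis_add k i : axis (k * m + i) = axis m ^+ k * axis i.
Proof.
have letterk l j : letter (l * m + j) = letter j.
  by elim: l => // l IH; rewrite mulSn -addnA addnC letter_period.
have axisk l j : axis (l * m + j) = axis (l * m) * axis j.
  elim: j => [|j IH]; first by rewrite addn0 mulg1.
  by rewrite addnS /= IH letterk mulgA.
rewrite axisk; congr (_ * _).
elim: k => [|l IH]; first by rewrite mul0n expg0.
by rewrite mulSn expgSr -IH addnC axisk.
Qed.

Definition on_carrier r x := exists s, r = x * gen s * x^-1.

(* Such an [r] would cross every axis wall between [i] and [i + m], hence its
   type would be adjacent to every vertex, itself included. *)
Lemma no_common_crossing i r x y :
  on_carrier (axis_wall i) x -> beyond i x -> beyond (i + m) y ->
  sep r x (axis i.+1) -> ~~ sep r (axis i.+1) (axis (i + m).+1) ->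
  sep r x y.
Proof.
move=> [s xs] bx byy rx nr; apply: contraT => nrxy.
have cross k : (i < k)%N -> (k <= i + m)%N ->
  exists2 v, wall_of r v & adj (letter k) v.
  move=> ik km.
  (* [x] has only just crossed the wall [i]. Were it beyond [k], its neighbour back across [i] would
     still be beyond [k], hence beyond [i]. *)
  have nbx : ~~ beyond k x.
    apply/negP => bkx.
    have : beyond k (x * gen s).
      rewrite /beyond (sepD _ _ x) [sep _ _ x]bkx sep_gen -xs.
      by rewrite (inj_eq axis_wall_inj) eqn_leq leqNgt ik.
    move/(beyond_le (ltnW ik)); apply/negP.
    by rewrite /beyond (sepD _ _ x) [sep _ _ x]bx sep_gen -xs eqxx.
  have bky : beyond k y by apply: beyond_le byy.
  have := @quadrants_adj _ Gam (axis_wall k) r x y (axis i.+1) (axis (i + m).+1).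
  case=> //.
  - by rewrite (sepD _ _ (axis k)) sep_sym [sep _ _ x](negbTE nbx).
  - exact: negbTE.
  - by rewrite sep_axis !ltnS km leqNgt ik.
  - exact: negbTE.
  - move=> s' [v [ks' rv sv]]; exists v => //.
    by rewrite (wall_of_inj (axis_wall_type k) ks').
have [v rv _] : exists2 v, wall_of r v & adj (letter i.+1) v.
  by apply: cross => //; rewrite -addn1 leq_add2l.
have [k [/andP[ik km] kv]] := letter_onto i v.
have [v' rv'] := cross k ik km.
by rewrite kv (wall_of_inj rv' rv) adj_irr.
Qed.

Lemma len_cover x y z (w : W) (rs : seq W) :
  (forall r, sep r x y -> sep r z w \/ r \in rs) ->
  (len (x^-1 * y)%g <= len (z^-1 * w)%g + size rs)%N.
Proof.
move=> H; have [u [yE <- red]] := geodesic x y.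
rewrite -(size_walls x) -(count_predC [in rs]) addnC.
have uu := reduced_uniq x red; apply: leq_add.
  rewrite -size_filter; apply: uniq_sep_len; first exact: filter_uniq.
  move=> r; rewrite mem_filter /= => /andP[nr]; rewrite reduced_sep // -yE.
  by case/H => // rrs; rewrite rrs in nr.
rewrite -size_filter; apply: uniq_leq_size; first exact: filter_uniq.
by move=> r; rewrite mem_filter => /andP[].
Qed.

(** A wall between [x] and the axis either also separates [x] from [y], by [no_common_crossing], or
    is one of the [m] axis walls that follow [i]. So the way from [x] to [y] is about as long as the
    way from [x] to the axis. *)
Lemma carrier_separation i x y :
  on_carrier (axis_wall i) x -> beyond i x -> beyond (i + m) y ->
  (len (x^-1 * axis i.+1) <= len (x^-1 * y)%g + m)%N.
Proof.
move=> cx bx byy.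
rewrite -[m in X in (_ <= X)%N](size_iota i.+1) -(size_map axis_wall).
apply: len_cover => r rx.
case nr: (sep r (axis i.+1) (axis (i + m).+1)).
  right; rewrite -addSn in nr; have [j [ij jm ->]] := sep_axis_wall nr.
  by apply: map_f; rewrite mem_iota ij.
by left; apply: (no_common_crossing cx bx byy rx); rewrite nr.
Qed.

(** Steps may stay in place, so that a finite path becomes a sequence indexed by all of [nat]. *)
Definition gallery (c : nat -> W) := forall k,
  c k.+1 = c k \/ exists s, c k.+1 = c k * gen s.

Lemma gallery_len c k l : gallery c -> (k <= l)%N -> (len ((c k)^-1 * c l) <= l - k)%N.
Proof.
move=> gc /subnK <-; rewrite addnK; elim: (l - k)%N => [|j IH].
  by rewrite mulVg len1.
rewrite addSn; case: (gc (j + k)%N) => [->|[s ->]]; first exact: leqW.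
rewrite mulgA; apply: leq_trans (lenM _ _) _.
by rewrite -addn1 leq_add // len_gen.
Qed.

Lemma first_crossing c i e : gallery c -> ~~ beyond i (c 0%N) -> beyond i (c e) ->
  exists k, [/\ (k <= e)%N, beyond i (c k), on_carrier (axis_wall i) (c k)
    & forall j, beyond i (c j) -> (k <= j)%N].
Proof.
move=> gc n0 be; have ex : exists k, beyond i (c k) by exists e.
case: (ex_minnP ex) => k bk kmin; exists k; split=> //; first exact: kmin.
case: k bk kmin => [|k] bk kmin; first by rewrite bk in n0.
have nbk : ~~ beyond i (c k) by apply: contraL (ltnSn k) => /kmin; rewrite -leqNgt.
case: (gc k) => [E|[s E]]; first by rewrite E in bk; rewrite bk in nbk.
exists s; move: bk; rewrite /beyond (sepD _ _ (c k)) [sep _ _ (c k)](negbTE nbk).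
by rewrite E sep_gen => /eqP ->; rewrite mulg_genK invgM genV mulgA.
Qed.

(** The gallery reaches the axis walls [M + j m] in order. Between first crossings of two successive
    ones it needs, by [carrier_separation], almost the distance [rho] to the axis; only the offset
    along the axis from [axis M] and one period are lost. *)
Lemma avoiding_gallery c n M rho q :
  gallery c -> c 0%N = axis 0 -> c n = axis (M + M) -> (q * m < M)%N ->
  (forall k, (k <= n)%N -> (rho <= len ((axis M)^-1 * c k))%N) ->
  (q * (rho - (q * m).+1) <= n)%N.
Proof.
move=> gc c0 cn qM far.
have cross j : (j <= q)%N -> exists k, [/\ (k <= n)%N, beyond (M + j * m) (c k),
    on_carrier (axis_wall (M + j * m)) (c k)
    & forall l, beyond (M + j * m) (c l) -> (k <= l)%N].
  move=> jq; apply: first_crossing => //.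
    by rewrite c0 beyond_axis.
  by rewrite cn beyond_axis ltn_add2l; apply: leq_ltn_trans qM; rewrite leq_mul2r jq orbT.
suff H j : (j <= q)%N -> exists k, [/\ (k <= n)%N, beyond (M + j * m) (c k),
    on_carrier (axis_wall (M + j * m)) (c k),
    (forall l, beyond (M + j * m) (c l) -> (k <= l)%N)
    & (j * (rho - (q * m).+1) <= k)%N].
  by have [k [kn _ _ _ /leq_trans]] := H q (leqnn q); apply.
elim: j => [|j IH] jq.
  by have [k [kn bk ck kmin]] := cross 0%N jq; exists k.
have [k [kn bk ck kmin lek]] := IH (ltnW jq).
have [l [ln bl cl lmin]] := cross _ jq; exists l; split=> //.
have E : (M + j.+1 * m = M + j * m + m)%N by lia.
have kl : (k <= l)%N.
  by apply: kmin; apply: beyond_le bl; rewrite E leq_addr.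
have := carrier_separation ck bk (_ : beyond (M + j * m + m) (c l)).
rewrite -E => /(_ bl) sepkl; have lkl := gallery_len gc kl.
have := far k kn; have := len_tri (axis M) (axis (M + j * m).+1) (c k).
rewrite -addnS len_axis [len (_ * c k)]len_sym addnS.
have : (j.+1 * m <= q * m)%N by rewrite leq_mul2r jq orbT.
move: sepkl lkl lek; rewrite [len (_ * axis _.+1)]len_sym; lia.
Qed.

Lemma near_not_beyond i h : (len h <= i)%N -> ~~ beyond i h.
Proof.
move=> hi; apply/negP => bi.
have := @uniq_sep_len _ Gam [seq axis_wall j | j <- iota 0 i.+1] 1 h.
rewrite size_map size_iota invg1 mul1g => H.
suff : (i.+1 <= len h)%N by lia.
apply: H.
  by rewrite map_inj_uniq ?iota_uniq //; exact: axis_wall_inj.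
move=> r /mapP[j]; rewrite mem_iota add0n ltnS => /andP[_ ji] ->.
rewrite (sepD _ _ (axis j)) [sep _ _ h](beyond_le ji bi) -[1]/(axis 0).
by rewrite sep_axis ltnn ltn0.
Qed.

Lemma near_beyond i e h : (i + len h < e)%N -> beyond i (axis e * h).
Proof.
move=> ie; apply: contraT => nb.
have := @uniq_sep_len _ Gam [seq axis_wall j | j <- iota i (e - i)] (axis e) (axis e * h).
rewrite size_map size_iota mulKg => /(_ _ _)H.
suff : (e - i <= len h)%N by lia.
apply: H; first by rewrite map_inj_uniq ?iota_uniq //; exact: axis_wall_inj.
move=> r /mapP[j]; rewrite mem_iota => /andP[ij]; rewrite subnKC; last by lia.
move=> je ->; rewrite (sepD _ _ (axis j)) sep_sym [sep _ _ (axis e)]beyond_axis je addTb.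
by apply: contra nb => /(beyond_le ij).
Qed.

(* The translate by [h] of the axis fellow-travels the axis, and an axis wall
   cannot be crossed by a wall separating the two far from the ends. *)
Lemma centralizer_fellow N h : (0 < N)%N ->
  h * axis m ^+ N = axis m ^+ N * h ->
  exists i k b, axis i = h * axis k * b /\ (len b <= m + m)%N /\ (i = (len h + m).+1).
Proof.
move=> N0 hN; set L := len h; pose c k := h * axis k.
have gc : gallery c by move=> k; right; exists (letter k); rewrite /c /= mulgA.
(* [e] is a multiple of [N * m], so [h] commutes with [axis e]; and it is at least [K], so that the
   translated axis has by then crossed every wall considered below. *)
pose K := (L + L + m + m).+1; pose e := ((N * K) * m)%N.
have Ke : (K <= e)%N by rewrite /e mulnAC leq_pmull // muln_gt0 N0.
have cE : c e = axis e * h.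
  have E : axis e = (axis m ^+ N) ^+ K by rewrite -expgnA -[e]addn0 axis_add mulg1.
  by rewrite /c E; apply: commuteX.
have cross i : (L <= i)%N -> (i <= L + m + m)%N -> exists k, [/\ (k <= e)%N, beyond i (c k),
    on_carrier (axis_wall i) (c k) & forall j, beyond i (c j) -> (k <= j)%N].
  move=> Li iL; apply: first_crossing => //; first by rewrite /c mulg1 near_not_beyond.
  rewrite cE; apply: near_beyond; apply: leq_trans Ke; rewrite /K -/L; lia.
have [k0 [_ b0 c0 min0]] := cross L (leqnn _) ltac:(lia).
have [k1 [_ b1 c1 min1]] := cross (L + m)%N ltac:(lia) ltac:(lia).
have [k2 [_ b2 c2 _]] := cross (L + m + m)%N ltac:(lia) ltac:(lia).
have k01 : (k0 <= k1)%N by apply: min0; apply: beyond_le b1; rewrite leq_addr.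
have k12 : (k1 <= k2)%N by apply: min1; apply: beyond_le b2; rewrite leq_addr.
exists (L + m).+1, k1, ((c k1)^-1 * axis (L + m).+1); split.
  by rewrite -/(c k1) mulVKg.
split=> //; set x0 := axis L.+1; set x1 := axis (L + m).+1; set x2 := axis (L + m + m).+1.
(* With [z = w = 1] the first alternative is void: every wall between [c k1] and [x1] has to be one
   of the [m + m] axis walls between [x0] and [x2]. *)
have := @len_cover (c k1) x1 1 1 [seq axis_wall j | j <- iota L.+1 (m + m)].
rewrite invg1 mulg1 len1 add0n size_map size_iota; apply => r r1; right.
case rx : (sep r x0 x1 || sep r x1 x2).
  case/orP: rx => rx.
    have [j [Lj jm ->]] : exists j, [/\ (L.+1 <= j)%N, (j < L.+1 + m)%N & r = axis_wall j].
      by apply: sep_axis_wall; rewrite addSn.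
    by apply: map_f; rewrite mem_iota Lj /=; lia.
  have [j [Lj jm ->]] : exists j, [/\ ((L + m).+1 <= j)%N, (j < (L + m).+1 + m)%N & r = axis_wall j].
    by apply: sep_axis_wall; rewrite addSn.
  by apply: map_f; rewrite mem_iota; lia.
case/norP: rx => nr0 nr2.
(* Any other wall [r] would separate [c k0] from [c k1] and also [c k1] from [c k2]; but the
   translated axis is geodesic and cannot cross [r] twice. *)
have r12 : sep r (c k1) (c k2) := no_common_crossing c1 b1 b2 r1 nr2.
have r01 : sep r (c k0) (c k1).
  apply: contraT => n01; have r0 : sep r (c k0) x0.
    by rewrite (sepD _ _ (c k1)) (negbTE n01) (sepD _ _ x1) r1 sep_sym (negbTE nr0).
  by have := no_common_crossing c0 b0 b1 r0 nr0; rewrite (negbTE n01).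
have tr k l : sep r (c k) (c l) = sep (h^-1 * r * h) (axis k) (axis l).
  by have := sepJ h (h^-1 * r * h) (axis k) (axis l); rewrite !mulgA mulgV mul1g mulgK.
move: r01 r12; rewrite !tr -{1}(subnKC k01) -{1}(subnKC k12).
move=> /sep_axis_wall[j [_ jk ->]] /sep_axis_wall[l [kl _ /axis_wall_inj E]].
by move: jk; rewrite subnKC // E ltnNge kl.
Qed.

(** In [axis i = h * axis k * b] both indices are reduced by periods: [k] by moving a power of
    [axis m ^+ N] through [h], and [i] by splitting off powers of [axis m] on the left. What remains
    has bounded length. *)
Lemma centralizer_ball N h : (0 < N)%N ->
  h * axis m ^+ N = axis m ^+ N * h ->
  exists p q f, axis m ^+ p * h = axis m ^+ q * f /\ (len f <= m + (m + m) + N * m)%N.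
Proof.
move=> N0 hN; have [i [k [b [iE [bm _]]]]] := centralizer_fellow N0 hN.
pose Q := (k %/ (N * m)).+1; pose d := (Q * N * m - k)%N.
have Nm : (0 < N * m)%N by rewrite muln_gt0 N0.
have kQ : (k <= Q * N * m)%N.
  by rewrite -mulnA /Q {1}(divn_eq k (N * m)) mulSn addnC leq_add2r ltnW // ltn_mod.
have dN : (d <= N * m)%N.
  by rewrite /d -mulnA /Q {2}(divn_eq k (N * m)) mulSn; lia.
have hE : h = axis i * b^-1 * (axis k)^-1 by rewrite iE -!mulgA mulVKg mulgV mulg1 ?mulgA.
exists (N * Q)%N, (i %/ m)%N, (axis (i %% m) * b^-1 * ((axis k)^-1 * axis (k + d))); split.
  have -> : axis m ^+ (N * Q) * h = h * axis m ^+ (N * Q).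
    by rewrite expgnA; apply/esym/commuteX.
  rewrite -[axis m ^+ (N * Q)]mulg1 -[1]/(axis 0) -axis_add addn0 {1}hE.
  rewrite {1}(divn_eq i m) axis_add; have -> : (N * Q * m = k + d)%N by rewrite /d; lia.
  by rewrite !mulgA.
apply: leq_trans (lenM _ _) _; apply: leq_add; last by rewrite len_axis.
apply: leq_trans (lenM _ _) _; apply: leq_add; last by rewrite lenV.
have := len_axis 0 (i %% m); rewrite invg1 mul1g add0n => ->.
by rewrite ltnW // ltn_mod.
Qed.

Lemma axis_order k : axis m ^+ k = 1 -> k = 0%N.
Proof.
rewrite -[_ ^+ k]mulg1 -[1 in X in X = _]/(axis 0) -axis_add addn0 => E.
have := len_axis 0 (k * m); rewrite invg1 mul1g add0n E len1 => /esym/eqP.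
by rewrite muln_eq0 [m == 0%N]eqn0Ngt m_gt0 orbF => /eqP.
Qed.

End Axis.

Section Finiteness.
Local Open Scope classical_set_scope.

Lemma infinite_range_inj (T : Type) (f : nat -> T) : injective f ->
  infinite_set (range f).
Proof.
move=> finj fin; apply: infinite_nat.
pose g x := if pselect (exists n, f n = x) is left H then projT1 (cid H) else 0%N.
apply: sub_finite_set (finite_image g fin) => n _.
exists (f n); first by exists n.
rewrite /g; case: pselect => [H|[]]; last by exists n.
by case: (cid H) => k /= /finj.
Qed.

Lemma finite_ball (V : finType) (Gam : sgraph V) R :
  finite_set [set g : racg Gam | (len g <= R)%N].
Proof.
pose f (t : R.-tuple (option V)) := el Gam (pmap id t).
apply: sub_finite_set (finite_image f (@finite_finset _ setT)) => g /= gR.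
have [u ug gE] := len_word g.
have st : size (map Some u ++ nseq (R - size u) None) == R.
  by rewrite size_cat size_map size_nseq subnKC // ug.
exists (Tuple st) => //; rewrite /f /= gE pmap_cat; congr (el _ _).
have -> : pmap id (nseq (R - size u) (@None V)) = [::].
  by elim: (R - size u)%N => //= k ->.
by rewrite cats0; elim: (u) => //= v w ->.
Qed.

End Finiteness.

(** * No splitting as a product of infinite subgroups *)

Section Indecomposable.
Variables (V : finType) (Gam : sgraph V).
Local Notation W := (racg Gam).
Local Open Scope group_scope.
Local Open Scope classical_set_scope.
Implicit Types (g h : W) (A B I : set W).

Variables (letter : nat -> V) (m : nat).
Hypothesis m_gt0 : (0 < m)%N.
Hypothesis letter_period : forall i, letter (i + m) = letter i.
Hypothesis letter_onto : forall i v, exists k, (i < k <= i + m)%N /\ letter k = v.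
Hypothesis letter_nadj : forall i,
  letter i != letter i.+1 /\ ~~ sgraph_adj Gam (letter i) (letter i.+1).

Local Notation axis := (axis Gam letter).

Lemma centralizer_finite I N : (0 < N)%N ->
  (forall h, I h -> h * axis m ^+ N = axis m ^+ N * h) ->
  (forall h h' p q, I h -> I h' -> axis m ^+ p * h = axis m ^+ q * h' -> h = h') ->
  finite_set I.
Proof.
move=> N0 IN Iinj.
pose rel h f := exists p q, axis m ^+ p * h = axis m ^+ q * f.
pose F f := if pselect (exists h, I h /\ rel h f) is left H then projT1 (cid H) else 1.
apply: sub_finite_set (finite_image F (finite_ball Gam (m + (m + m) + N * m))).
move=> h Ih.
have [p [q [f [E fl]]]] :=
  centralizer_ball m_gt0 letter_period letter_onto letter_nadj N0 (IN _ Ih).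
exists f => //; rewrite /F; case: pselect => [H|[]]; last by exists h; split=> //; exists p, q.
case: (cid H) => h' /= [Ih' [p' [q' E']]]; apply: (Iinj _ _ (q + p') (q' + p))%N => //.
by rewrite !expgnDr -!mulgA E E' !mulgA -!expgnDr addnC.
Qed.

(** Two elements of [A] that agree up to powers of [axis m] are equal: the [B]-component [b ^+ l] of
    the power in question lies in [A] as well, so it is trivial and [l = 0]. Thus
    [centralizer_finite] applies. *)
Lemma factor_infinite A B (a b : W) N I :
  subgroup A -> subgroup B -> A `&` B = [set 1] ->
  (forall x y, A x -> B y -> x * y = y * x) -> A a -> B b ->
  axis m = a * b -> I `<=` A -> (0 < N)%N ->
  (forall h, I h -> h * axis m ^+ N = axis m ^+ N * h) ->
  (forall l, b ^+ l = 1 -> l = 0%N) -> finite_set I.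
Proof.
move=> [A1 AM AV] [B1 BM BV] AB comm Aa Bb gE IA N0 IN bl.
apply: centralizer_finite N0 IN _.
have AX l : A (a ^+ l) by elim: l => [|l IH]; rewrite ?expg0 // expgS; exact: AM.
have BX l : B (b ^+ l) by elim: l => [|l IH]; rewrite ?expg0 // expgS; exact: BM.
have key h h' l : A h -> A h' -> h = axis m ^+ l * h' -> h = h'.
  move=> Ah Ah' E.
  have bE : b ^+ l = (a ^+ l)^-1 * h * h'^-1.
    have gX : axis m ^+ l = a ^+ l * b ^+ l by rewrite gE expgMn //; exact: comm.
    by rewrite E gX -!mulgA mulKg mulgV mulg1.
  have : (A `&` B) (b ^+ l).
    by split=> //; rewrite bE; apply: (AM) (AV _ Ah'); apply: AM Ah; apply: AV.
  by rewrite AB /= E => /bl ->; rewrite expg0 mul1g.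
move=> h h' p q /IA Ah /IA Ah' E; case: (leqP p q) => [pq|/ltnW qp].
  apply: (key _ _ (q - p)%N) => //; apply: (mulgI (axis m ^+ p)).
  by rewrite E mulgA -expgnDr subnKC.
apply/esym/(key _ _ (p - q)%N) => //; apply: (mulgI (axis m ^+ q)).
by rewrite -E mulgA -expgnDr subnKC.
Qed.

Theorem not_thick0 : ~ thick_at_most 0 [set: W].
Proof.
case=> _ [A [B [Ainf Binf [sA sB AB comm prod]]]].
have : [set: W] (axis m) by [].
rewrite -prod; move=> [a Aa [b Bb gE]]; have {}gE := esym gE.
have BA : B `&` A = [set 1] by rewrite setIC.
have commBA x y : B x -> A y -> x * y = y * x by move=> Bx Ay; rewrite [RHS]comm.
have gE' : axis m = b * a by rewrite gE comm.
have gX N : axis m ^+ N = a ^+ N * b ^+ N by rewrite gE expgMn //; exact: comm.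
have ord N l : (0 < N)%N -> axis m ^+ (N * l) = 1 -> l = 0%N.
  move=> N0 /(axis_order m_gt0 letter_period letter_nadj)/eqP.
  by rewrite muln_eq0 eqn0Ngt N0 => /eqP.
have AX l : A (a ^+ l).
  by case: sA => A1 AM _; elim: l => [|l IH]; rewrite ?expg0 // expgS; exact: AM.
have BX l : B (b ^+ l).
  by case: sB => B1 BM _; elim: l => [|l IH]; rewrite ?expg0 // expgS; exact: BM.
(* If [b] has finite order, a power of [axis m] lies in [A] and therefore commutes with all of [B];
   as [a] then has infinite order, [B] would be finite. *)
case: (pselect (exists N, (0 < N)%N /\ b ^+ N = 1)) => [[N [N0 bN]]|nb].
  apply: Binf; apply: (factor_infinite sB sA BA commBA Bb Aa gE' _ N0) => //.
    by move=> h Bh; rewrite gX bN mulg1 -comm.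
  by move=> l al; apply: (ord N) => //; rewrite gX mulnC expgnA al expg1n mulnC expgnA bN expg1n mulg1.
case: (pselect (exists N, (0 < N)%N /\ a ^+ N = 1)) => [[N [N0 aN]]|na].
  apply: Ainf; apply: (factor_infinite sA sB AB comm Aa Bb gE _ N0) => //.
    by move=> h Ah; rewrite gX aN mul1g comm.
  by move=> l bl; apply: (ord N) => //; rewrite gX expgnA aN expg1n mulnC expgnA bl expg1n mulg1.
have nofin x l : ~ (exists N, (0 < N)%N /\ x ^+ N = 1) -> x ^+ l = 1 :> W -> l = 0%N.
  by move=> nx xl; case: l xl => // l xl; case: nx; exists l.+1.
(* If both components have infinite order, the powers of [a] already form an infinite subset of [A]
   that commutes with [axis m]. *)
have : finite_set (range (fun i => a ^+ i)).
  apply: (factor_infinite sA sB AB comm Aa Bb gE _ (ltn0Sn 0)).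
  - by move=> _ [i _ <-].
  - move=> _ [i _ <-]; rewrite expg1 gE; apply/esym/commuteX.
  by rewrite /commute -mulgA (comm a b).
  - by move=> l /nofin; apply.
apply: infinite_range_inj.
suff inj i j : (i <= j)%N -> a ^+ i = a ^+ j -> i = j.
  by move=> i j E; case: (leqP i j) => [|/ltnW] ij; [|apply/esym]; apply: inj.
move=> ij; rewrite -{1}(subnK ij) expgnDr -{1}[a ^+ i]mul1g => /mulIg/esym/nofin.
by move/(_ na) => ji; apply/eqP; rewrite eqn_leq ij -subn_eq0 ji.
Qed.

End Indecomposable.

(** * Thickness from connected squares *)

Section WordLength.
Variable G : groupType.
Local Open Scope group_scope.
Local Open Scope classical_set_scope.
Implicit Types (S : set G) (x y : G).

Lemma word_length_has S x n : has_word S x n ->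
  has_word S x (word_length S x) /\ (word_length S x <= n)%N.
Proof.
move=> H; rewrite /word_length; case: pselect => [ex|[]]; last first.
  by exists n; apply/asboolP.
by case: ex_minnP => k /asboolP kw kmin; split=> //; apply: kmin; apply/asboolP.
Qed.

Lemma has_word1 S : has_word S 1 0.
Proof. by exists [::]; rewrite big_nil. Qed.

Lemma word_dist_refl S x : word_dist S x x = 0%N.
Proof.
rewrite /word_dist mulVg; apply/eqP; rewrite -leqn0.
by have [] := word_length_has (has_word1 S).
Qed.

End WordLength.

Section Thick.
Variables (V : finType) (Gam : sgraph V).
Local Notation W := (racg Gam).
Local Notation adj := (sgraph_adj Gam).
Local Notation gen := (gen Gam).
Local Notation el := (el Gam).
Local Open Scope group_scope.
Local Open Scope classical_set_scope.
Implicit Types (x y : W) (s t v : V) (u w : seq V) (e f : V * V).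

(* A square is recorded by its two diagonals. *)
Definition square e f := [&& e.1 != e.2, ~~ adj e.1 e.2, f.1 != f.2, ~~ adj f.1 f.2,
  adj e.1 f.1, adj e.1 f.2, adj e.2 f.1 & adj e.2 f.2].

Lemma square_sym e f : square e f -> square f e.
Proof.
rewrite /square => /and5P[-> -> -> -> /and4P[]].
by rewrite ![adj e.1 _]adj_sym ![adj e.2 _]adj_sym => -> -> -> ->.
Qed.

Lemma square_swap e f : square e f -> square (e.2, e.1) f.
Proof.
rewrite /square => /and5P[/= en ea -> -> /and4P[-> -> -> ->]].
by rewrite eq_sym en adj_sym ea.
Qed.

(** The property CFS, constructed from squares. The nodes of the graph are the ordered diagonals and
    its edges are the squares, so squares sharing a diagonal are edges with a common end. *)
Definition cfs := exists e0, (exists f, square e0 f) /\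
  forall v, exists t, connect square e0 (v, t).

Definition std : set W := range gen.

Definition special (P : pred V) : set W := [set el u | u in [set u | all P u]].

Lemma special_subgroup P : subgroup (special P).
Proof.
split; first by exists [::].
  move=> _ _ [u uP <-] [w wP <-]; exists (u ++ w); last exact: el_cat.
  by rewrite /= all_cat uP.
by move=> _ [u uP <-]; exists (rev u); [rewrite /= all_rev | exact: el_rev].
Qed.

(** The letters outside [P] act trivially, so the orbit of [1] is the image of the retraction onto
    [special P], which deletes these letters from words. *)
Definition keep_act (P : pred V) v x := if P v then gen v * x else x.

Lemma keep_act_inv P v : involutive (keep_act P v).
Proof. by move=> x; rewrite /keep_act; case: (P v); rewrite ?genK. Qed.

Lemma keep_act_adj P s t : adj s t ->
  forall x, keep_act P s (keep_act P t x) = keep_act P t (keep_act P s x).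
Proof.
move=> st x; rewrite /keep_act; case: (P s); case: (P t) => //.
by rewrite !mulgA (gen_adj st).
Qed.

Lemma filter_eq P u w : el u = el w -> el (seq.filter P u) = el (seq.filter P w).
Proof.
have H u' : racg_act (keep_act P) (el u') 1 = el (seq.filter P u').
  elim: u' => [|v u' IH] /=.
    exact: (racg_act1 (keep_act_inv P) (@keep_act_adj P)).
  rewrite (racg_actM (keep_act_inv P) (@keep_act_adj P)).
  rewrite (racg_act_gen (keep_act_inv P) (@keep_act_adj P)) IH /keep_act.
  by case: (P v).
by move=> E; rewrite -!H E.
Qed.

Lemma has_word_gen (P : pred V) x n :
  has_word [set gen v | v in [set v | P v]] x n <->
  exists u, [/\ size u = n, all P u & el u = x].
Proof.
split=> [[w [<- wS <-]]|[u [<- uP <-]]]; last first.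
  exists (map gen u); split; first exact: size_map.
    move=> g /mapP[v vu ->]; left; exists v => //.
    by have /allP := uP; apply.
  by rewrite big_map; elim: (u) => [|v u' IH]; rewrite ?big_nil // big_cons IH.
elim: w wS => [|g w IH] wS; first by exists [::]; rewrite big_nil.
have [|u [su uP uE]] := IH.
  by move=> h hw; apply: wS; rewrite inE hw orbT.
have [v Pv gE] : exists2 v, P v & gen v = g.
  case: (wS g (mem_head _ _)) => -[v Pv vE]; exists v => //.
  by rewrite -[g]invgK -vE genV.
by exists (v :: u); split; rewrite /= ?su ?Pv // uE big_cons gE.
Qed.

Lemma special_gen (P : pred V) :
  fin_generating [set gen v | v in [set v | P v]] (special P).
Proof.
split; first exact: finite_image (@finite_finset _ _).
apply/seteqP; split=> [x|_ [u uP <-] K [[K1 KM KV] PK]].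
  apply; split; first exact: special_subgroup.
  by move=> _ [v vP <-]; exists [:: v]; rewrite /= ?andbT ?mulg1.
elim: u uP => //= v u IH /andP[vP uP]; apply: KM; last exact: IH.
by apply: PK; exists v.
Qed.

Lemma stdE : std = [set gen v | v in [set v | predT v]].
Proof. by apply/seteqP; split=> _ [v _ <-]; exists v. Qed.

Lemma std_gen : fin_generating std [set: W].
Proof.
have := special_gen predT; rewrite -stdE; have -> // : special predT = [set: W].
by apply/seteqP; split=> // x _; have [u ->] := el_surj x; exists u; rewrite /= ?all_predT.
Qed.

Lemma has_word_std x n : has_word std x n <-> exists u, size u = n /\ el u = x.
Proof.
rewrite stdE has_word_gen; split=> [[u [su _ ue]]|[u [su ue]]]; exists u => //.
by rewrite all_predT.
Qed.

(** The retraction does not lengthen words, so the special subgroup is isometrically embedded and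
    the constants are [1] and [0]. *)
Lemma special_undistorted (P : pred V) : undistorted std (special P).
Proof.
exists [set gen v | v in [set v | P v]]; split; first exact: special_gen.
exists 1%N, 0%N => x y Kx Ky; rewrite !mul1n !addn0 /word_dist.
have [u uP <-] : special P (x^-1 * y).
  by have [_ KM KV] := special_subgroup P; apply: KM => //; exact: KV.
have [/has_word_gen[w [sw wP we]] _] : has_word [set gen v | v in [set v | P v]]
   (el u) (word_length [set gen v | v in [set v | P v]] (el u)) /\ True.
  split=> //; apply: (proj1 (@word_length_has _ _ _ (size u) _)).
  by apply/has_word_gen; exists u.
split.
  by apply: (proj2 (word_length_has _)); apply/has_word_std; exists w.
have [/has_word_std[w' [sw' we']] _] : has_word std (el u) (word_length std (el u)) /\ True.
  split=> //; apply: (proj1 (@word_length_has _ _ _ (size u) _)).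
  by apply/has_word_std; exists u.
apply: leq_trans (_ : size (seq.filter P w') <= _)%N; last first.
  by rewrite -sw' size_filter count_size.
apply: (proj2 (word_length_has _)); apply/has_word_gen; exists (seq.filter P w').
split=> //; first exact: filter_all.
rewrite (filter_eq P we'); congr el.
by elim: (u) uP => //= v u' IH /andP[-> /IH ->].
Qed.

Definition line e : set W := special (pred2 e.1 e.2).
Definition flat e f : set W := special [predU (pred2 e.1 e.2) & (pred2 f.1 f.2)].

Lemma line_infinite e f : square e f -> forall x, infinite_set [set x * y | y in line e].
Proof.
case/and5P => en ea _ _ _ x.
have inj : injective (fun i => x * el (alt i.*2 e.1 e.2)).
  move=> i j /mulgI E; have [+ _] := lin_alt en ea i.*2.
  by have [+ _] := lin_alt en ea j.*2; rewrite E => ->; lia.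
apply: sub_infinite_set (infinite_range_inj inj) => _ [i _ <-].
exists (el (alt i.*2 e.1 e.2)) => //; exists (alt i.*2 e.1 e.2) => //=.
by elim: i => //= i ->; rewrite !eqxx !orbT.
Qed.

Lemma gen_comm_words (P Q : pred V) u w : all P u -> all Q w ->
  (forall s t, P s -> Q t -> adj s t) -> el u * el w = el w * el u.
Proof.
move=> uP wQ PQ; elim: u uP => [|s u IH] /=; first by rewrite mulg1 mul1g.
case/andP => sP uP; rewrite -mulgA IH // !mulgA; congr (_ * _).
elim: w wQ {IH} => [|t w IH] /=; first by rewrite mulg1 mul1g.
by case/andP => tQ wQ; rewrite mulgA (gen_adj (PQ _ _ sP tQ)) -!mulgA IH.
Qed.

Lemma flat_product e f : square e f -> direct_product (line e) (line f) (flat e f).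
Proof.
case/and5P => en ea fn fa /and4P[a11 a12 a21 a22].
have adj_ef s t : pred2 e.1 e.2 s -> pred2 f.1 f.2 t -> adj s t.
  by move=> /pred2P[]-> /pred2P[]->.
split; [exact: special_subgroup | exact: special_subgroup | | |].
- apply/seteqP; split=> [x [[u uP uE] [w wP wE]]|_ ->]; last first.
    by split; exists [::].
  (* The retraction onto the line of [e] fixes an element of that line and kills an element of the
     line of [f]. *)
  have := @filter_eq (pred2 e.1 e.2) u w; rewrite uE wE => /(_ erefl).
  have -> : seq.filter (pred2 e.1 e.2) u = u by apply/all_filterP.
  have -> : seq.filter (pred2 e.1 e.2) w = [::].
    apply/eqP; rewrite -[_ == _]negbK -has_filter; apply/hasPn => v vw.
    have /allP/(_ v vw) fv := wP.
    by apply/negP => /adj_ef /(_ fv); rewrite adj_irr.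
  by rewrite uE.
- by move=> _ _ [u uP <-] [w wP <-]; apply: gen_comm_words adj_ef.
apply/seteqP; split=> [_ [_ [u uP <-] [_ [w wP <-] <-]]|_ [u uP <-]].
  exists (u ++ w); last exact: el_cat.
  rewrite /= all_cat; apply/andP; split; apply/allP => v.
    by move/(allP uP) => H; apply/orP; left.
  by move/(allP wP) => H; apply/orP; right.
elim: u uP => [|v u IH] /=.
  by move=> _; exists 1; [exists [::] | exists 1; [exists [::] | rewrite mulg1]].
case/andP => vef /IH[_ [u1 u1P <-] [_ [u2 u2P <-] E]]; rewrite -E.
case/orP: vef => vP.
  exists (gen v * el u1); first by exists (v :: u1) => //; apply/andP.
  by exists (el u2); [exists u2 | rewrite mulgA].
exists (el u1); first by exists u1.
exists (gen v * el u2); first by exists (v :: u2) => //; apply/andP.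
rewrite !mulgA; congr (_ * _).
have := @gen_comm_words (pred2 e.1 e.2) (pred2 f.1 f.2) u1 [:: v] u1P.
by rewrite /= mulg1; apply=> //; apply/andP.
Qed.

Lemma line_sub_flat e f : line e `<=` flat e f.
Proof.
by move=> _ [u uP <-]; exists u => //; apply/allP => v /(allP uP) H; apply/orP; left.
Qed.

Lemma line_sub_flatr e f : line f `<=` flat e f.
Proof.
by move=> _ [u uP <-]; exists u => //; apply/allP => v /(allP uP) H; apply/orP; right.
Qed.

Lemma coarse_intersection (A B I : set W) :
  infinite_set I -> I `<=` A -> I `<=` B ->
  infinite_coarse_intersection std [set: W] A B.
Proof.
move=> inf IA IB; exists 0%N; apply: sub_infinite_set inf => x Ix.
by split; split=> //; exists x; rewrite ?word_dist_refl //; [exact: IA|exact: IB].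
Qed.

Section Chain.
Variable HH : set (set W).

Inductive coset_chain : W -> set W -> W -> set W -> Prop :=
| chain_refl g K : HH K -> coset_chain g K g K
| chain_step g K g' K' g'' K'' : HH K ->
    infinite_coarse_intersection std [set: W] (left_coset g K) (left_coset g' K') ->
    coset_chain g' K' g'' K'' -> coset_chain g K g'' K''.

Lemma chain_trans g K g' K' g'' K'' : coset_chain g K g' K' ->
  coset_chain g' K' g'' K'' -> coset_chain g K g'' K''.
Proof.
elim=> // a A b B c C HA inter _ IH /IH; exact: chain_step.
Qed.

Lemma chain_fun g K g' K' : coset_chain g K g' K' ->
  exists (m : nat) (gs : nat -> W) (Ks : nat -> set W),
    [/\ forall i, (i <= m)%N -> [set: W] (gs i) /\ HH (Ks i),
        gs 0%N = g /\ Ks 0%N = K, gs m = g' /\ Ks m = K'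
      & forall i, (i < m)%N -> infinite_coarse_intersection std [set: W]
          (left_coset (gs i) (Ks i)) (left_coset (gs i.+1) (Ks i.+1))].
Proof.
elim=> {g K g' K'} [g K HK|g K g' K' g'' K'' HK inter _ [m [gs [Ks [H1 [g0 k0] Hm Hs]]]]].
  by exists 0%N, (fun=> g), (fun=> K).
exists m.+1, (fun i => if i is j.+1 then gs j else g),
  (fun i => if i is j.+1 then Ks j else K); split=> //.
  by case=> [|i] //; exact: H1.
by case=> [|i] //; [rewrite g0 k0 | exact: Hs].
Qed.

End Chain.

Theorem cfs_thick1 : cfs -> thick_at_most 1 [set: W].
Proof.
case=> e0 [[f0 ef0] cov].
pose HH : set (set W) := [set K | exists e f, [/\ connect square e0 e, square e f & K = flat e f]].
have HHi e f : connect square e0 e -> square e f -> HH (flat e f).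
  by move=> *; exists e, f.
have incomp e : connect square e0 e -> exists f, square e f.
  case/connectP => p; elim/last_ind: p e => [|p e' _] e; first by move=> _ ->; exists f0.
  rewrite rcons_path last_rcons => /andP[_ sq] ->.
  by exists (last e0 p); exact: square_sym.
have sub_step x y e f e' f' (I : set W) : connect square e0 e -> square e f ->
    connect square e0 e' -> square e' f' -> infinite_set I ->
    I `<=` left_coset x (flat e f) -> I `<=` left_coset y (flat e' f') ->
    coset_chain HH x (flat e f) y (flat e' f').
  move=> ce ef ce' ef' infI I1 I2; apply: chain_step (chain_refl _ (HHi _ _ ce' ef')).
    exact: HHi.
  exact: coarse_intersection infI I1 I2.
have sub_line x e f g : line g `<=` flat e f ->
    [set x * y | y in line g] `<=` left_coset x (flat e f).
  by move=> gef _ [y gy <-]; exists y => //; exact: gef.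
(* At a fixed base point, successive flats along a path of diagonals share a whole line. *)
have switch x p e f f' : connect square e0 e -> path square e p -> square e f ->
    square (last e p) f' -> coset_chain HH x (flat e f) x (flat (last e p) f').
  elim: p e f => [|e1 p IH] e f ce /=.
    move=> _ ef ef'; apply: (sub_step _ _ _ _ _ _ _ _ _ _ _ (@line_infinite _ _ ef x)) => //;
    exact/sub_line/line_sub_flat.
  case/andP => ee1 pp ef lf'.
  have ce1 : connect square e0 e1 by apply: connect_trans ce (connect1 _).
  have e1e := square_sym ee1.
  apply: chain_trans (IH e1 e ce1 pp e1e lf').
  apply: (@chain_trans _ _ _ x (flat e e1)).
    apply: (sub_step _ _ _ _ _ _ _ _ _ _ _ (@line_infinite _ _ ef x)) => //;
      exact/sub_line/line_sub_flat.
  apply: (sub_step _ _ _ _ _ _ _ _ _ _ _ (@line_infinite _ _ e1e x)) => //.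
    exact/sub_line/line_sub_flatr.
  exact/sub_line/line_sub_flat.
have csym : connect_sym square.
  by apply: sym_connect_sym => e f; apply/idP/idP; exact: square_sym.
have walk u : forall x e f, connect square e0 e -> square e f ->
    exists e' f', [/\ connect square e0 e', square e' f'
      & coset_chain HH x (flat e f) (x * el u) (flat e' f')].
  elim: u => [|s u IH] x e f ce ef /=.
    by exists e, f; split=> //; rewrite mulg1; apply/chain_refl/HHi.
  (* To move the base point across the letter [s], the chain switches to a flat that has [(s, t)] as
     a diagonal: its line contains [gen s], so the cosets based at [x] and at [x * gen s] share
     it. *)
  have [t cst] := cov s; have [f' stf'] := incomp _ cst.
  have /connectP[p pp lp] : connect square e (s, t).
    by apply: connect_trans cst; rewrite csym.
  have [e2 [f2 [ce2 ef2 ch]]] := IH (x * gen s) _ _ cst stf'.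
  exists e2, f2; split=> //; rewrite mulgA; apply: chain_trans ch.
  apply: (@chain_trans _ _ _ x (flat (s, t) f')).
    by rewrite lp; apply: switch => //; rewrite -lp.
  apply: (sub_step _ _ _ _ _ _ _ _ _ _ _ (@line_infinite _ _ stf' x)) => //.
    exact/sub_line/line_sub_flat.
  move=> _ [y ly <-]; exists (gen s * y); last by rewrite mulgA mulg_genK.
  case: ly => w wP <-; exists (s :: w) => //=.
  by rewrite inE /= eqxx; apply/allP => v /(allP wP) H; apply/orP; left.
exists std, HH; split.
- exact: std_gen.
- apply: sub_finite_set (finite_image (fun ef => flat ef.1 ef.2) (@finite_finset _ setT)).
  by move=> _ [e [f [_ _ ->]]]; exists (e, f).
- move=> _ [e [f [ce ef ->]]]; split=> //; first exact: special_subgroup.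
    exact: special_undistorted.
  split; first by eexists; exact: special_gen.
  exists (line e), (line f); have fe := square_sym ef; split.
  + by apply: sub_infinite_set (@line_infinite _ _ ef 1) => _ [y ly <-]; rewrite mul1g.
  + by apply: sub_infinite_set (@line_infinite _ _ fe 1) => _ [y ly <-]; rewrite mul1g.
  + exact: flat_product.
- have -> : gen_subgroup (\bigcup_(K in HH) K) = [set: W].
    apply/seteqP; split=> // x _ K [[K1 KM KV] HK].
    have [u ->] := el_surj x; elim: u => //= s u IH; apply: KM => //.
    have [t cst] := cov s; have [f' stf'] := incomp _ cst.
    apply: HK; exists (flat (s, t) f'); first exact: HHi.
    exists [:: s]; last by rewrite /= mulg1.
    by rewrite /= andbT; apply/orP; left; rewrite inE /= eqxx.
  split; first by split.
  split=> //; apply: sub_finite_set (finite_set1 [set: W]) => _ [g _ <-] /=.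
  by apply/seteqP; split=> // x _; exists (g^-1 * x); rewrite ?mulVKg.
- move=> x y _ _; have [u yE] := el_surj (x^-1 * y).
  have [e' [f' [ce' ef' ch]]] := walk u x e0 f0 (connect0 _ _) ef0.
  have [m [gs [Ks [H1 [g0 k0] [gm km] H2]]]] := chain_fun ch.
  exists m, gs, Ks; split=> //.
    by rewrite g0 k0; exists 1; rewrite ?mulg1 //; exists [::].
  by rewrite gm km -yE mulVKg; exists 1; rewrite ?mulg1 //; exists [::].
Qed.

End Thick.

(** * Paths in the geometric Cayley graph *)

Section WordMetric.
Variables (G : groupType) (S : set G).
Local Open Scope group_scope.
Local Open Scope classical_set_scope.
Implicit Types x y z g h : G.
Hypothesis S_gen : fin_generating S [set: G].
Local Notation wl := (word_length S).
Local Notation wd := (word_dist S).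

Lemma has_wordM x y m n : has_word S x m -> has_word S y n -> has_word S (x * y) (m + n).
Proof.
case=> [u [<- uS <-]] [w [<- wS <-]]; exists (u ++ w); rewrite size_cat big_cat; split=> //.
by move=> g; rewrite mem_cat => /orP[/uS|/wS].
Qed.

Lemma has_wordV x n : has_word S x n -> has_word S x^-1 n.
Proof.
case=> [u [<- uS <-]]; exists (rev (map (fun g : G => g^-1) u)); split.
- by rewrite size_rev size_map.
- by move=> g; rewrite mem_rev => /mapP[h /uS hS ->]; rewrite invgK or_comm.
elim: u {uS} => [|g u IH]; first by rewrite !big_nil invg1.
by rewrite /= rev_cons -cats1 big_cat IH big_seq1 big_cons invgM.
Qed.

Lemma has_word_ex x : exists n, has_word S x n.
Proof.
have [_ genS] := S_gen; have : gen_subgroup S x by rewrite genS.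
move=> H; apply: (H [set y | exists n, has_word S y n]); split.
  split; first by exists 0%N; exact: has_word1.
    by move=> a b [m am] [n bn]; exists (m + n)%N; exact: has_wordM.
  by move=> a [m am]; exists m; exact: has_wordV.
move=> g Sg; exists 1%N, [:: g]; split=> //; last by rewrite big_seq1.
by move=> h; rewrite inE => /eqP ->; left.
Qed.

Lemma has_wl x : has_word S x (wl x).
Proof. by have [n /word_length_has[]] := has_word_ex x. Qed.

Lemma wl_le x n : has_word S x n -> (wl x <= n)%N.
Proof. by case/word_length_has. Qed.

Lemma wlM x y : (wl (x * y) <= wl x + wl y)%N.
Proof. by apply: wl_le; apply: has_wordM; exact: has_wl. Qed.

Lemma wlV x : wl x^-1 = wl x.
Proof.
have H y : (wl y^-1 <= wl y)%N by apply/wl_le/has_wordV/has_wl.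
by apply/eqP; rewrite eqn_leq H -{1}[x]invgK H.
Qed.

Lemma wd_tri x y z : (wd x z <= wd x y + wd y z)%N.
Proof. by have := wlM (x^-1 * y) (y^-1 * z); rewrite mulgA mulgK. Qed.

Lemma wd_sym x y : wd x y = wd y x.
Proof. by rewrite /word_dist -wlV invgM invgK. Qed.

Lemma wd_adj x y : cayley_adj S x y -> (wd x y <= 1)%N.
Proof.
case=> _ H; apply: wl_le; exists [:: x^-1 * y]; split; rewrite ?big_seq1 //.
by move=> g; rewrite inE => /eqP ->; rewrite invgM invgK.
Qed.

Lemma wd_le1 x y : (wd x y <= 1)%N -> x = y \/ cayley_adj S x y.
Proof.
rewrite /word_dist; have := has_wl (x^-1 * y).
case: (wl _) => [|[|//]] [w [sw wS wE]] _.
  left; move/eqP: sw wE; rewrite size_eq0 => /eqP ->; rewrite big_nil => E.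
  by rewrite -[y](mulVKg x) -E mulg1.
case: w sw wS wE => [//|g [|//]] _ wS; rewrite big_seq1 => gE.
have [|neq] := pselect (x = y); [by left|right; split=> //].
by have := wS g (mem_head _ _); rewrite gE invgM invgK.
Qed.

Lemma wd_path x y : exists p, [/\ path (fun a b => (wd a b <= 1)%N) x p,
  last x p = y, size p = wd x y & all (fun v => (wd x v <= wd x y)%N) p].
Proof.
have [w [sw wS wE]] := has_wl (x^-1 * y).
rewrite -[wd x y]/(wl _) -sw.
have {wE}-> : y = x * \prod_(g <- w) g by rewrite wE mulVKg.
elim/last_ind: w wS {sw} => [|w g IH] wS.
  by exists [::]; rewrite big_nil mulg1.
have [|p [pp lp sp ap]] := IH.
  by move=> h hw; apply: wS; rewrite mem_rcons inE hw orbT.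
have step : (wd (x * \prod_(h <- w) h) (x * \prod_(h <- rcons w g) h) <= 1)%N.
  rewrite -cats1 big_cat big_seq1 mulgA /word_dist mulKg; apply: wl_le.
  exists [:: g]; split; rewrite ?big_seq1 //.
  by move=> h; rewrite inE => /eqP ->; apply: wS; rewrite mem_rcons mem_head.
have sw : (wd x (x * \prod_(h <- rcons w g) h) <= size (rcons w g))%N.
  by rewrite /word_dist mulKg; apply: wl_le; exists (rcons w g).
exists (rcons p (x * \prod_(h <- rcons w g) h)); split.
- by rewrite rcons_path pp lp step.
- by rewrite last_rcons.
- by rewrite !size_rcons sp.
rewrite all_rcons sw; apply/allP => v vp; rewrite size_rcons ltnW // ltnS.
by have /allP/(_ v vp) := ap.
Qed.

End WordMetric.

(** * The distance of the Cayley graph as a pseudometric *)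

Section CayleyMetric.
Variables (R : realType) (G : groupType) (S : set G).
Local Open Scope ring_scope.
Hypothesis S_gen : fin_generating S [set: G].
Local Notation wd := (word_dist S).
Local Notation point := (cayley_point R S).
Local Notation cd := (@cayley_dist R G S).
Implicit Types (x y z : point) (b c : bool).

(** Indexing the two ends of an edge by a boolean lets the cases of [cayley_dist] be treated
    uniformly; [coff b x] is the offset of [x] from the end [cend b x]. *)
Definition cend b x : G := if b then ctgt x else csrc x.
Definition coff b x : R := if b then 1 - cpos x else cpos x.

Lemma coff_ge0 b x : 0 <= coff b x.
Proof. by have := cpos_itv x; rewrite /coff; case: b; lra. Qed.

Lemma coff_le1 b x : coff b x <= 1.
Proof. by have := cpos_itv x; rewrite /coff; case: b; lra. Qed.

Lemma wd_cend b c x : (wd (cend b x) (cend c x))%:R <= coff b x + coff c x :> R.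
Proof.
have st : (wd (csrc x) (ctgt x) <= 1)%N.
  by case: (cpos_edge x) => [/(wd_adj)//|[-> _]]; rewrite word_dist_refl.
have ts : (wd (ctgt x) (csrc x) <= 1)%N by rewrite wd_sym.
have := cpos_itv x.
case: b; case: c; rewrite /cend /coff ?word_dist_refl; try lra.
  by move: ts; rewrite -(@ler_nat R) /=; lra.
by move: st; rewrite -(@ler_nat R) /=; lra.
Qed.

Lemma cd_vertexE x (v : G) : exists b,
  cayley_dist_vertex x v = coff b x + (wd (cend b x) v)%:R.
Proof. by rewrite /cayley_dist_vertex minElt; case: ifP => _; [exists false|exists true]. Qed.

Lemma cd_vertex_le x (v : G) b :
  cayley_dist_vertex x v <= coff b x + (wd (cend b x) v)%:R.
Proof. by rewrite /cayley_dist_vertex ge_min; case: b; rewrite lexx ?orbT. Qed.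

Lemma cd_cases x y :
  (exists b c, cd x y = coff b x + (wd (cend b x) (cend c y))%:R + coff c y) \/
  (exists b, [/\ csrc y = cend b x, ctgt y = cend (~~ b) x
     & cd x y = `|coff b x - cpos y|]).
Proof.
rewrite /cayley_dist; case: ifPn => [/andP[/eqP E1 /eqP E2]|_].
  by right; exists false; rewrite /= E1 E2.
case: ifPn => [/andP[/eqP E1 /eqP E2]|_].
  right; exists true; rewrite /= E1 E2; split=> //.
  by rewrite -normrN /coff; congr `| _ |; lra.
left; rewrite minElt; case: ifP => _.
  by have [b ->] := cd_vertexE x (csrc y); exists b, false; rewrite addrC.
by have [b ->] := cd_vertexE x (ctgt y); exists b, true; rewrite addrC.
Qed.

Lemma cd_direct x y b : csrc y = cend b x -> ctgt y = cend (~~ b) x ->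
  cd x y <= `|coff b x - cpos y|.
Proof.
rewrite /cayley_dist => E1 E2; case: ifPn => [/andP[/eqP E3 /eqP E4]|n1].
  case: b E1 E2 => //= E1 E2.
  have xd : csrc x = ctgt x by rewrite E3.
  have yd : csrc y = ctgt y by rewrite -E4.
  case: (cpos_edge x) => [[]//|[_ ->]]; case: (cpos_edge y) => [[]//|[_ ->]].
  by rewrite subrr normr0.
case: b E1 E2 => /= E1 E2; last by rewrite E1 E2 !eqxx in n1.
rewrite E1 E2 !eqxx /= -normrN le_eqVlt; apply/orP; left; apply/eqP.
by congr `| _ |; lra.
Qed.

(** Going through chosen ends is never shorter than [cayley_dist]. For two points of one edge this
    uses that the distinct ends of an edge are at word distance at least 1. *)
Lemma cd_le x y b c : cd x y <= coff b x + (wd (cend b x) (cend c y))%:R + coff c y.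
Proof.
have [n1|] := boolP ((csrc x == csrc y) && (ctgt x == ctgt y) ||
                     (csrc x == ctgt y) && (ctgt x == csrc y)); last first.
  rewrite negb_or => /andP[/negbTE n1 /negbTE n2].
  rewrite /cayley_dist n1 n2 ge_min; apply/orP; case: c.
    by right; have := cd_vertex_le x (ctgt y) b; rewrite /coff /=; lra.
  by left; have := cd_vertex_le x (csrc y) b; rewrite /coff /=; lra.
have [b' [E1 E2 b'x]] : exists b', [/\ csrc y = cend b' x, ctgt y = cend (~~ b') x
    & csrc x = ctgt x -> b' = false].
  case/orP: n1 => /andP[/eqP E1 /eqP E2]; first by exists false; rewrite /= E1 E2.
  have [xx|xx] := eqVneq (csrc x) (ctgt x); last first.
    by exists true; rewrite /= E1 E2; split=> // /eqP; rewrite -E1 -E2 (negbTE xx).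
  by exists false; rewrite /= -E1 -E2 xx.
apply: le_trans (cd_direct E1 E2) _.
have yE : cend c y = cend (b' (+) c) x by case: (c); rewrite /= ?E2 ?E1 ?addbT ?addbF.
have := cpos_itv x; have := cpos_itv y; rewrite ler_norml.
case: (eqVneq b (b' (+) c)) => [bE|bE].
  have := ler0n R (wd (cend b x) (cend c y)); rewrite bE.
  by move: (_%:R) => w; rewrite /coff; case: (b'); case: (c) => /=; lra.
have [xd|nd] := eqVneq (csrc x) (ctgt x).
  have := ler0n R (wd (cend b x) (cend c y)).
  case: (cpos_edge x) => [[]//|[_ x0]]; case: (cpos_edge y) => [[ny _]|[_ y0]].
    by case: ny; rewrite E1 E2; case: (b') => /=.
  move: (_%:R) => w; rewrite (b'x xd) /coff x0 y0; case: (c) (b) => [] [] /=; lra.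
have : 1 <= (wd (cend b x) (cend c y))%:R :> R.
  rewrite (ler_nat _ 1) lt0n yE; apply/negP => /eqP w0.
  have := @wd_le1 _ _ S_gen (cend b x) (cend (b' (+) c) x); rewrite w0 => /(_ isT).
  case=> [E|[E _]]; last first.
    have := has_wl S_gen ((cend b x)^-1 * cend (b' (+) c) x)%g.
    rewrite -[word_length _ _]/(wd _ _) w0 => -[w [/eqP]]; rewrite size_eq0 => /eqP -> _.
    by rewrite big_nil => E'; apply: E; rewrite -[RHS](mulVKg (cend b x)) -E' mulg1.
  by move: bE E nd; case: (b); case: (_ (+) _) => //= _ ->; rewrite eqxx.
move: (_%:R) bE => w; rewrite /coff; case: (b'); case: (c); case: (b) => //= _; lra.
Qed.

Lemma cd_ge0 x y : 0 <= cd x y.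
Proof.
case: (cd_cases x y) => [[b [c ->]]|[b [_ _ ->]]]; last exact: normr_ge0.
by rewrite !addr_ge0 // coff_ge0.
Qed.

Lemma cd_sym_le x y : cd y x <= cd x y.
Proof.
case: (cd_cases x y) => [[b [c ->]]|[b [E1 E2 ->]]].
  by apply: le_trans (cd_le y x c b) _; rewrite wd_sym //; lra.
case: b E1 E2 => /= E1 E2.
  apply: le_trans (@cd_direct y x true _ _) _ => //.
  by rewrite le_eqVlt /coff; apply/orP; left; apply/eqP; congr `| _ |; lra.
apply: le_trans (@cd_direct y x false _ _) _ => //.
by rewrite distrC.
Qed.

Lemma cd_sym x y : cd x y = cd y x.
Proof. by apply/eqP; rewrite eq_le !cd_sym_le. Qed.

Lemma coff_direct x y b c : csrc y = cend b x -> ctgt y = cend (~~ b) x ->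
  cend c y = cend (b (+) c) x /\ coff (b (+) c) x <= `|coff b x - cpos y| + coff c y.
Proof.
move=> E1 E2; split; first by case: c; rewrite /= ?E2 ?E1 ?addbT ?addbF.
have : - `|coff b x - cpos y| <= coff b x - cpos y <= `|coff b x - cpos y|.
  by rewrite -ler_norml.
by rewrite /coff; case: b {E1 E2}; case: c => /=; lra.
Qed.

Lemma cd_tri x y z : cd x z <= cd x y + cd y z.
Proof.
case: (cd_cases x y) => [[b [c ->]]|[b [E1 E2 ->]]];
  case: (cd_cases y z) => [[b' [c' ->]]|[b' [E1' E2' ->]]].
- apply: le_trans (cd_le x z b c') _.
  have := wd_cend c b' y.
  have : (wd (cend b x) (cend c' z))%:R <= (wd (cend b x) (cend c y))%:R +
    ((wd (cend c y) (cend b' y))%:R + (wd (cend b' y) (cend c' z))%:R) :> R.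
    rewrite -!natrD ler_nat; apply: leq_trans (wd_tri S_gen _ (cend c y) _) _.
    by rewrite leq_add2l wd_tri.
  lra.
- have [E E'] : cend (b' (+) c) z = cend c y /\
     coff (b' (+) c) z <= `|coff b' y - cpos z| + coff c y.
    split.
      have := proj1 (coff_direct (b' (+) c) E1' E2').
      by rewrite addbA addbb.
    have : - `|coff b' y - cpos z| <= coff b' y - cpos z <= `|coff b' y - cpos z|.
      by rewrite -ler_norml.
    by rewrite /coff; case: (b'); case: (c) => /=; lra.
  by apply: le_trans (cd_le x z b (b' (+) c)) _; rewrite E; lra.
- have [E E'] := coff_direct b' E1 E2.
  by apply: le_trans (cd_le x z (b (+) b') c') _; rewrite -E; lra.
have Ez1 : csrc z = cend (b (+) b') x.
  by rewrite E1'; exact: (proj1 (coff_direct b' E1 E2)).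
have Ez2 : ctgt z = cend (~~ (b (+) b')) x.
  by rewrite E2' (proj1 (coff_direct (~~ b') E1 E2)) addbN.
apply: le_trans (cd_direct Ez1 Ez2) _.
apply: le_trans (_ : `|coff (b (+) b') x - coff b' y| + `|coff b' y - cpos z| <= _).
  exact: ler_distD.
rewrite lerD2r le_eqVlt; apply/orP; left; apply/eqP; rewrite /coff.
by case: (b'); case: (b) => //=; rewrite -normrN; congr `| _ |; lra.
Qed.

Lemma wd_cd x y : (wd (csrc x) (csrc y))%:R <= cd x y + 2.
Proof.
have coff1 b z : (wd (csrc z) (cend b z))%:R <= 1 :> R.
  have := cpos_itv z; have := wd_cend false b z; rewrite /coff /=; case: b; try lra.
  by rewrite word_dist_refl.
case: (cd_cases x y) => [[b [c ->]]|[b [-> _ ->]]]; last first.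
  by have := coff1 b x; have := normr_ge0 (coff b x - cpos y); lra.
have : (wd (csrc x) (csrc y))%:R <= (wd (csrc x) (cend b x))%:R +
    ((wd (cend b x) (cend c y))%:R + (wd (cend c y) (csrc y))%:R) :> R.
  rewrite -!natrD ler_nat; apply: leq_trans (wd_tri S_gen _ (cend b x) _) _.
  by rewrite leq_add2l wd_tri.
have := coff1 b x; have := coff1 c y; rewrite (wd_sym S_gen (csrc y)).
by have := coff_ge0 b x; have := coff_ge0 c y; lra.
Qed.

Lemma cd_wd x y : cd x y <= (wd (csrc x) (csrc y))%:R + 2.
Proof.
apply: le_trans (cd_le x y false false) _.
by have := coff_le1 false x; have := coff_le1 false y; rewrite /=; lra.
Qed.

End CayleyMetric.

(** * Continuous paths and sequences of vertices *)

Section CayleyPaths.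
Variables (R : realType) (G : groupType) (S : set G).
Local Open Scope classical_set_scope.
Local Open Scope ring_scope.
Hypothesis S_gen : fin_generating S [set: G].
Local Notation wd := (word_dist S).
Local Notation point := (cayley_point R S).
Local Notation cd := (@cayley_dist R G S).
Implicit Types (x y z : point) (P : point -> Prop) (L : R).

(** A Lipschitz parametrization on [[0, 1]] gives continuity and the bound [L] on the length at
    once, and concatenation is a reparametrization proportional to the constants. *)
Definition lip_path P x y L := exists f : R -> point, [/\ f 0 = x, f 1 = y,
  forall s t, 0 <= s -> s <= t -> t <= 1 -> cd (f s) (f t) <= L * (t - s)
  & forall t, 0 <= t <= 1 -> P (f t)].

Lemma lip_path_cat P x y z L1 L2 : 0 < L1 -> 0 < L2 ->
  lip_path P x y L1 -> lip_path P y z L2 -> lip_path P x z (L1 + L2).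
Proof.
move=> L10 L20 [f [f0 f1 fl fP]] [g [g0 g1 gl gP]].
pose l := L1 / (L1 + L2).
have L0 : 0 < L1 + L2 by exact: addr_gt0.
have l0 : 0 < l by exact: divr_gt0.
have l1 : l < 1 by rewrite /l ltr_pdivrMr // mul1r ltrDl.
have L1E : L1 = (L1 + L2) * l by rewrite /l mulrC divfK ?gt_eqF.
have L2E : L2 = (L1 + L2) * (1 - l) by rewrite mulrBr mulr1 -L1E addrC addKr.
have dl t : 0 <= t -> t <= l -> 0 <= t / l <= 1.
  by move=> t0 tl; rewrite divr_ge0 ?(ltW l0) //= ler_pdivrMr // mul1r.
have dr t : l <= t -> t <= 1 -> 0 <= (t - l) / (1 - l) <= 1.
  move=> lt t1; rewrite divr_ge0 ?subr_ge0 ?(ltW l1) //=.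
  by rewrite ler_pdivrMr ?subr_gt0 // mul1r lerB.
have El s t : L1 * (t / l - s / l) = (L1 + L2) * (t - s).
  by rewrite -mulrBl mulrC -mulrA [l^-1 * _]mulrC {1}L1E mulfK ?gt_eqF // mulrC.
have Er s t : L2 * ((t - l) / (1 - l) - (s - l) / (1 - l)) = (L1 + L2) * (t - s).
  rewrite -mulrBl mulrC -mulrA [(1 - l)^-1 * _]mulrC {1}L2E mulfK ?subr_eq0 ?gt_eqF //.
  by rewrite mulrC; congr (_ * _); lra.
exists (fun t => if t <= l then f (t / l) else g ((t - l) / (1 - l))); split.
- by rewrite (ltW l0) mul0r.
- by rewrite leNgt l1 /= divff // subr_eq0 gt_eqF.
- move=> s t s0 st t1; case: (leP t l) => tl.
    rewrite (le_trans st tl) -El; have /andP[a b] := dl s s0 (le_trans st tl).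
    have /andP[c d] := dl t (le_trans s0 st) tl.
    by apply: fl => //; rewrite ler_pM2r ?invr_gt0.
  have /andP[c d] := dr t (ltW tl) t1.
  case: (leP s l) => sl; last first.
    have /andP[a b] := dr s (ltW sl) (le_trans st t1).
    by rewrite -Er; apply: gl => //; rewrite ler_pM2r ?invr_gt0 ?subr_gt0 // lerD2r.
  have /andP[a b] := dl s s0 sl.
  apply: le_trans (cd_tri S_gen _ y _) _; rewrite -{1}f1 -g0.
  have := fl _ _ a b (lexx 1); have := gl _ _ (lexx 0) c d.
  have -> : L1 * (1 - s / l) = (L1 + L2) * (l - s) by rewrite -El divff ?gt_eqF.
  have -> : L2 * ((t - l) / (1 - l) - 0) = (L1 + L2) * (t - l).
    by rewrite -Er subrr mul0r.
  by rewrite !mulrBr; lra.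
move=> t /andP[t0 t1]; case: (leP t l) => tl; first by apply: fP; exact: dl.
by apply: gP; apply: dr => //; exact: ltW.
Qed.

Lemma lip_path_div c a b gam delta L : 0 < L ->
  lip_path (fun z => ~ (cd c z < delta * dist_to_pair cd c a b - gam)) a b L ->
  (div_pts cd gam delta a b c <= L%:E)%E.
Proof.
move=> L0 [f [f0 f1 fl fP]].
apply: le_trans (ereal_inf_lbound _) _.
  exists f => //; split=> // s /andP[s0 s1] e e0.
  exists (e / L); first exact: divr_gt0.
  move=> t /andP[t0 t1]; rewrite ltr_pdivlMr // mulrC => lt.
  apply: le_lt_trans lt; case: (leP s t) => st.
    by apply: le_trans (fl _ _ s0 st t1) _; rewrite distrC ger0_norm // subr_ge0.
  rewrite cd_sym //; apply: le_trans (fl _ _ t0 (ltW st) s1) _.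
  by rewrite ger0_norm // subr_ge0 ltW.
apply: ge_ereal_sup => _ [s sp <-]; rewrite lee_fin.
have mono i : (i < size s)%N -> nth 1 (0 :: s) i <= nth 1 (0 :: s) i.+1.
  move=> si; have [/(pathP 1)/(_ i si)] := sp => lt _.
  exact: ltW.
apply: le_trans (_ : \sum_(0 <= i < size s) L * (nth 1 (0 :: s) i.+1 - nth 1 (0 :: s) i) <= _).
  rewrite !big_nat; apply: ler_sum => i /andP[_ si]; apply: fl; last 2 first.
  - exact: mono.
  - by apply: itv_partition_nth_le sp; rewrite ltnS.
  - by apply: itv_partition_nth_ge sp; rewrite ltnS ltnW.
rewrite -mulr_sumr telescope_sumr // (itv_partition_nth_size _ sp) subr0 mulr1 //.
Qed.

Definition vtx (g : G) : point :=
  @CayleyPoint R G S g g 0 (introT andP (conj (lexx 0) ler01)) (or_intror (conj erefl erefl)).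

Lemma cd_vtx g h : cd (vtx g) (vtx h) <= (wd g h)%:R.
Proof.
by apply: le_trans (cd_le S_gen _ _ false false) _; rewrite /= add0r addr0.
Qed.

Lemma wd_tri_lip P x L : 0 < L -> P x -> lip_path P x x L.
Proof.
move=> L0 Px; exists (fun=> x); split=> // s t _ st _.
rewrite /cayley_dist !eqxx /= subrr normr0 mulr_ge0 ?subr_ge0 // ltW //.
Qed.

Lemma lip_edge (Q : G -> Prop) g h : (wd g h <= 1)%N -> Q g -> Q h ->
  lip_path (fun z => Q (csrc z)) (vtx g) (vtx h) 1.
Proof.
move=> /(wd_le1 S_gen)[<- Qg _|gh Qg Qh]; first exact: wd_tri_lip.
pose e (t : R) : point := if pselect (0 <= t <= 1) is left H
  then CayleyPoint H (or_introl gh) else vtx g.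
have eE u : 0 <= u -> u <= 1 -> [/\ csrc (e u) = g, ctgt (e u) = h & cpos (e u) = u].
  by move=> u0 u1; rewrite /e; case: pselect => // -[]; rewrite u0.
(* The values at the ends are overridden: the edge points at positions 0 and 1 are at distance 0
   from the vertices but are different records. *)
exists (fun t => if t == 0 then vtx g else if t == 1 then vtx h else e t); split.
- by rewrite eqxx.
- by rewrite eqxx oner_eq0.
- move=> s t s0 st t1; rewrite mul1r.
  have [sg sh ss] := eE s s0 (le_trans st t1); have [tg th tt] := eE t (le_trans s0 st) t1.
  have t0 := le_trans s0 st; have s1 := le_trans st t1.
  have cxx x : cd x x = 0 by rewrite /cayley_dist !eqxx /= subrr normr0.
  case: (eqVneq s 0) => [->|sn0]; case: (eqVneq t 0) => [tE|tn0].
  + by rewrite tE cxx subrr.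
  + case: (eqVneq t 1) => [->|tn1].
      apply: le_trans (cd_vtx _ _) _; rewrite subr0 (ler_nat _ _ 1) wd_adj //.
    apply: le_trans (cd_le S_gen _ _ false false) _.
    by rewrite /= tg tt word_dist_refl; lra.
  + by move: sn0; rewrite (_ : s = 0) ?eqxx //; lra.
  + case: (eqVneq s 1) => [sE|sn1].
      by rewrite (_ : t = 1) ?eqxx ?cxx ?sE ?subrr //; lra.
    case: (eqVneq t 1) => [->|tn1].
      apply: le_trans (cd_le S_gen _ _ true false) _.
      by rewrite /= sh ss word_dist_refl; lra.
    apply: le_trans (@cd_direct _ _ _ _ _ false _ _) _; rewrite /= ?tg ?th //.
    by rewrite ss tt distrC ger0_norm // subr_ge0.
move=> t /andP[t0 t1]; case: eqP => // _; case: eqP => // _.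
by have [-> _ _] := eE t t0 t1.
Qed.

Lemma lip_vertices (Q : G -> Prop) g p : path (fun a b => (wd a b <= 1)%N) g p ->
  (forall v, v \in g :: p -> Q v) ->
  lip_path (fun z => Q (csrc z)) (vtx g) (vtx (last g p)) (size p).+1%:R.
Proof.
elim: p g => [|h p IH] g /= => [_ Qg|/andP[gh pp] Qg].
  by apply: wd_tri_lip => //; apply: Qg; rewrite mem_head.
rewrite -addn1 addnC natrD; apply: lip_path_cat (lip_edge gh _ _) (IH _ pp _) => //.
- by apply: Qg; rewrite mem_head.
- by apply: Qg; rewrite !inE eqxx orbT.
- by move=> v vp; apply: Qg; rewrite inE vp orbT.
Qed.

Lemma lip_source (Q : G -> Prop) x : Q (csrc x) ->
  lip_path (fun z => Q (csrc z)) x (vtx (csrc x)) 1.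
Proof.
move=> Qx; have /andP[x0 x1] := cpos_itv x.
have hpos t : 0 <= t <= 1 -> 0 <= cpos x * (1 - t) <= 1.
  move=> /andP[t0 t1]; rewrite mulr_ge0 ?subr_ge0 //=.
  by apply: le_trans (ler_pM _ _ x1 (_ : _ <= 1)) _; rewrite ?mulr1 ?subr_ge0 //; lra.
have hedge t : cayley_adj S (csrc x) (ctgt x) \/ (csrc x = ctgt x /\ cpos x * (1 - t) = 0).
  by case: (cpos_edge x) => [|[-> ->]]; [left | right; rewrite mul0r].
pose e (t : R) : point := if pselect (0 <= t <= 1) is left H
  then CayleyPoint (hpos t H) (hedge t) else x.
have eE u : 0 <= u -> u <= 1 ->
    [/\ csrc (e u) = csrc x, ctgt (e u) = ctgt x & cpos (e u) = cpos x * (1 - u)].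
  by move=> u0 u1; rewrite /e; case: pselect => // -[]; rewrite u0.
exists (fun t => if t == 1 then vtx (csrc x) else if t == 0 then x else e t); split.
- by rewrite eqxx eq_sym oner_eq0.
- by rewrite eqxx.
- move=> s t s0 st t1; rewrite mul1r.
  have t0 := le_trans s0 st; have s1 := le_trans st t1.
  pose e' u := if u == 0 then x else e u.
  have e'E u : 0 <= u -> u <= 1 ->
      [/\ csrc (e' u) = csrc x, ctgt (e' u) = ctgt x & cpos (e' u) = cpos x * (1 - u)].
    move=> u0 u1; rewrite /e'; case: eqP => [->|_]; last exact: eE.
    by rewrite subr0 mulr1.
  have [sg sh ss] := e'E s s0 s1; have [tg th tt] := e'E t t0 t1.
  have cxx y : cd y y = 0 by rewrite /cayley_dist !eqxx /= subrr normr0.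
  rewrite -/(e' s) -/(e' t); case: (eqVneq s 1) => [sE|sn1].
    have -> : t = 1 by lra.
    by rewrite eqxx cxx sE subrr.
  case: (eqVneq t 1) => [->|tn1].
    apply: le_trans (cd_le S_gen _ _ false false) _.
    rewrite /= sg ss word_dist_refl !addr0 -[leRHS]mul1r ler_wpM2r ?subr_ge0 //.
  apply: le_trans (@cd_direct _ _ _ _ _ false _ _) _; rewrite /= ?tg ?th ?sg ?sh //.
  rewrite ss tt -mulrBr normrM ger0_norm // (_ : 1 - s - (1 - t) = t - s); last by lra.
  by rewrite ger0_norm ?subr_ge0 // -[leRHS]mul1r ler_wpM2r ?subr_ge0.
move=> t /andP[t0 t1]; case: eqP => // _; case: eqP => // _.
by have [-> _ _] := eE t t0 t1.
Qed.

Lemma lip_path_rev P x y L : lip_path P x y L -> lip_path P y x L.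
Proof.
move=> [f [f0 f1 fl fP]]; exists (fun t => f (1 - t)); split.
- by rewrite subr0.
- by rewrite subrr.
- move=> s t s0 st t1; rewrite cd_sym //; apply: le_trans (fl (1 - t) (1 - s) _ _ _) _; [lra|lra|lra|].
  by rewrite (_ : 1 - s - (1 - t) = t - s) //; lra.
- by move=> t /andP[t0 t1]; apply: fP; apply/andP; split; lra.
Qed.

Section Discretization.
Variable f : R -> point.

Fixpoint chain_length (a : R) (s : seq R) : R :=
  if s is b :: s' then cd (f a) (f b) + chain_length b s' else 0.

Lemma chain_lengthE a s : chain_length a s =
  \sum_(0 <= i < size s) cd (f (nth 1 (a :: s) i)) (f (nth 1 (a :: s) i.+1)).
Proof.
elim: s a => [|b s IH] a /=; first by rewrite big_nil.
by rewrite big_nat_recl //= IH.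
Qed.

(** The supremum of the times reachable by a subdivision with steps shorter than 1 is itself
    reachable, by continuity there, and could be passed if it were less than 1. *)
Lemma fine_partition : continuous_path cd f ->
  exists s, itv_partition 0 1 s /\ path (fun u v => cd (f u) (f v) < 1) 0 s.
Proof.
move=> fc; pose A := [set t : R | 0 <= t <= 1 /\ exists s,
  [/\ path <%R 0 s, last 0 s = t & path (fun u v => cd (f u) (f v) < 1) 0 s]].
have A0 : A 0 by split; [rewrite lexx ler01 | exists [::]].
have Aub : has_sup A.
  by split; [exists 0 | exists 1 => t [/andP[]]].
pose t1 := sup A.
have t1ge : 0 <= t1 by apply: ub_le_sup => //; case: Aub.
have t1le : t1 <= 1 by apply: ge_sup; [exists 0 | move=> t [/andP[]]].
have [eta eta0 Heta] := fc t1 (introT andP (conj t1ge t1le)) (1 / 2) ltac:(lra).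
have [t At tt1] := sup_adherent eta0 Aub; rewrite -/t1 in tt1.
have tle : t <= t1 by apply: ub_le_sup => //; case: Aub.
pose t2 := Num.min 1 (t1 + eta / 2).
have t2E : t2 <= 1 /\ t2 <= t1 + eta / 2 by rewrite /t2 !ge_min !lexx orbT.
have t12 : t1 <= t2 by rewrite le_min t1le /=; lra.
have At2 : A t2.
  case: At => /andP[t0 tl1] [s [sp sl sf]].
  split; first by apply/andP; split; lra.
  have [tt2|tt2] := eqVneq t t2; first by exists s; rewrite -tt2.
  exists (rcons s t2); rewrite !rcons_path last_rcons sp sf sl; split=> //=.
    by rewrite lt_neqAle tt2 (le_trans tle t12).
  apply: le_lt_trans (cd_tri S_gen _ (f t1) _) _.
  have h1 : cd (f t1) (f t) < 1 / 2.
    by apply: Heta; [apply/andP; split; lra | rewrite ger0_norm; lra].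
  have h2 : cd (f t1) (f t2) < 1 / 2.
    by apply: Heta; [apply/andP; split; lra | rewrite ltr_norml; lra].
  by rewrite cd_sym //; lra.
have t21 : t2 <= t1 by apply: ub_le_sup => //; case: Aub.
have t2e1 : t2 = 1.
  by move: t21; rewrite /t2 minElt; case: ifP => // _; lra.
have [_ [s [sp sl sf]]] := At2.
by exists s; split=> //; split=> //; rewrite sl t2e1.
Qed.

(** Greedy thinning: [a] is the last point kept, and the next one is kept only at distance at least
    1 from it, so that each kept point uses up a unit of length. [sigma] carries the length spent
    since [a]. *)
Lemma coarsen a b s sigma :
  cd (f a) (f b) < 1 -> cd (f a) (f b) <= sigma ->
  path (fun u v => cd (f u) (f v) < 1) b s ->
  exists w, [/\ path (fun u v => cd (f u) (f v) < 2) a w, last a w = last b s,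
    {subset w <= b :: s} & (size w)%:R <= sigma + chain_length b s + 1].
Proof.
elim: s a b sigma => [|c s IH] a b sigma ab1 ab /=.
  move=> _; exists [:: b]; split=> //=; first by rewrite andbT (lt_trans ab1) // ltr1n.
  by have := cd_ge0 (f a) (f b); lra.
case/andP => bc sp; have tri := cd_tri S_gen (f a) (f b) (f c).
case: (ltP (cd (f a) (f c)) 1) => ac.
  have [|w [w1 w2 w3 w4]] := IH a c (sigma + cd (f b) (f c)) ac _ sp; first by lra.
  exists w; split=> //; first by move=> u /w3 H; rewrite inE H orbT.
  by lra.
have cc0 : cd (f c) (f c) = 0 by rewrite /cayley_dist !eqxx /= subrr normr0.
have [| |w [w1 w2 w3 w4]] := IH c c 0 _ _ sp; rewrite ?cc0 //.
exists (c :: w); split=> //=.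
- by rewrite w1 andbT; lra.
- by move=> u; rewrite inE => /orP[/eqP->|/w3 H]; rewrite inE ?H ?orbT // mem_head orbT.
- by rewrite -addn1 natrD; lra.
Qed.

Lemma discretize (P : point -> Prop) L : continuous_path cd f ->
  (forall t, 0 <= t <= 1 -> P (f t)) -> (path_length cd f <= L%:E)%E ->
  exists ws : seq G, [/\ path (fun g h => (wd g h <= 4)%N) (csrc (f 0)) ws,
    last (csrc (f 0)) ws = csrc (f 1),
    (size ws)%:R <= L + 1 & forall v, v \in ws -> exists2 z, P z & csrc z = v].
Proof.
move=> fc fP fL; have [s [sp sf]] := fine_partition fc.
have sL : chain_length 0 s <= L.
  rewrite -lee_fin; apply: le_trans fL; apply: ereal_sup_ubound; exists s => //.
  by rewrite chain_lengthE.
have cc0 : cd (f 0) (f 0) = 0 by rewrite /cayley_dist !eqxx /= subrr normr0.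
have [| |w [w1 w2 w3 w4]] := @coarsen 0 0 s 0 _ _ sf; rewrite ?cc0 //.
have last1 : last 0 s = 1 by case: sp => _ /eqP.
exists (map (fun t => csrc (f t)) w); split.
- elim: w (0 : R) w1 {w2 w3 w4} => //= b w IH a /andP[ab wp].
  rewrite IH // andbT; have := wd_cd S_gen (f a) (f b) => H.
  rewrite -ltnS -(@ltr_nat R); apply: le_lt_trans H _.
  rewrite (_ : 5%:R = 2 + 3 :> R) -?natrD //; lra.
- by rewrite (last_map (fun t => csrc (f t))) w2 last1.
- by rewrite size_map; lra.
move=> v /mapP[t tw ->]; exists (f t) => //; apply: fP.
have := w3 t tw; rewrite inE => /orP[/eqP ->|ts]; first by rewrite lexx ler01.
have tsz : (index t s < size s)%N by rewrite index_mem.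
have <- : nth 1 (0 :: s) (index t s).+1 = t by rewrite /= nth_index.
by rewrite (itv_partition_nth_ge _ sp) ?(itv_partition_nth_le _ sp).
Qed.

End Discretization.

End CayleyPaths.

(** * Quadratic divergence *)

Section StdPaths.
Variables (V : finType) (Gam : sgraph V).
Local Notation W := (racg Gam).
Local Notation adj := (sgraph_adj Gam).
Local Notation gen := (gen Gam).
Local Notation el := (el Gam).
Local Notation len := (@len V Gam).
Local Open Scope group_scope.
Implicit Types (x y z g h c : W) (s t v : V) (u w : seq V) (e f : V * V).

Definition std_path (P : W -> Prop) (N : nat) x y := exists u,
  [/\ (size u <= N)%N, y = x * el u & forall k, P (x * el (take k u))].

Lemma std_path_refl P N x : P x -> std_path P N x x.
Proof. by move=> Px; exists [::]; split=> //= [|k]; rewrite mulg1. Qed.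

Lemma std_path_cat P M N x y z :
  std_path P M x y -> std_path P N y z -> std_path P (M + N) x z.
Proof.
move=> [u [uM -> uP]] [w [wN -> wP]]; exists (u ++ w); split.
- by rewrite size_cat leq_add.
- by rewrite el_cat mulgA.
move=> k; rewrite take_cat; case: ltnP => _; first exact: uP.
by rewrite el_cat mulgA.
Qed.

Lemma std_path_le P M N x y : (M <= N)%N -> std_path P M x y -> std_path P N x y.
Proof. by move=> MN [u [uM yE uP]]; exists u; split=> //; exact: leq_trans MN. Qed.

Lemma std_path_edge P x s : P x -> P (x * gen s) -> std_path P 1 x (x * gen s).
Proof.
move=> Px Pxs; exists [:: s]; split=> [//||[|k]] /=; first by rewrite mulg1.
  by rewrite mulg1.
by rewrite mulg1.
Qed.

Lemma alt_rcons n s t : exists l, alt n.+1 s t = rcons (alt n s t) l.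
Proof.
elim: n s t => [|n IH] s t; first by exists s.
by have [l E] := IH t s; exists l; rewrite -[alt n.+2 s t]/(s :: alt n.+1 t s) E.
Qed.

Lemma size_alt n s t : size (alt n s t) = n.
Proof. by elim: n s t => //= n IH s t; rewrite IH. Qed.

Lemma mem_alt n s t v : v \in alt n s t -> (v == s) || (v == t).
Proof.
elim: n s t => //= n IH s t; rewrite inE => /orP[->//|/IH].
by rewrite orbC.
Qed.

Lemma len_alt_other R e w : e.1 != e.2 -> ~~ adj e.1 e.2 ->
  {in w, forall v, v != e.1 /\ v != e.2} ->
  (R./2 <= len (el (alt R e.1 e.2) * el w))%N.
Proof.
move=> en ea we; have := lin_len en ea (el (alt R e.1 e.2) * el w).
have [E _] := lin_alt en ea R; rewrite /lin in E *.
by rewrite dihM // (lin_other en ea we) E abszN.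
Qed.

Lemma len_alt R e : e.1 != e.2 -> ~~ adj e.1 e.2 ->
  (R./2 <= len (el (alt R e.1 e.2)))%N.
Proof. by move=> en ea; rewrite -[el _]mulg1 -[1]/(el [::]) len_alt_other. Qed.

Lemma square_other e f v : square Gam e f -> (v == f.1) || (v == f.2) ->
  v != e.1 /\ v != e.2.
Proof.
case/and5P => _ _ _ _ /and4P[a b c d] /pred2P[]->; split;
  by apply/eqP => E; move: a b c d; rewrite E ?adj_irr // => ? ?; rewrite adj_irr.
Qed.

(** The two lines of a flat commute: the word along [f] is appended, then the word along [e] is
    removed. At every moment one of the two coordinates is complete, so the path stays far from
    [x]. *)
Lemma std_path_square (P : W -> Prop) R x e f : square Gam e f ->
  (forall v : W, (R./2 <= len (x^-1 * v))%N -> P v) ->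
  std_path P (R + R) (x * el (alt R e.1 e.2)) (x * el (alt R f.1 f.2)).
Proof.
move=> ef HP; have fe := square_sym ef.
have [en ea fn fa _] := and5P ef.
have comm : el (alt R e.1 e.2) * el (alt R f.1 f.2) =
            el (alt R f.1 f.2) * el (alt R e.1 e.2).
  apply: (@gen_comm_words _ _ (pred2 e.1 e.2) (pred2 f.1 f.2)).
  - by apply/allP => v /mem_alt.
  - by apply/allP => v /mem_alt.
  case/and5P: ef => _ _ _ _ /and4P[a b c d] s t.
  by move=> /pred2P[]-> /pred2P[]->.
apply: std_path_cat.
  exists (alt R f.1 f.2); split; [by rewrite size_alt | reflexivity |] => k.
  apply: HP; rewrite -mulgA mulKg; apply: len_alt_other => // v /mem_take/mem_alt.
  exact: square_other.
exists (rev (alt R e.1 e.2)); split; first by rewrite size_rev size_alt.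
  by rewrite -!mulgA [_ * (_ * el (rev _))]mulgA comm -!mulgA el_rev mulgV mulg1.
move=> k; apply: HP; rewrite -!mulgA mulKg mulgA comm -mulgA -el_cat.
apply: len_alt_other => // v; rewrite mem_cat => /orP[/mem_alt|/mem_take].
  exact: square_other.
by rewrite mem_rev => /mem_alt; exact: square_other.
Qed.

Variables (e0 f0 : V * V).
Hypothesis e0_square : square Gam e0 f0.
Hypothesis e0_cover : forall v, exists t, connect (square Gam) e0 (v, t).

Local Notation comp := (connect (square Gam) e0).

Lemma comp_square e : comp e -> exists f, square Gam e f.
Proof.
case/connectP => p; elim/last_ind: p e => [|p e' _] e; first by move=> _ ->; exists f0.
rewrite rcons_path last_rcons => /andP[_ sq] ->.
by exists (last e0 p); exact: square_sym.
Qed.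

Lemma comp_swap e : comp e -> comp (e.2, e.1).
Proof.
move=> ce; have [f ef] := comp_square ce.
apply: connect_trans ce _; apply: connect_trans (connect1 ef) _.
exact/connect1/square_sym/square_swap.
Qed.

Lemma square_connect_sym : connect_sym (square Gam).
Proof.
by apply: sym_connect_sym => e f; apply/idP/idP; exact: square_sym.
Qed.

Local Notation Lam := (#|{: V * V}|).

Lemma std_path_comp (P : W -> Prop) R x e f : comp e -> comp f ->
  (forall v : W, (R./2 <= len (x^-1 * v))%N -> P v) ->
  std_path P (Lam * (R + R)) (x * el (alt R e.1 e.2)) (x * el (alt R f.1 f.2)).
Proof.
move=> ce cf HP.
have : connect (square Gam) e f by apply: connect_trans cf; rewrite square_connect_sym.
case/connectP => p0 pp0 lp0; case: (shortenP pp0) lp0 => p pp up _ lp {p0 pp0}.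
have sp : (size p <= Lam)%N.
  by have := max_card [in e :: p]; rewrite (card_uniqP up) => /ltnW.
apply: (@std_path_le _ (size p * (R + R))%N); first by rewrite leq_mul2r sp orbT.
have [g eg] := comp_square ce.
elim: p e g pp lp {ce up sp} eg => [|e1 p IH] e g /=.
  move=> _ -> eg; apply: std_path_refl; apply: HP; rewrite mulKg.
  by case/and5P: eg => en ea _ _ _; exact: len_alt.
case/andP => ee1 pp lp eg; rewrite mulSn.
apply: std_path_cat (std_path_square ee1 HP) _.
by apply: IH pp lp _; exact: square_sym ee1.
Qed.

(* The path [x w] is pushed to distance [R] along the lines of the square
   complex; each letter of [w] costs a number of steps linear in [R]. *)
Lemma far_path (P : W -> Prop) R w x e f : (0 < R)%N -> comp e -> comp f ->
  (forall i (v : W), (R./2 <= (len ((x * el (take i w))^-1 * v)).+1)%N -> P v) ->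
  std_path P ((size w).+1 * (Lam * (R + R) + 1))
    (x * el (alt R e.1 e.2)) (x * el w * el (alt R f.1 f.2)).
Proof.
case: R => // R _; elim: w x e => [|s w IH] x e ce cf HP.
  rewrite mul1n mulg1; apply: std_path_le (std_path_comp ce cf _); first exact: leq_addr.
  by move=> v Hv; apply: (HP 0%N); rewrite mulg1 ltnW.
have [t cst] := e0_cover s.
have HPx (v : W) : (R.+1./2 <= len (x^-1 * v))%N -> P v.
  by move=> Hv; apply: (HP 0%N); rewrite mulg1 ltnW.
have P1 := std_path_comp ce cst HPx.
have cts : comp (t, s) := comp_swap cst.
have [f' sqf] := comp_square cst; have [stn sta _ _ _] := and5P sqf.
rewrite -[(size (s :: w)).+1]/((size w).+2) mulSn.
apply: (@std_path_cat _ _ _ _ (x * gen s * el (alt R.+1 t s))); last first.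
  rewrite -[el (s :: w)]/(gen s * el w) [x * (_ * _)]mulgA; apply: (IH _ (t, s)) => // i v Hv.
  by apply: (HP i.+1); rewrite /= !mulgA in Hv *.
(* The ray at [x] that starts with [s] is, seen from [x * gen s], the ray that starts with [t], one
   letter shorter; a single edge completes it. *)
apply: std_path_cat P1 _; rewrite -[el (alt R.+1 (s, t).1 (s, t).2)]/(gen s * el (alt R t s)).
have [l lE] := alt_rcons R t s.
rewrite lE el_rcons !mulgA; apply: std_path_edge.
  apply: (HP 0%N); rewrite mulg1 -!mulgA mulKg -[gen s * _]/(el (alt R.+1 s t)).
  by apply: leqW; exact: (@len_alt R.+1 (s, t)).
apply: (HP 1%N); rewrite /= take0 /= mulg1 -[_ * gen l]mulgA -el_rcons -lE mulKg.
apply: leqW; apply: (@len_alt R.+1 (t, s)); first by rewrite eq_sym.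
by rewrite adj_sym.
Qed.

End StdPaths.

Lemma far_arith (T X cy yv cv ca ay : nat) : (4 * X + 16 + T <= yv)%N -> (ay <= T)%N ->
  (ca <= 3 * X + 14)%N -> (yv <= cy + cv)%N -> (cy <= ca + ay)%N -> (X + 2 <= cv)%N.
Proof. lia. Qed.

Lemma radius_arith (K X : nat) :
  (2 * (K * (4 * X + 16 + K * K * (X + 2)) + 2) <=
   2 * (K * (16 + K * K * 2) + 2) * (X + 1))%N.
Proof.
have h : (4 * X + 16 + K * K * (X + 2) <= (16 + K * K * 2) * (X + 1))%N.
  by move: (K * K)%N => T; nia.
have -> : (2 * (K * (16 + K * K * 2) + 2) * (X + 1) =
  2 * (K * ((16 + K * K * 2) * (X + 1)) + 2 * (X + 1)))%N by ring.
rewrite leq_mul2l /=; apply: leq_add; last by rewrite leq_pmulr // addn1.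
by rewrite leq_mul2l h orbT.
Qed.

Lemma count_arith (K X w : nat) : (w <= K * (X + 2))%N ->
  (w.+1 <= (2 * K + 1) * (X + 1))%N.
Proof. nia. Qed.

Lemma detour_arith (K Lam X w R0 rho A N p : nat) :
  (R0 <= rho * (X + 1))%N -> (w.+1 <= (2 * K + 1) * (X + 1))%N ->
  A = (2 * rho + (2 * K + 1) * (Lam * (2 * rho) + 1))%N ->
  N = (R0 + (w.+1 * (Lam * (R0 + R0) + 1) + R0))%N ->
  (p <= K * N)%N -> (p.+3 <= (K * A + 3) * (X + 1) ^ 2)%N.
Proof.
move=> R0X wX AE NE pN; set Y := (X + 1)%N in R0X wX *.
have Y0 : (0 < Y)%N by rewrite /Y addn1.
have NY : (N <= A * Y ^ 2)%N.
  have h1 : (R0 <= rho * Y ^ 2)%N.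
    by apply: leq_trans R0X _; rewrite leq_mul2l -mulnn leq_pmulr ?orbT.
  have h2 : (Lam * (R0 + R0) + 1 <= (Lam * (2 * rho) + 1) * Y)%N.
    rewrite mulnDl mul1n leq_add //; rewrite -mulnA leq_mul2l; apply/orP; right.
    by rewrite -mulnA addnn -mul2n leq_mul2l.
  have h3 := leq_mul wX h2; rewrite NE AE.
  have -> : ((2 * rho + (2 * K + 1) * (Lam * (2 * rho) + 1)) * Y ^ 2 =
    rho * Y ^ 2 + ((2 * K + 1) * Y * ((Lam * (2 * rho) + 1) * Y) + rho * Y ^ 2))%N.
    by rewrite -mulnn; ring.
  by rewrite leq_add // leq_add.
have h4 : (K * N <= K * A * Y ^ 2)%N by rewrite -mulnA leq_mul2l NY orbT.
have h5 : (3 <= 3 * Y ^ 2)%N by rewrite leq_pmulr // expn_gt0 Y0.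
rewrite mulnDl -addn3; apply: leq_add => //; exact: leq_trans pN h4.
Qed.

(** * Comparison with an arbitrary finite generating set *)

Section QuasiIsometry.
Variables (V : finType) (Gam : sgraph V) (S : set (racg Gam)).
Local Notation W := (racg Gam).
Local Notation gen := (gen Gam).
Local Notation el := (el Gam).
Local Notation len := (@len V Gam).
Local Notation wd := (word_dist S).
Local Open Scope group_scope.
Local Open Scope classical_set_scope.
Implicit Types (x y z g h c : W) (s t v : V) (u w : seq V) (e f : V * V).
Hypothesis S_gen : fin_generating S [set: W].

Lemma qi_constant : exists K, (0 < K)%N /\ forall x y,
  (wd x y <= K * len (x^-1 * y))%N /\ (len (x^-1 * y)%g <= K * wd x y)%N.
Proof.
have [/finite_seqP[sS SE] _] := S_gen.
pose K1 := \max_(v : V) word_length S (gen v); pose K2 := \max_(g <- sS) len g.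
exists (K1 + K2).+1; split=> // x y; rewrite /word_dist; move: (x^-1 * y) => g; split.
  have [u <- {1}->] := len_word g; apply: leq_trans (_ : K1 * size u <= _)%N; last first.
    by rewrite leq_mul2r leqW ?orbT // leq_addr.
  elim: u => [|v u IH] /=; first by rewrite muln0 (wl_le (has_word1 S)).
  by rewrite mulnS; apply: leq_trans (wlM S_gen _ _) _; rewrite leq_add // leq_bigmax.
have [w [<- wS <-]] := has_wl S_gen g.
apply: leq_trans (_ : K2 * size w <= _)%N; last first.
  by rewrite leq_mul2r leqW ?orbT // leq_addl.
elim: w wS => [|h w IH] wS; first by rewrite big_nil len1.
rewrite big_cons mulnS; apply: leq_trans (lenM _ _) _; apply: leq_add; last first.
  by apply: IH => k kw; apply: wS; rewrite inE kw orbT.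
have sK k : S k -> (len k <= K2)%N by rewrite SE => /leq_bigmax_seq; apply.
by case: (wS h (mem_head _ _)) => /sK //; rewrite lenV.
Qed.

Variable K : nat.
Hypothesis wdK : forall x y, (wd x y <= K * len (x^-1 * y))%N.
Hypothesis lenK : forall x y, (len (x^-1 * y)%g <= K * wd x y)%N.

Lemma wd_gen x s : (wd x (x * gen s) <= K)%N.
Proof.
by apply: leq_trans (wdK _ _) _; rewrite mulKg -[leqRHS]muln1 leq_mul2l len_gen orbT.
Qed.

Lemma std_path_wd (P : W -> Prop) N x y : std_path P N x y ->
  exists p, [/\ path (fun a b => (wd a b <= 1)%N) x p, last x p = y,
    (size p <= K * N)%N
    & forall v : W, v \in x :: p -> exists g, P g /\ (wd g v <= K)%N].
Proof.
move=> [u [uN -> uP]].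
have [p [pp lp sp vp]] : exists p, [/\ path (fun a b => (wd a b <= 1)%N) x p,
    last x p = x * el u, (size p <= K * size u)%N
    & forall v : W, v \in x :: p -> exists g, P g /\ (wd g v <= K)%N].
  elim: u x {uN} uP => [|s u IH] x uP.
    exists [::]; split; rewrite ?muln0 //= ?mulg1 // => v; rewrite inE => /eqP ->.
    by exists x; split; [have := uP 0%N; rewrite mulg1 | rewrite word_dist_refl].
  have [|p [pp lp sp vp]] := IH (x * gen s).
    by move=> k; have := uP k.+1; rewrite /= mulgA.
  have [q [pq lq sq /allP vq]] := wd_path S_gen x (x * gen s).
  exists (q ++ p); split.
  - by rewrite cat_path pq lq.
  - by rewrite last_cat lq lp mulgA.
  - by rewrite size_cat sq /= mulnS leq_add // wd_gen.
  have Px : P x by have := uP 0%N; rewrite mulg1.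
  move=> v; rewrite -cat_cons mem_cat => /orP[|vpp]; last first.
    by apply: vp; rewrite inE vpp orbT.
  rewrite inE => /orP[/eqP ->|/vq vx]; exists x; split=> //.
    by rewrite word_dist_refl.
  exact: leq_trans vx (wd_gen _ _).
exists p; split=> //; apply: leq_trans sp _; by rewrite leq_mul2l uN orbT.
Qed.

Lemma std_path_rev (P : W -> Prop) N x y : std_path P N x y -> std_path P N y x.
Proof.
move=> [u [uN -> uP]]; exists (rev u); split; first by rewrite size_rev.
  by rewrite el_rev mulgK.
move=> k; rewrite take_rev -{1}(cat_take_drop (size u - k) u) el_cat el_rev.
by rewrite !mulgA mulgK.
Qed.

Lemma take_alt k n s t : take k (alt n s t) = alt (minn k n) s t.
Proof.
elim: n k s t => [|n IH] [|k] s t; rewrite ?minn0 ?min0n //.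
by rewrite minnSS /= IH.
Qed.

(* If both rays of the line through [x] came within [D] of [c], the distance
   between their near points, comparable to their distance along the line,
   would be at most [2 D], while both are far from [c]'s neighbour [x]. *)
Lemma escape_ray (R : realFieldType) (D : R) c x e : (0 < K)%N ->
  e.1 != e.2 -> ~~ sgraph_adj Gam e.1 e.2 ->
  ((2 + 4 * K%:R ^+ 2) * D + K%:R < 2 * (wd c x)%:R)%R ->
  (forall k, (D <= (wd c (x * el (alt k e.1 e.2)))%:R)%R) \/
  (forall k, (D <= (wd c (x * el (alt k e.2 e.1)))%:R)%R).
Proof.
move=> K0 en ea HD.
case: (pselect (forall k, (D <= (wd c (x * el (alt k e.1 e.2)))%:R)%R)); first by left.
move=> /existsNP[k /negP]; rewrite -ltNge => Dk; right => l.
rewrite leNgt; apply/negP => Dl; move: HD; apply/negP; rewrite -leNgt.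
set y := x * el (alt k e.1 e.2) in Dk; set z := x * el (alt l e.2 e.1) in Dl.
have lena n s t : (len (el (alt n s t)) <= n)%N.
  by rewrite -[leqRHS](size_alt n s t) len_el.
have xy : (wd c x <= wd c y + K * k)%N.
  apply: leq_trans (wd_tri S_gen _ y _) _; rewrite leq_add2l.
  rewrite wd_sym //; apply: leq_trans (wdK _ _) _.
  by rewrite mulKg leq_mul2l lena orbT.
have xz : (wd c x <= wd c z + K * l)%N.
  apply: leq_trans (wd_tri S_gen _ z _) _; rewrite leq_add2l.
  rewrite wd_sym //; apply: leq_trans (wdK _ _) _.
  by rewrite mulKg leq_mul2l lena orbT.
have kl : (k + l <= 2 * (K * (wd c y + wd c z)) + 1)%N.
  have := lin_lip en ea (el (alt k e.1 e.2)) (el (alt l e.2 e.1)).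
  have [-> _] := lin_alt en ea k; have [_ ->] := lin_alt en ea l.
  have -> : (el (alt k e.1 e.2))^-1 * el (alt l e.2 e.1) = y^-1 * z.
    by rewrite /y /z invgM -!mulgA mulKg.
  move=> H; have := leq_trans H (lenK _ _).
  have : (K * wd y z <= K * (wd c y + wd c z))%N.
    by rewrite leq_mul2l (wd_sym S_gen c y) wd_tri ?orbT.
  lia.
have k1 : (1 <= K%:R :> R)%R by rewrite (ler_nat _ 1).
move: xy xz kl; rewrite -!(ler_nat R) !natrD !natrM !natrD.
move: (K%:R)%R (wd c x)%:R%R (wd c y)%:R%R (wd c z)%:R%R k%:R%R l%:R%R k1 Dk Dl.
move=> q a b d k' l' q1 Dk Dl H1 H2 H3.
have H4 : (q * (k' + l') <= q * (2 * (q * (b + d)) + 1))%R.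
  by apply: ler_wpM2l => //; lra.
have H5 : (q * q * (b + d) <= q * q * (2 * D))%R.
  by apply: ler_wpM2l; [apply: mulr_ge0; lra | lra].
rewrite expr2; lra.
Qed.

End QuasiIsometry.

(** * Quadratic upper bound on divergence *)

Section DivergenceUpper.
Variables (V : finType) (Gam : sgraph V) (S : set (racg Gam)) (R : realType).
Local Notation W := (racg Gam).
Local Notation el := (el Gam).
Local Notation len := (@len V Gam).
Local Notation wd := (word_dist S).
Local Notation cd := (@cayley_dist R (racg Gam) S).
Local Open Scope classical_set_scope.
Local Open Scope ring_scope.
Hypothesis S_gen : fin_generating S [set: W].
Variable K : nat.
Hypothesis K_gt0 : (0 < K)%N.
Hypothesis wdK : forall x y : W, (wd x y <= K * len (x^-1 * y)%g)%N.
Hypothesis lenK : forall x y : W, (len (x^-1 * y)%g <= K * wd x y)%N.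
Hypothesis Gam_cfs : cfs Gam.

Lemma lip_path_imp (P Q : cayley_point R S -> Prop) x y L : (forall z, P z -> Q z) ->
  lip_path P x y L -> lip_path Q x y L.
Proof. by move=> PQ [f [f0 f1 fl fP]]; exists f; split=> // t /fP/PQ. Qed.

Lemma lip_path_ends (Q : W -> Prop) a b p : path (fun g h => (wd g h <= 1)%N) (csrc a) p ->
  last (csrc a) p = csrc b -> (forall v, v \in csrc a :: p -> Q v) ->
  lip_path (fun z : cayley_point R S => Q (csrc z)) a b ((size p).+3)%:R.
Proof.
move=> pp lp Qp.
have -> : ((size p).+3)%:R = 1 + ((size p).+1%:R + 1) :> R.
  by rewrite -natr1 -[(size p).+2%:R]natr1; lra.
have Qa : Q (csrc a) by apply: Qp; rewrite mem_head.
have Qb : Q (csrc b) by rewrite -lp; apply: Qp; exact: mem_last.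
apply: lip_path_cat (lip_source S_gen Qa) _ => //.
apply: lip_path_cat (lip_path_rev S_gen (lip_source S_gen Qb)) => //.
by rewrite -lp; exact: lip_vertices.
Qed.

(** [delta] is small enough for [escape_ray] at both ends, and [gam] absorbs the additive losses of
    replacing a point by the source of its edge and a letter by a path over [S]. *)
Lemma div_upper (delta gam : R) : 0 < delta <= (2 + 4 * K%:R ^+ 2)^-1 ->
  2 * K%:R + 6 <= gam -> exists2 C : R, 0 < C & forall x a b c, 0 <= x ->
    0 < dist_to_pair cd c a b -> cd a b <= x ->
    (div_pts cd gam delta a b c <= (C * (x + 1) ^+ 2)%:E)%E.
Proof.
move=> /andP[d0 d1] gam1.
have [e0 [[f0 sq0] cover]] := Gam_cfs.
pose Lam := #|{: V * V}|.
pose rho := (2 * (K * (16 + K * K * 2) + 2))%N.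
pose A := (2 * rho + (2 * K + 1) * (Lam * (2 * rho) + 1))%N.
pose C := (4 * (K * A + 3))%N.
have k1 : 1 <= K%:R :> R by rewrite (ler_nat _ 1).
have C12 : 12%:R <= C%:R :> R by rewrite ler_nat /C; lia.
exists C%:R; first by lra.
move=> x a b c x0 r0 abx; set r := dist_to_pair _ _ _ _ in r0 *.
have rca : r <= cd c a by rewrite /r ge_min lexx.
have rcb : r <= cd c b by rewrite /r ge_min lexx orbT.
have car : cd c a <= r + x.
  have t := cd_tri S_gen c b a; rewrite (cd_sym S_gen b) in t.
  by rewrite /r /dist_to_pair minElt; case: ifP => _; lra.
have dsm : delta <= 1 / 6.
  apply: le_trans d1 _; rewrite -[leRHS]invrK lef_pV2 ?posrE ?invr_gt0; try lra; try nra.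
have dr : delta * r <= r / 6 by nra.
have wab := wd_cd S_gen a b; have wca := wd_cd S_gen c a.
have wca' := cd_wd S_gen c a; have wcb' := cd_wd S_gen c b.
(* If [c] is far away compared with [x], a geodesic from [a] to [b] avoids the ball; otherwise [r]
   is at most linear in [x]. *)
have [rbig|rsmall] := leP (2 * x + 12) r.
  have [p [pp lp sp /allP vp]] := wd_path S_gen (csrc a) (csrc b).
  apply: (@le_trans _ _ (size p).+3%:R%:E); last first.
    rewrite lee_fin sp -addn3 natrD.
    apply: (@le_trans _ _ (12%:R * (x + 1) ^+ 2)); first by rewrite expr2; nra.
    by rewrite ler_wpM2r ?sqr_ge0.
  apply: lip_path_div => //.
  apply: lip_path_imp (lip_path_ends (Q := fun v => ((wd (csrc c) v)%:R >= r - x - 4)) pp lp _).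
    by move=> z Hz /lt_geF/negP; apply; have := wd_cd S_gen c z; rewrite -/r; lra.
  move=> v; rewrite inE => /orP[/eqP ->|/vp]; first by lra.
  have := wd_tri S_gen (csrc c) v (csrc a); rewrite (wd_sym S_gen v).
  by rewrite -!(ler_nat R) !natrD; lra.
(* The distance from [c] required of the vertices of the path in letters: [K] is lost on passing to
   a path over [S], and [2] on passing from sources to points. *)
pose D := delta * r - gam + 2 + K%:R.
pose X := (Num.truncn x).+1.
have /andP[Xx xX] := truncn_itv x0.
have {}Xx : X%:R <= x + 1 by rewrite /X -addn1 natrD; lra.
have {}xX : x <= X%:R by exact: ltW.
(* Half of [R0] exceeds [K] times the distance needed: a vertex that far from the word [w] keeps
   distance [X + 2 >= D] from [c], since [c] is within [3 X + 14] of [a] and [w] has at most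
   [K (X + 2)] letters. *)
pose R0 := (2 * (K * (4 * X + 16 + K * K * (X + 2)) + 2))%N.
have [w [wE wl _]] := geodesic (csrc a) (csrc b).
pose P (v : W) := D <= (wd (csrc c) v)%:R.
have DX : D <= X%:R + 2 by rewrite /D; lra.
have wabX : (wd (csrc a) (csrc b) <= X + 2)%N.
  by rewrite -(ler_nat R) natrD; lra.
have wcaX : (wd (csrc c) (csrc a) <= 3 * X + 14)%N.
  by rewrite -(ler_nat R) natrD natrM; lra.
have wlX : (size w <= K * (X + 2))%N.
  by rewrite wl; apply: leq_trans (lenK _ _) _; rewrite leq_mul2l wabX orbT.
have HP i (v : W) : (R0./2 <= (len ((csrc a * el (take i w))^-1 * v)%g).+1)%N -> P v.
  have -> : R0./2 = (K * (4 * X + 16 + K * K * (X + 2)) + 2)%N by rewrite /R0 mul2n doubleK.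
  set y := (csrc a * _)%g => Hv.
  have wyv : (4 * X + 16 + K * K * (X + 2) <= wd y v)%N.
    rewrite -(leq_pmul2l K_gt0); apply: leq_trans (lenK _ _).
    by move: Hv; rewrite addn2 ltnS; exact: ltnW.
  have way : (wd (csrc a) y <= K * K * (X + 2))%N.
    apply: leq_trans (wdK _ _) _; rewrite mulKg -mulnA leq_mul2l.
    apply/orP; right; apply: leq_trans wlX; apply: leq_trans (len_el _ _) _.
    by rewrite size_take_min geq_minr.
  have tri1 := wd_tri S_gen y (csrc c) v; have tri2 := wd_tri S_gen (csrc c) (csrc a) y.
  rewrite /P; apply: le_trans DX _; rewrite -natrD ler_nat.
  rewrite (wd_sym S_gen y (csrc c)) in tri1.
  exact: far_arith wyv way wcaX tri1 tri2.
have en0 := and5P sq0; case: en0 => en ea _ _ _.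
(* On the way from [a] or [b] out to radius [R0] the path is not yet far out; there it follows
   whichever ray of the line of [e0] keeps away from [c]. *)
have esc q : r - 2 <= (wd (csrc c) q)%:R -> exists e, connect (square Gam) e0 e /\
    std_path P R0 q (q * el (alt R0 e.1 e.2))%g.
  move=> Hq; have HD : (2 + 4 * K%:R ^+ 2) * D + K%:R < 2 * (wd (csrc c) q)%:R.
    have : (2 + 4 * K%:R ^+ 2) * (delta * r) <= r.
      rewrite mulrA -[leRHS]mul1r ler_wpM2r ?(ltW r0) //.
      by rewrite mulrC -ler_pdivlMr ?div1r // ltr_wpDr // mulr_ge0 ?sqr_ge0.
    have : (2 + 4 * K%:R ^+ 2) * (K%:R + 4) <= (2 + 4 * K%:R ^+ 2) * (gam - 2 - K%:R).
      by apply: ler_wpM2l; [apply: addr_ge0 => //; rewrite mulr_ge0 ?sqr_ge0 | lra].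
    have : 0 <= K%:R ^+ 2 * (K%:R + 4) :> R by apply: mulr_ge0; rewrite ?sqr_ge0 //; lra.
    by rewrite /D; lra.
  have mk e : connect (square Gam) e0 e ->
      (forall k, D <= (wd (csrc c) (q * el (alt k e.1 e.2))%g)%:R) ->
      exists e, connect (square Gam) e0 e /\ std_path P R0 q (q * el (alt R0 e.1 e.2))%g.
    move=> ce He; exists e; split=> //; exists (alt R0 e.1 e.2); split=> //.
      by rewrite size_alt.
    by move=> k; rewrite take_alt; exact: He.
  have [H|H] := escape_ray S_gen wdK lenK K_gt0 en ea HD.
    by apply: (mk e0).
  by apply: (mk (e0.2, e0.1)) => //; exact: (comp_swap sq0).
have [e1 [ce1 path1]] := esc (csrc a) ltac:(lra).
have [e2 [ce2 path2]] := esc (csrc b) ltac:(by have := wd_cd S_gen c b; lra).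
have R00 : (0 < R0)%N by rewrite /R0 muln_gt0 addn2.
have mid := far_path sq0 cover R00 ce1 ce2 HP; rewrite -wE in mid.
have := std_path_cat path1 (std_path_cat mid (std_path_rev path2)).
set N := (R0 + _)%N => full.
have [p [pp lp sp vp]] := std_path_wd S_gen wdK full.
apply: (@le_trans _ _ (size p).+3%:R%:E).
  apply: lip_path_div => //.
  apply: lip_path_imp (lip_path_ends (Q := fun v => ((wd (csrc c) v)%:R >= D - K%:R)) pp lp _).
    by move=> z Hz /lt_geF/negP; apply; have := wd_cd S_gen c z; rewrite -/r /D in Hz *; lra.
  move=> v /vp[v0 [Pv0 v0v]]; rewrite /P in Pv0.
  have := wd_tri S_gen (csrc c) v v0; rewrite (wd_sym S_gen v).
  by move: v0v; rewrite -!(ler_nat R) natrD; lra.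
rewrite lee_fin; apply: (@le_trans _ _ (((K * A + 3) * (X + 1) ^ 2)%N%:R)); last first.
  rewrite /C natrM natrX [(X + 1)%:R]natrD natrM.
  have : (X%:R + 1) ^+ 2 <= 4 * (x + 1) ^+ 2 :> R.
    have -> : 4 * (x + 1) ^+ 2 = (2 * (x + 1)) ^+ 2 by ring.
    by rewrite ler_pXn2r ?nnegrE //; lra.
  move: ((X%:R + 1) ^+ 2) ((x + 1) ^+ 2) => u v uv.
  rewrite -mulrA mulrCA; apply: ler_wpM2l => //; lra.
rewrite ler_nat.
have R0X : (R0 <= rho * (X + 1))%N by exact: radius_arith.
have sX := count_arith wlX.
exact: detour_arith R0X sX erefl erefl sp.
Qed.

End DivergenceUpper.

Lemma crossing_arith1 q m rho M :
  (q * (2 * m + 2) <= rho)%N -> (rho <= M)%N -> (0 < M)%N -> (q * m < M)%N.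
Proof. by rewrite mulnDr mulnCA; move: (q * m)%N => t; lia. Qed.

Lemma crossing_arith2 q m rho : (0 < m)%N ->
  (q * (2 * m + 2) <= rho)%N -> (q * q <= q * (rho - (q * m).+1))%N.
Proof.
move=> m0 qr; rewrite leq_mul2l; case: (posnP q) => // q0; apply/orP; right.
have : (q <= q * m)%N by rewrite leq_pmulr.
by move: qr; rewrite mulnDr mulnCA; move: (q * m)%N => t; lia.
Qed.

(** * Quadratic lower bound on divergence *)

Section DivergenceLower.
Variables (V : finType) (Gam : sgraph V) (S : set (racg Gam)) (R : realType).
Local Notation W := (racg Gam).
Local Notation gen := (gen Gam).
Local Notation el := (el Gam).
Local Notation len := (@len V Gam).
Local Notation wd := (word_dist S).
Local Notation cd := (@cayley_dist R (racg Gam) S).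
Local Open Scope classical_set_scope.
Local Open Scope ring_scope.
Hypothesis S_gen : fin_generating S [set: W].
Variable K : nat.
Hypothesis K_gt0 : (0 < K)%N.
Hypothesis wdK : forall x y : W, (wd x y <= K * len (x^-1 * y)%g)%N.
Hypothesis lenK : forall x y : W, (len (x^-1 * y)%g <= K * wd x y)%N.

Lemma word_of_chain (g : W) ws : path (fun g h => (wd g h <= 4)%N) g ws ->
  exists u, [/\ (size u <= 4 * K * size ws)%N, last g ws = (g * el u)%g
    & forall k, exists v : W, v \in g :: ws /\
        (len (v^-1 * (g * el (take k u)))%g <= 4 * K)%N].
Proof.
elim: ws g => [|h ws IH] g /=.
  move=> _; exists [::]; split=> [//||k]; first by rewrite /= mulg1.
  by exists g; rewrite inE eqxx /= mulg1 mulVg len1.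
case/andP => gh /IH[u [su lu Hu]]; have [u1 [hE su1 _]] := geodesic g h.
have s1 : (size u1 <= 4 * K)%N.
  by rewrite su1; apply: leq_trans (lenK _ _) _; rewrite mulnC leq_mul2r gh orbT.
exists (u1 ++ u); split.
- by rewrite size_cat mulnS leq_add.
- by rewrite lu hE el_cat mulgA.
move=> k; rewrite take_cat; case: ltnP => ku.
  exists g; split; first by rewrite inE eqxx.
  rewrite mulKg; apply: leq_trans (len_el _ _) _.
  by rewrite size_take ku; apply: leq_trans (ltnW ku) s1.
have [v [vin Hv]] := Hu (k - size u1)%N; exists v; split.
  by rewrite inE vin orbT.
by rewrite el_cat [(g * (_ * _))%g]mulgA -hE.
Qed.

Variables (letter : nat -> V) (m : nat).
Hypothesis m_gt0 : (0 < m)%N.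
Hypothesis letter_period : forall i, letter (i + m) = letter i.
Hypothesis letter_onto : forall i v, exists k, (i < k <= i + m)%N /\ letter k = v.
Hypothesis letter_nadj : forall i,
  letter i != letter i.+1 /\ ~~ sgraph_adj Gam (letter i) (letter i.+1).
Local Notation axis := (axis Gam letter).

(** The witnesses are the ends and the midpoint of a segment of length [2 M] of the axis. A path
    avoiding the ball about the midpoint is made discrete and spelled in letters, and becomes a
    gallery subject to [avoiding_gallery]. *)
Lemma div_lower (delta gam : R) : 0 < delta -> 0 <= gam -> exists2 C : R, 0 < C &
  forall x, 0 <= x -> ((x ^+ 2)%:E <= C%:E * Div cd gam delta (C * x + C)%R
    + (C * x + C)%R%:E)%E.
Proof.
move=> d0 g0; have k1 : 1 <= K%:R :> R by rewrite (ler_nat _ 1).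
pose k : R := K%:R; have k0 : 0 < k by rewrite /k; lra.
(* [c2] collects the additive losses in [beta] below, so that [M * (delta / k / k) = beta + c2]; [A]
   then turns the choice of [q] into [M <= A * (q + 1)]. *)
pose c2 := (2 * delta + gam + 2) / k + 4 * k.
have c20 : 0 <= c2 by rewrite addr_ge0 ?divr_ge0 ?mulr_ge0 //; lra.
pose A := ((2 * m + 2)%N%:R + c2) / (delta / k / k).
have dkk : 0 < delta / k / k by rewrite !divr_gt0.
have A0 : 0 <= A by apply: divr_ge0; [apply: addr_ge0 | exact: ltW].
pose C := 8%:R * k * A ^+ 2 + 2 * A ^+ 2 + 2 * k * (1 + 3 * k) + 1.
have A2 : 0 <= A ^+ 2 by exact: sqr_ge0.
have kA2 : 0 <= k * A ^+ 2 by rewrite mulr_ge0 // ltW.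
have kk : 0 <= k * k by rewrite mulr_ge0 // ltW.
have C0 : 0 < C by rewrite /C; lra.
exists C => // x x0.
pose X := (Num.truncn x).+1.
have /andP[Xx xX] := truncn_itv x0.
have {}Xx : X%:R <= x + 1 by rewrite /X -addn1 natrD; lra.
have {}xX : x <= X%:R by exact: ltW.
pose M := (X + 3 * K)%N.
have MR : M%:R = X%:R + 3 * k :> R by rewrite /M natrD natrM.
pose a := vtx R S (axis 0); pose b := vtx R S (axis (M + M)); pose c := vtx R S (axis M).
pose r := dist_to_pair cd c a b.
have lenM0 : len ((axis M)^-1 * axis 0)%g = M.
  by rewrite len_sym; have := len_axis letter_nadj 0 M; rewrite add0n.
have lenMM : len ((axis M)^-1 * axis (M + M))%g = M by exact: len_axis.
have wdM (g : W) : len ((axis M)^-1 * g)%g = M -> M%:R / k - 2 <= cd c (vtx R S g).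
  move=> lg; have := wd_cd S_gen c (vtx R S g); have := lenK (axis M) g.
  rewrite lg -(ler_nat R) natrM -/k /= => H.
  have : M%:R / k <= (wd (axis M) g)%:R by rewrite ler_pdivrMr // mulrC.
  lra.
have rM : M%:R / k - 2 <= r by rewrite /r le_min !wdM.
have Mk3 : 3 <= M%:R / k by rewrite ler_pdivlMr // MR; have := ler0n R X; lra.
have abC : cd a b <= C * x + C.
  apply: le_trans (cd_vtx R S_gen _ _) _; have := wdK (axis 0) (axis (M + M)).
  have -> : len ((axis 0)^-1 * axis (M + M))%g = (M + M)%N.
    by have := len_axis letter_nadj 0 (M + M); rewrite add0n.
  rewrite -(ler_nat R) natrM natrD MR -/k => H; apply: le_trans H _.
  have kx : k * X%:R <= k * (x + 1) by apply: ler_wpM2l => //; exact: ltW.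
  have : 0 <= (8%:R * k * A ^+ 2 + 2 * A ^+ 2 + 2 * k * (3 * k) + 1) * x.
    by apply: mulr_ge0 => //; lra.
  rewrite /C; lra.
have key : ((x ^+ 2 / C - 1)%:E <= Div cd gam delta (C * x + C)%R)%E.
  apply: (@le_trans _ _ (div_pts cd gam delta a b c)); last first.
    by apply: ereal_sup_ubound; exists a, b, c; split=> //; rewrite -/r; lra.
  apply: le_ereal_inf_tmp => _ [f [fc fa fb fav] <-].
  have pl0 : (0 <= path_length cd f)%E.
    apply: (@le_trans _ _ (cd (f 0) (f 1))%:E); first by rewrite lee_fin cd_ge0.
    apply: ereal_sup_ubound; exists [:: 1]; first exact: itv_partition1 ltr01.
    by rewrite big_nat1.
  case plE : (path_length cd f) pl0 => [L| |] //; last by move=> _; rewrite leey.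
  rewrite !lee_fin => L0.
  pose Q z := ~ cd c z < delta * dist_to_pair cd c a b - gam.
  have plL : (path_length cd f <= L%:E)%E by rewrite plE.
  have [ws [wp wl wsz wv]] := @discretize _ _ _ S_gen f Q L fc fav plL.
  rewrite fa in wp wl; rewrite fb in wl.
  have {}wl : last (axis 0) ws = axis (M + M) := wl.
  have {}wp : path (fun g h => (wd g h <= 4)%N) (axis 0) ws := wp.
  have [u [su ul Hu]] := word_of_chain wp.
  (* The distance in letters that the gallery keeps from [axis M], after all conversions of metrics;
     it may be negative, and [rho] is then 0. *)
  pose beta := (delta * (M%:R / k - 2) - gam - 2) / k - 4 * k.
  pose rho := if 0 <= beta then Num.truncn beta else 0%N.
  have rhob (n : nat) : beta <= n%:R -> (rho <= n)%N.
    rewrite /rho; case: ifP => // b0 bn; rewrite -(ler_nat R).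
    by have /andP[H _] := truncn_itv b0; exact: le_trans H bn.
  have brho : beta < rho.+1%:R.
    rewrite /rho; case: ifP => [b0|/negbT]; first by case/andP: (truncn_itv b0).
    by rewrite -ltNge; lra.
  have far j : (rho <= len ((axis M)^-1 * (axis 0 * el (take j u))))%N.
    apply: rhob; have [v [vin Hv]] := Hu j.
    have vfar : delta * r - gam - 2 <= (wd (axis M) v)%:R.
      suff [z Hz <-] : exists2 z, ~ cd c z < delta * dist_to_pair cd c a b - gam & csrc z = v.
        by move/negP: Hz; rewrite -leNgt -/r; have := cd_wd S_gen c z; rewrite /=; lra.
      move: vin; rewrite inE => /orP[/eqP ->|/wv//].
      by exists (f 0); [apply: fav; rewrite lexx ler01 | rewrite fa].
    have l1 := wdK (axis M) v; have l2 := len_tri (axis M) (axis 0 * el (take j u))%g v.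
    rewrite [len (_ * v)%g]len_sym in l2 *.
    have l3 : (len ((v^-1 * axis M)%g) <= len ((axis M)^-1 * (axis 0 * el (take j u)))%g + 4 * K)%N.
      apply: leq_trans l2 _; rewrite leq_add2l [len (_ * v)%g]len_sym.
      exact: Hv.
    have l4 : (wd (axis M) v)%:R <= k * ((len ((axis M)^-1 * (axis 0 * el (take j u)))%g)%:R + 4 * k).
      rewrite /k -natrM -natrD -natrM ler_nat; apply: leq_trans l1 _.
      by rewrite leq_mul2l len_sym l3 orbT.
    have dr : delta * (M%:R / k - 2) <= delta * r by rewrite ler_wpM2l // ltW.
    rewrite /beta lerBlDr ler_pdivrMr // mulrC; lra.
  pose cc j := (axis 0 * el (take j u))%g.
  have gc : gallery cc.
    move=> j; case: (ltnP j (size u)) => ju.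
      right; exists (nth (letter 0) u j).
      by rewrite /cc (take_nth (letter 0) ju) el_rcons mulgA.
    by left; rewrite /cc !take_oversize // ltnW.
  have cc0 : cc 0%N = axis 0 by rewrite /cc take0 mulg1.
  have ccn : cc (size u) = axis (M + M) by rewrite /cc take_size -ul -wl.
  (* For [q > 0] this choice leaves [rho - (q * m + 1) >= q], so the [q] crossings take at least
     [q * q] steps. *)
  pose q := (rho %/ (2 * m + 2))%N.
  have qr : (q * (2 * m + 2) <= rho)%N by exact: leq_trunc_div.
  have rM' : (rho <= M)%N by have := far 0%N; rewrite take0 mulg1 lenM0.
  have M0 : (0 < M)%N by rewrite /M /X.
  have qM : (q * m < M)%N.
    exact: crossing_arith1 qr rM' M0.
  have := avoiding_gallery m_gt0 letter_onto letter_nadj gc cc0 ccn qM (fun j _ => far j).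
  have qq : (q * q <= q * (rho - (q * m).+1))%N.
    exact: crossing_arith2.
  move=> /(leq_trans qq) /leq_trans /(_ su) qws.
  have rq : (rho < (q + 1) * (2 * m + 2))%N by rewrite addn1 ltn_ceil // addn2.
  have bq : beta <= (q%:R + 1) * (2 * m + 2)%N%:R.
    apply: le_trans (ltW brho) _; rewrite -[1](mulr1n) -natrD -natrM ler_nat //.
  have MA : M%:R <= A * (q%:R + 1).
    rewrite /A mulrAC ler_pdivlMr //.
    have -> : M%:R * (delta / k / k) = beta + c2.
      by rewrite /beta /c2; field; rewrite gt_eqF.
    rewrite mulrDl; have : c2 * 1 <= c2 * (q%:R + 1).
      by apply: ler_wpM2l => //; rewrite lerDr.
    by rewrite mulr1 mulrC; lra.
  have xM : x <= M%:R by rewrite MR; lra.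
  have x2 : x ^+ 2 <= A ^+ 2 * (q%:R + 1) ^+ 2.
    rewrite -exprMn ler_pXn2r ?nnegrE //; first exact: le_trans xM MA.
    by apply: mulr_ge0 => //; rewrite addr_ge0.
  have q2 : (q%:R + 1) ^+ 2 <= 2 * (8%:R * k * (L + 1) / 2 + 1).
    move: qws; rewrite -(ler_nat R) !natrM -/k => qws.
    have : k * (size ws)%:R <= k * (L + 1) by rewrite ler_wpM2l // ltW.
    have := sqr_ge0 (q%:R - 1 : R); rewrite !expr2; lra.
  rewrite lerBlDr ler_pdivrMr //.
  have : A ^+ 2 * (q%:R + 1) ^+ 2 <= A ^+ 2 * (2 * (8%:R * k * (L + 1) / 2 + 1)).
    by rewrite ler_wpM2l.
  have : 0 <= (2 * A ^+ 2 + 2 * k * (1 + 3 * k) + 1) * L by apply: mulr_ge0 => //; lra.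
  by rewrite /C; lra.
have -> : (x ^+ 2)%:E = (C%:E * (x ^+ 2 / C - 1)%:E + C%:E)%E.
  by rewrite -EFinM -EFinD; congr _%:E; field; rewrite gt_eqF.
apply: leeD.
  by rewrite lee_pmul2l.
by rewrite lee_fin lerDr mulr_ge0 // ltW.
Qed.

End DivergenceLower.

(** * From a connected complement to both geometric conclusions *)

Section ClosedWalk.
Variables (V : finType) (r : rel V).
Hypothesis r_conn : forall s t, connect r s t.

Lemma covering_closed_walk (v0 : V) : exists p,
  [/\ path r v0 p, last v0 p = v0 & forall v, v \in v0 :: p].
Proof.
have [p [pp lp sub]] : exists p, [/\ path r v0 p, last v0 p = v0 & {subset enum V <= v0 :: p}].
  elim: (enum V) => [|v s [p [pp lp sub]]]; first by exists [::].
  have /connectP[q1 pq1 lq1] := r_conn v0 v; have /connectP[q2 pq2 lq2] := r_conn v v0.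
  exists (q1 ++ q2 ++ p); split.
  - by rewrite !cat_path pq1 -lq1 pq2 -lq2.
  - by rewrite !last_cat -lq1 -lq2.
  move=> w; rewrite inE => /orP[/eqP ->|/sub].
    by rewrite -cat_cons mem_cat lq1 mem_last.
  by rewrite !inE !mem_cat => /orP[->//|->]; rewrite !orbT.
by exists p; split=> // v; apply: sub; rewrite mem_enum.
Qed.

Lemma periodic_walk : (1 < #|V|)%N -> exists (letter : nat -> V) (m : nat),
  [/\ (0 < m)%N, forall i, letter (i + m)%N = letter i,
    forall i v, exists k, (i < k <= i + m)%N /\ letter k = v
    & forall i, r (letter i) (letter i.+1)].
Proof.
move=> V1; have /card_gt0P[v0 _] : (0 < #|V|)%N by exact: ltnW.
have [p [pp lp cov]] := covering_closed_walk v0.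
have m0 : (0 < size p)%N.
  case: p {pp lp} cov => // cov; move: V1; rewrite ltnNge => /negP; case.
  rewrite -(card1 v0); apply/subset_leq_card/fintype.subsetP => v _.
  by have := cov v; rewrite !inE.
pose m := size p; pose letter i := nth v0 (v0 :: p) (i %% m).
have wrap : nth v0 (v0 :: p) m = v0 by rewrite -[RHS]lp (last_nth v0).
have letterS i : letter i.+1 = nth v0 (v0 :: p) (i %% m).+1.
  rewrite /letter -addn1 -modnDml addn1.
  have := ltn_pmod i m0; rewrite -/m leq_eqVlt => /orP[/eqP E|lt].
    by rewrite E modnn wrap.
  by rewrite modn_small.
exists letter, m; split=> //.
- by move=> i; rewrite /letter modnDr.
- move=> i v.
  have [j jm jv] : exists2 j, (j < m)%N & nth v0 (v0 :: p) j = v.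
    have : (index v (v0 :: p) < m.+1)%N by rewrite (_ : m.+1 = size (v0 :: p)) // index_mem.
    rewrite ltnS leq_eqVlt => /orP[/eqP E|lt].
      by exists 0%N => //; rewrite -(nth_index v0 (cov v)) E wrap.
    by exists (index v (v0 :: p)) => //; rewrite nth_index.
  have im := ltn_pmod i m0; have iE := divn_eq i m; rewrite -/m in im.
  case: (ltnP (i %% m) j) => ij.
    exists (i %/ m * m + j)%N; split; first by apply/andP; split; lia.
    by rewrite /letter modnMDl modn_small.
  exists ((i %/ m).+1 * m + j)%N; split; first by rewrite mulSn; apply/andP; split; lia.
  by rewrite /letter modnMDl modn_small.
move=> i; rewrite letterS; have /(pathP v0)/(_ (i %% m)%N) := pp; apply.
exact: ltn_pmod.
Qed.

End ClosedWalk.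

Section Geometry.
Variables (V : finType) (Gam : sgraph V).
Local Notation W := (racg Gam).
Local Open Scope classical_set_scope.
Local Open Scope ring_scope.

Definition nonadj : rel V := fun s t => (s != t) && ~~ sgraph_adj Gam s t.

Lemma nonadjE s t : nonadj s t = (s != t) && ~~ sgraph_adj Gam s t.
Proof. by []. Qed.

Definition co_connected := (1 < #|V|)%N /\ forall s t, connect nonadj s t.

Theorem racg_quadratic (R : realType) : co_connected -> cfs Gam ->
  thick_exactly_one W /\ quadratic_divergence R W.
Proof.
move=> [V1 conn] Gcfs.
have [letter [m [m0 per onto nadj']]] := periodic_walk conn V1.
have nadj i : letter i != letter i.+1 /\ ~~ sgraph_adj Gam (letter i) (letter i.+1).
  exact/andP/nadj'.
split; first by split; [exact: cfs_thick1 | exact: (not_thick0 m0 per onto nadj)].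
split; first by exists (@std V Gam); exact: std_gen.
move=> S Sgen; have [K [K0 wlK]] := qi_constant Sgen.
have wdK x y := proj1 (wlK x y); have lenK x y := proj2 (wlK x y).
have k1 : 1 <= K%:R :> R by rewrite (ler_nat _ 1).
have dpos : 2 <= 2 + 4 * K%:R ^+ 2 :> R.
  by rewrite lerDl mulr_ge0 // sqr_ge0.
exists (2 + 4 * K%:R ^+ 2)^-1, (2 * K%:R + 6); split.
- by rewrite invr_gt0; lra.
- by rewrite invf_lt1; lra.
- by lra.
move=> delta gam hd hg; split; last first.
  have [||C C0 HC] := div_lower Sgen K0 wdK lenK m0 onto nadj (R := R) (delta := delta) (gam := gam).
  - by case/andP: hd.
  - by lra.
  by exists C.
have [C C0 HC] := div_upper Sgen K0 wdK lenK Gcfs hd hg.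
exists (C + 1) => [|x x0]; first by lra.
apply: ge_ereal_sup => _ [a [b [c [r0 abx ->]]]].
apply: le_trans (HC x a b c x0 r0 abx) _.
have E : ((C + 1) * x + (C + 1)) ^+ 2 = (C + 1) ^+ 2 * (x + 1) ^+ 2 by ring.
rewrite -EFinM -EFinD lee_fin E.
have : 0 <= (x + 1) ^+ 2 by exact: sqr_ge0.
move: ((x + 1) ^+ 2) => y y0.
have : C * y <= (C + 1) * y by rewrite ler_wpM2r //; lra.
have : (C + 1) * y <= (C + 1) * ((C + 1) ^+ 2 * y).
  rewrite ler_wpM2l //; first by lra.
  rewrite -[leLHS]mul1r ler_wpM2r // expr2; nra.
have : 0 <= (C + 1) * x by rewrite mulr_ge0 //; lra.
lra.
Qed.

End Geometry.

(** * Independence of the edges of a random graph *)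

Section Expectation.
Variables (R : realType) (n : nat) (p : R).
Local Open Scope ring_scope.
Hypothesis p01 : 0 <= p <= 1.
Local Notation graph := (sgraph 'I_n).
Local Notation vset := {set 'I_n}.
Implicit Types (G H : graph) (e : vset) (A B : pred vset) (f g : graph -> R).

Fact graph_of_subproof A : [forall e in [set e : vset | (#|e| == 2%N) && A e], #|e| == 2%N].
Proof. by apply/forall_inP => e; rewrite inE => /andP[]. Qed.

Definition graph_of A : graph := SGraph (graph_of_subproof A).

Lemma in_graph_of A e : (e \in edges (graph_of A)) = (#|e| == 2%N) && A e.
Proof. by rewrite inE. Qed.

Lemma edge_card2 G e : e \in edges G -> #|e| == 2%N.
Proof. by move/(forall_inP (edges_card2 G)). Qed.

Lemma graph_ext G H : (forall e, #|e| == 2%N -> (e \in edges G) = (e \in edges H)) -> G = H.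
Proof.
move=> GH; apply: val_inj; apply/setP => e /=.
have [e2|ne2] := boolP (#|e| == 2%N); first exact: GH.
by apply/idP/idP => /edge_card2; rewrite (negbTE ne2).
Qed.

Lemma sum_prod_edges (h : vset -> bool -> R) :
  \sum_(G : graph) \prod_(e : vset | #|e| == 2%N) h e (e \in edges G) =
  \prod_(e : vset | #|e| == 2%N) (h e true + h e false).
Proof.
transitivity (\prod_(e : vset | #|e| == 2%N) \sum_(b : bool) h e b); last first.
  by apply: eq_bigr => e _; rewrite big_bool.
rewrite (big_distr_big_dep false) /=.
pose toF G := [ffun e : vset => e \in edges G].
rewrite (reindex_onto toF (fun F => graph_of (fun e => F e))) /=; last first.
  move=> F /pfamilyP[/fintype.subsetP sF _]; apply/ffunP => e; rewrite ffunE in_graph_of.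
  have [Fe|] := boolP (F e); last by rewrite andbF.
  by rewrite andbT; apply: sF; rewrite inE Fe.
apply: eq_big => G; last by move=> _; apply: eq_bigr => e _; rewrite ffunE.
rewrite (_ : graph_of _ = G) ?eqxx ?andbT; last first.
  by apply: graph_ext => e e2; rewrite in_graph_of e2 ffunE.
symmetry; apply/pfamilyP; split=> //; apply/fintype.subsetP => e.
by rewrite inE ffunE eqbF_neg negbK; exact: edge_card2.
Qed.

Definition expect f : R := \sum_(G : graph) gnp_weight p G * f G.

Lemma weight_ge0 G : 0 <= gnp_weight p G.
Proof.
have /andP[p0 p1] := p01; apply: prodr_ge0 => e _.
by case: ifP => _ //; rewrite subr_ge0.
Qed.

Lemma expect_prod (h : vset -> bool -> R) :
  expect (fun G => \prod_(e : vset | #|e| == 2%N) h e (e \in edges G)) =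
  \prod_(e : vset | #|e| == 2%N) (p * h e true + (1 - p) * h e false).
Proof.
rewrite -(sum_prod_edges (fun e b => (if b then p else 1 - p) * h e b)).
by apply: eq_bigr => G _; rewrite -big_split.
Qed.

Lemma expect1 : expect (fun=> 1) = 1.
Proof.
have := expect_prod (fun _ _ => 1); rewrite [RHS]big1; last first.
  by move=> e _; rewrite !mulr1 addrC subrK.
by move=> H; rewrite -[RHS]H; apply: eq_bigr => G _; rewrite big1_eq.
Qed.

Lemma expect_le f g : (forall G, f G <= g G) -> expect f <= expect g.
Proof. by move=> fg; apply: ler_sum => G _; rewrite ler_wpM2l ?weight_ge0. Qed.

Lemma expect_ext f g : (forall G, f G = g G) -> expect f = expect g.
Proof. by move=> fg; apply: eq_bigr => G _; rewrite fg. Qed.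

Lemma expect_sum (I : Type) (r : seq I) (P : pred I) (F : I -> graph -> R) :
  expect (fun G => \sum_(i <- r | P i) F i G) = \sum_(i <- r | P i) expect (F i).
Proof.
rewrite /expect exchange_big /=; apply: eq_bigr => G _.
by rewrite mulr_sumr.
Qed.

Lemma expectZ c f : expect (fun G => c * f G) = c * expect f.
Proof. by rewrite /expect mulr_sumr; apply: eq_bigr => G _; rewrite mulrCA. Qed.

Lemma expectB f g : expect (fun G => f G - g G) = expect f - expect g.
Proof. by rewrite /expect -sumrB; apply: eq_bigr => G _; rewrite mulrBr. Qed.

Definition depends A f := forall G H,
  (forall e, A e -> (e \in edges G) = (e \in edges H)) -> f G = f H.

Definition merge A G H := graph_of (fun e => if A e then e \in edges G else e \in edges H).

Lemma in_merge A G H e :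
  (e \in edges (merge A G H)) = if A e then e \in edges G else e \in edges H.
Proof.
rewrite in_graph_of; case: (A e); apply/andP/idP => [[]//|H1]; split=> //; exact: edge_card2 H1.
Qed.

(* Exchanging the [A]-parts of two independent copies preserves the weight. *)
Lemma expectM A f g : depends A f -> depends (predC A) g ->
  expect (fun G => f G * g G) = expect f * expect g.
Proof.
move=> fA gA; apply/esym.
have -> : expect f * expect g = \sum_(GH : graph * graph)
    gnp_weight p GH.1 * gnp_weight p GH.2 * (f GH.1 * g GH.2).
  rewrite /expect big_distrlr pair_big /=; apply: eq_bigr => -[G H] _ /=; ring.
pose swap (GH : graph * graph) := (merge A GH.1 GH.2, merge A GH.2 GH.1).
have swapK : involutive swap.
  by move=> [G H]; congr (_, _); apply: graph_ext => e _; rewrite !in_merge; case: (A e).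
rewrite (reindex_inj (inv_inj swapK)) /=.
rewrite -[RHS]mulr1 -expect1 /expect big_distrlr pair_big /=.
apply: eq_bigr => -[G H] _ /=; rewrite mulr1.
have -> : f (merge A G H) = f G by apply: fA => e Ae; rewrite in_merge Ae.
have -> : g (merge A H G) = g G.
  by apply: gA => e /negbTE Ae; rewrite in_merge Ae.
rewrite [RHS]mulrAC; congr (_ * _).
rewrite /gnp_weight -!big_split /=; apply: eq_bigr => e _; rewrite !in_merge.
by case: (A e) => //; rewrite mulrC.
Qed.

Lemma depends_sub A B f : (forall e, A e -> B e) -> depends A f -> depends B f.
Proof. by move=> AB fA G H GH; apply: fA => e /AB; exact: GH. Qed.

Lemma depends_prod (I : eqType) (r : seq I) (A : pred vset) (F : I -> graph -> R) :
  (forall i, i \in r -> depends A (F i)) -> depends A (fun G => \prod_(i <- r) F i G).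
Proof.
move=> FA G H GH; apply: eq_big_seq => i ir; exact: FA.
Qed.

Lemma expect_prod_indep (I : eqType) (r : seq I) (A : I -> pred vset) (F : I -> graph -> R) :
  uniq r -> (forall i, i \in r -> depends (A i) (F i)) ->
  (forall i j e, i \in r -> j \in r -> A i e -> A j e -> i = j) ->
  expect (fun G => \prod_(i <- r) F i G) = \prod_(i <- r) expect (F i).
Proof.
elim: r => [|i r IH] /= => [_ _ _|/andP[ir ur] FA dis].
  by rewrite big_nil -[RHS]expect1; apply: expect_ext => G; rewrite big_nil.
rewrite big_cons -IH //; last 2 first.
- by move=> j jr; apply: FA; rewrite inE jr orbT.
- move=> j k e jr kr; apply: dis; first by rewrite inE jr orbT.
  by rewrite inE kr orbT.
rewrite -(expectM (FA i (mem_head _ _))); last first.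
  apply: depends_prod => j jr; apply: depends_sub (FA j _); last by rewrite inE jr orbT.
  move=> e Aje; apply/negP => Aie; move/negP: ir; apply.
  by rewrite (dis i j e) ?mem_head // inE jr orbT.
by apply: expect_ext => G; rewrite big_cons.
Qed.

Definition prob (P : graph -> Prop) : R := gnp_prob p P.

Lemma probE P : prob P = expect (fun G => (`[< P G >])%:R).
Proof.
rewrite /prob /gnp_prob /expect big_mkcond; apply: eq_bigr => G _.
by case: ifP => _; rewrite ?mulr1 ?mulr0.
Qed.

Lemma prob_le (P Q : graph -> Prop) : (forall G, P G -> Q G) -> prob P <= prob Q.
Proof.
move=> PQ; rewrite !probE; apply: expect_le => G; rewrite ler_nat.
by case: (asboolP (P G)) => // /PQ QG; rewrite (asboolT QG).
Qed.

Lemma prob_ge0 P : 0 <= prob P.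
Proof. by apply: sumr_ge0 => G _; exact: weight_ge0. Qed.

Lemma prob_le1 P : prob P <= 1.
Proof.
rewrite probE -[leRHS]expect1; apply: expect_le => G.
by case: (`[< _ >]); rewrite ?lexx ?ler01.
Qed.

Lemma prob_not P : prob P = 1 - prob (fun G => ~ P G).
Proof.
rewrite !probE -[X in _ = X - _]expect1 -expectB; apply: expect_ext => G.
by rewrite asbool_neg; case: (`[< _ >]); rewrite ?subr0 ?subrr.
Qed.

Lemma prob_or P Q : prob (fun G => P G \/ Q G) <= prob P + prob Q.
Proof.
rewrite !probE -[leRHS](_ : expect (fun G => (`[< P G >])%:R + (`[< Q G >])%:R) = _).
  apply: expect_le => G; rewrite asbool_or.
  by case: (`[< P G >]); case: (`[< Q G >]) => /=; rewrite ?addr0 ?add0r ?lerDl ?ler01.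
by rewrite /expect -big_split; apply: eq_bigr => G _; rewrite mulrDr.
Qed.

Lemma prob_exists (I : finType) (C : pred I) (P : I -> graph -> Prop) :
  prob (fun G => exists i, C i /\ P i G) <= \sum_(i | C i) prob (P i).
Proof.
rewrite probE.
apply: le_trans (_ : expect (fun G => \sum_(i | C i) (`[< P i G >])%:R) <= _).
  apply: expect_le => G; case: asboolP => [[i [Ci Pi]]|_]; last exact: sumr_ge0.
  rewrite (bigD1 i) //= (asboolT Pi) lerDl; exact: sumr_ge0.
by rewrite expect_sum; apply: ler_sum => i _; rewrite probE.
Qed.

Lemma expect_edge e : #|e| == 2%N -> expect (fun G => (e \in edges G)%:R) = p.
Proof.
move=> e2; pose h (e' : vset) (b : bool) : R := if e' == e then b%:R else 1.
have := expect_prod h; rewrite (bigD1 e) //= big1; last first.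
  by move=> e' /andP[_ /negbTE ne]; rewrite /h ne !mulr1 addrC subrK.
rewrite mulr1 /h eqxx mulr1 mulr0 addr0 => <-; apply: expect_ext => G.
rewrite (bigD1 e) //= eqxx big1 ?mulr1 // => e' /andP[_ /negbTE -> //].
Qed.

End Expectation.

(** * Deterministic criteria for connected squares *)

Section Dense.
Variables (V : finType) (Gam : sgraph V).
Local Notation adj := (sgraph_adj Gam).
Local Notation nonadj := (nonadj Gam).
Local Notation square := (square Gam).

Lemma squareI s t x y : nonadj s t -> nonadj x y -> adj s x -> adj s y ->
  adj t x -> adj t y -> square (s, t) (x, y).
Proof. by move=> /andP[a b] /andP[c d] *; apply/and5P; split=> //; apply/and4P. Qed.

(** Consecutive non-edges [s t] and [t u] of a walk in the complement are both opposite to one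
    non-edge [x y], hence joined by two squares; such walks reach every vertex. *)
Lemma dense_cfs : co_connected Gam ->
  (forall a b c, exists x y, [/\ nonadj x y, adj a x && adj a y,
     adj b x && adj b y & adj c x && adj c y]) -> cfs Gam.
Proof.
move=> [V1 conn] H.
have [v0 [w0 vw0]] : exists v0 w0, nonadj v0 w0.
  have /card_gt1P[v [w [_ _ vw]]] := V1.
  have /connectP[[|u p] /=] := conn v w; first by move=> _ E; rewrite E eqxx in vw.
  by case/andP => vu _ _; exists v, u.
have step s t u : nonadj s t -> nonadj t u -> connect square (s, t) (t, u).
  move=> st tu; have [x [y [xy /andP[sx sy] /andP[tx ty] /andP[ux uy]]]] := H s t u.
  apply: connect_trans (connect1 (squareI st xy sx sy tx ty)) _.
  by apply/connect1/square_sym/squareI.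
exists (v0, w0); split.
  have [x [y [xy /andP[sx sy] /andP[tx ty] _]]] := H v0 w0 w0.
  by exists (x, y); exact: squareI.
move=> v; have /connectP[p pp lp] := conn w0 v.
elim: p v0 w0 vw0 pp lp => [|u p IH] s t st /=.
  move=> _ ->; exists s; have [x [y [xy /andP[sx sy] /andP[tx ty] _]]] := H s t t.
  apply: connect_trans (connect1 (squareI st xy sx sy tx ty)) _.
  apply/connect1/square_sym/squareI => //.
  by case/andP: st => a b; apply/andP; rewrite eq_sym adj_sym.
case/andP => tu pp lp; have [w cw] := IH t u tu pp lp.
by exists w; apply: connect_trans cw; exact: step.
Qed.

End Dense.

Definition endpoints (V : Type) (M : seq (V * V)) : seq V :=
  flatten [seq [:: xy.1; xy.2] | xy <- M].

Section Greedy.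
Variables (V : finType) (adj nonadj : rel V).

(** By the pigeonhole principle some [s] still has [kappa] neighbours in [X], among which there is a
    non-adjacent pair; it is removed and the choice repeated. Disjointness makes the pairs be hit
    through different edges, hence independently. *)
Lemma greedy_matching (kappa mu : nat) (S X : {set V}) :
  (forall K : {set V}, kappa <= #|K| -> exists x y, [/\ x \in K, y \in K, x != y & nonadj x y]) ->
  (forall x, x \in X -> exists2 s, s \in S & adj s x) ->
  mu * 2 + #|S| * kappa <= #|X| ->
  exists M : seq (V * V), [/\ size M = mu, uniq (endpoints M)
    & forall xy, xy \in M -> [/\ xy.1 \in X, xy.2 \in X, nonadj xy.1 xy.2
        & exists2 s, s \in S & adj s xy.1 && adj s xy.2]].
Proof.
move=> cliq; elim: mu X => [|mu IH] X XS szX; first by exists [::].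
have [s sS sX] : exists2 s, s \in S & kappa <= #|[set x in X | adj s x]|.
  apply/exists_inP; apply: contraT; rewrite negb_exists_in => /forall_inP small.
  move: szX; rewrite leqNgt => /negP; case.
  apply: leq_trans (_ : (#|S| * kappa).+1 <= _); last by move: (#|S| * kappa) => c; lia.
  rewrite ltnS; have -> : X = \bigcup_(s in S) [set x in X | adj s x].
    apply/setP => x; apply/idP/bigcupP => [xX|[s _]]; last by rewrite inE => /andP[].
    by have [s sS sx] := XS x xX; exists s => //; rewrite inE xX.
  apply: leq_trans (_ : \sum_(s in S) #|[set x in X | adj s x]| <= _).
    elim/big_rec2 : _ => [|s U k _ IHk]; first by rewrite cards0.
    by apply: leq_trans (leq_card_setU _ _) _; rewrite leq_add2l.
  rewrite -sum_nat_const; apply: leq_sum => s sS.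
  by rewrite ltnW // ltnNge small.
have [x [y [xK yK xy nxy]]] := cliq _ sX; move: xK yK; rewrite !inE => /andP[xX sx] /andP[yX sy].
have [|| M [sM uM HM]] := IH (X :\ x :\ y).
- by move=> z; rewrite !inE => /and3P[_ _]; exact: XS.
- have := cardsD1 x X; rewrite xX; have := cardsD1 y (X :\ x); rewrite !inE eq_sym xy yX; lia.
exists ((x, y) :: M); split; first by rewrite /= sM.
  rewrite /endpoints /= -/(endpoints M) uM andbT inE negb_or xy /=.
  have nin z : z \in endpoints M -> (z != x) && (z != y).
    case/flattenP => _ /mapP[uv uvM ->]; have [] := HM _ uvM.
    by rewrite !inE => /and3P[a b _] /and3P[c d _] _ _ /orP[]/eqP ->; rewrite ?a ?b ?c ?d.
  by apply/andP; split; apply/negP => /nin; rewrite eqxx ?andbF.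
move=> uv; rewrite inE => /orP[/eqP ->|/HM]; first by split=> //; exists s; rewrite //= sx.
by move=> [+ + -> He]; rewrite !inE => /and3P[_ _ ->] /and3P[_ _ ->].
Qed.

End Greedy.

Section ClosedSets.
Variables (V : finType) (Z : {set V}) (r : rel V).
Hypothesis r_sym : symmetric r.

Definition closed_in (T : {set V}) :=
  [forall z in T, forall w in Z, r z w ==> (w \in T)].

Lemma closed_inP (T : {set V}) :
  reflect (forall z w, z \in T -> w \in Z -> r z w -> w \in T) (closed_in T).
Proof.
apply: (iffP forall_inP) => [H z w zT wZ zw|H z zT].
  by have /forall_inP/(_ w wZ)/implyP := H z zT; apply.
by apply/forall_inP => w wZ; apply/implyP; exact: H zT wZ.
Qed.

(* A closed set is a union of components of [r] on [Z], and every component has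
   more than [s0] elements. *)
Lemma count_closed (s0 : nat) :
  (forall S : {set V}, S \subset Z -> S != finset.set0 -> closed_in S -> s0 < #|S|) ->
  #|[set T : {set V} | (T \subset Z) && closed_in T]| <= 2 ^ (#|V| %/ s0.+1).
Proof.
move=> big; pose e z w := [&& z \in Z, w \in Z & r z w].
have csym : connect_sym e.
  by apply: sym_connect_sym => z w; rewrite /e r_sym andbCA.
pose roots := [set fingraph.root e z | z in Z].
have rootZ z : z \in Z -> fingraph.root e z \in Z.
  move=> zZ; have /connectP[p] := connect_root e z.
  elim/last_ind: p => [|p w _]; first by move=> _ ->.
  by rewrite rcons_path last_rcons => /andP[_ /and3P[_ wZ _]] ->.
have conT (T : {set V}) z w : closed_in T -> connect e z w -> z \in T -> w \in T.
  move=> /closed_inP cT /connectP[p pp ->] {w}; elim: p z pp => //= w p IH z.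
  by case/andP => /and3P[_ wZ zw] pp zT; apply: IH pp (cT _ _ zT wZ zw).
have memroot (T : {set V}) z : closed_in T -> (z \in T) = (fingraph.root e z \in T).
  move=> cT; apply/idP/idP; apply: conT cT _; first exact: connect_root.
  by rewrite csym; exact: connect_root.
have nroots : #|roots| * s0.+1 <= #|V|.
  apply: leq_trans (_ : #|Z| <= _); last exact: max_card.
  rewrite -[#|Z|]sum1_card (partition_big (fingraph.root e) [in roots]) /=; last first.
    by move=> z zZ; apply: imset_f.
  rewrite -sum_nat_const; apply: leq_sum => _ /imsetP[z zZ ->].
  rewrite sum1dep_card; apply: big.
  - by apply/fintype.subsetP => w; rewrite inE => /andP[].
  - by apply/finset.set0Pn; exists z; rewrite inE zZ eqxx.
  apply/closed_inP => u w; rewrite !inE => /andP[uZ /eqP <-] wZ uw.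
  rewrite wZ eq_sym; apply/eqP/fingraph.rootP => //; apply: connect1.
  by rewrite /e uZ wZ.
apply: leq_trans (_ : 2 ^ #|roots| <= _); last first.
  by rewrite leq_exp2l // leq_divRL.
rewrite -card_powerset; pose h (T : {set V}) := T :&: roots.
rewrite -(@card_in_imset _ _ h); last first.
  move=> T1 T2; rewrite !inE => /andP[s1 c1] /andP[s2 c2] E.
  apply/setP => z.
  have [zZ|nz] := boolP (z \in Z); last first.
    by apply/idP/idP => [/(fintype.subsetP s1)|/(fintype.subsetP s2)]; rewrite (negbTE nz).
  have rz : fingraph.root e z \in roots by apply: imset_f.
  rewrite (memroot _ _ c1) (memroot _ _ c2).
  by have := congr1 (fun A : {set V} => fingraph.root e z \in A) E; rewrite !inE rz !andbT.
apply/subset_leq_card/fintype.subsetP => _ /imsetP[T _ ->].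
by rewrite inE finset.subsetIr.
Qed.

End ClosedSets.

Lemma subset_of_card (T : finType) (A : {set T}) k : k <= #|A| ->
  exists2 B : {set T}, B \subset A & #|B| = k.
Proof.
move=> kA; exists [set x in take k (enum A)].
  by apply/fintype.subsetP => x; rewrite inE => /mem_take; rewrite mem_enum.
rewrite cardsE (card_uniqP _) ?take_uniq ?enum_uniq //.
by rewrite size_takel // -cardE.
Qed.

Section Sparse.
Variables (V : finType) (Gam : sgraph V).
Local Notation adj := (sgraph_adj Gam).
Local Notation nonadj := (nonadj Gam).
Local Notation square := (square Gam).
Variable a : V.

Definition link (X : {set V}) (z w : V) := [exists x, exists y,
  [&& x \in X, y \in X, adj a x && adj a y, nonadj x y, adj z x && adj z y
    & adj w x && adj w y]].

Lemma linkP (X : {set V}) z w : reflect (exists x y, [/\ x \in X /\ y \in X, adj a x && adj a y,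
   nonadj x y, adj z x && adj z y & adj w x && adj w y]) (link X z w).
Proof.
apply: (iffP existsP) => [[x /existsP[y /and5P[xX yX axy nxy /andP[zxy wxy]]]]|].
  by exists x, y; split.
move=> [x [y [[xX yX] axy nxy zxy wxy]]]; exists x; apply/existsP; exists y.
by rewrite xX yX axy nxy zxy wxy.
Qed.

Lemma link_sym (X : {set V}) : symmetric (link X).
Proof.
suff H z w : link X z w -> link X w z by move=> z w; apply/idP/idP; exact: H.
by move=> /linkP[x [y [? ? ? ? ?]]]; apply/linkP; exists x, y.
Qed.

Definition far_part (V3 : {set V}) := [set z in V3 | ~~ adj a z].

Variables (V1 V2 V3 : {set V}) (kappa c1 s0 tau : nat).

Definition clique_free := forall K : {set V}, kappa <= #|K| ->
  exists x y, [/\ x \in K, y \in K, x != y & ~~ adj x y].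

Definition source (X S : {set V}) := [&& a \notin S, [disjoint S & X], 0 < #|S| & #|S| <= s0].

(** The number is what [greedy_matching] needs for [#|S| * c1] pairs: two endpoints for each pair,
    and [kappa] vertices for each element of [S] to keep the pigeonhole argument going. *)
Definition many_neighbours (X : {set V}) := forall S : {set V}, source X S ->
  #|S| * (c1 * 2 + kappa) <= #|[set x in X | adj a x && [exists s in S, adj s x]]|.

Definition hits (M : seq (V * V)) (t : V) := has (fun xy => adj t xy.1 && adj t xy.2) M.

Definition matching_in (X : {set V}) (k : nat) (M : seq (V * V)) :=
  [&& size M == k, uniq (endpoints M) & all [in X] (endpoints M)].

Definition matchings_hit (X : {set V}) := forall (S : {set V}) (M : seq (V * V)),
  source X S -> matching_in X (#|S| * c1) M ->
  exists t, [/\ t \in V3, t \notin S, ~~ adj a t & hits M t].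

Definition large_closed_hit := forall (T : {set V}) (M : seq (V * V)),
  T \subset far_part V3 -> closed_in (far_part V3) (link V1) T -> tau <= #|T| ->
  matching_in V2 (s0 * c1) M -> exists2 t, t \in T & hits M t.

Definition closed_large := forall S : {set V}, S \subset far_part V3 -> S != finset.set0 ->
  closed_in (far_part V3) (link V1) S -> s0 < #|S|.

Hypothesis cliq : clique_free.

Lemma source_matching (X S : {set V}) : many_neighbours X -> source X S ->
  exists2 M, matching_in X (#|S| * c1) M &
    forall xy, xy \in M -> [/\ adj a xy.1 && adj a xy.2, nonadj xy.1 xy.2
      & exists2 s, s \in S & adj s xy.1 && adj s xy.2].
Proof.
move=> many src; have := many S src; set Y := [set x in X | _] => szY.
have [|||M [sM uM HM]] := @greedy_matching _ adj nonadj kappa (#|S| * c1) S Y.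
- move=> K /cliq[x [y [xK yK xy nxy]]]; exists x, y; split=> //.
  by rewrite nonadjE xy.
- by move=> x; rewrite inE => /and3P[_ _ /exists_inP].
- by rewrite -mulnA -mulnDr.
exists M.
  apply/and3P; split=> //; first exact/eqP.
  apply/allP => x /flattenP[_ /mapP[uv /HM[u1 u2 _ _] ->]].
  by rewrite !inE => /orP[]/eqP ->; [move: u1|move: u2]; rewrite !inE => /andP[].
move=> xy /HM[x1 x2 nxy Hs]; split=> //.
by move: x1 x2; rewrite !inE => /and3P[_ -> _] /and3P[_ -> _].
Qed.

Lemma source_link (X S : {set V}) : many_neighbours X -> matchings_hit X -> source X S ->
  exists t s, [/\ t \in far_part V3, t \notin S, s \in S & link X s t].
Proof.
move=> many hit src; have [M MX HM] := source_matching many src.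
have [t [t3 tS nat' /hasP[xy xyM txy]]] := hit S M src MX.
have [axy nxy [s sS sxy]] := HM xy xyM; exists t, s; split=> //.
  by rewrite inE t3.
apply/linkP; exists xy.1, xy.2; split=> //.
case/and3P: MX => _ _ /allP allX; split; apply: allX; apply/flattenP;
  exists [:: xy.1; xy.2]; rewrite ?inE ?eqxx ?orbT //; exact: map_f.
Qed.

Hypothesis V_cover : forall v, v != a -> [|| v \in V1, v \in V2 | v \in V3].
Hypothesis aV3 : a \notin V3.
Hypothesis V12 : [disjoint V1 & V2].
Hypothesis V13 : [disjoint V1 & V3].
Hypothesis V23 : [disjoint V2 & V3].
Hypothesis s0_gt0 : 0 < s0.

(** A closed set with at most [s0] elements would be a source, and [source_link] would provide a
    link leaving it. *)
Lemma closed_largeP : many_neighbours V1 -> matchings_hit V1 -> closed_large.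
Proof.
move=> many hit S SZ S0 /closed_inP cS; rewrite ltnNge; apply/negP => Ss0.
have SV3 : S \subset V3.
  by apply: fintype.subset_trans SZ _; apply/fintype.subsetP => z; rewrite inE => /andP[].
have src : source V1 S.
  apply/and4P; split=> //; last by rewrite card_gt0.
    by apply: contra aV3; apply/fintype.subsetP.
  by apply: fintype.disjointWl SV3 _; rewrite fintype.disjoint_sym.
have [t [s [tZ tS sS st]]] := source_link many hit src.
by move/negP: tS; apply; exact: cS sS tZ st.
Qed.

(* The diagonals [(a, z)] with [z] in the far part are linked through diagonals
   in [V1] or [V2].  The component of each of them under [V1] is large, and two
   large [V1]-closed sets are joined by a link through [V2]; a further square
   brings in any other vertex [v]. *)
Theorem sparse_cfs :
  many_neighbours V1 -> many_neighbours V2 -> matchings_hit V1 -> matchings_hit V2 ->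
  large_closed_hit -> 0 < tau -> tau * 2 <= #|far_part V3| ->
  (forall v, v != a -> exists z, [/\ z \in V3, z != v, adj v z & ~~ adj a z]) ->
  (forall v z, v != a -> z \in V3 -> z != v ->
     exists y, [/\ y \in V1, y != v, adj a y, adj z y & ~~ adj v y]) ->
  cfs Gam.
Proof.
move=> many1 many2 hit1 hit2 large tau0 tauZ near nonnb.
set Z := far_part V3 in large tauZ *.
have Zin z : z \in Z -> z \in V3 /\ ~~ adj a z by rewrite inE => /andP[].
have naZ z : z \in Z -> nonadj a z.
  by move=> /Zin[z3 naz]; rewrite nonadjE naz andbT; apply: contraNneq aV3 => ->.
pose e z w := link V1 z w || link V2 z w.
have lsq (X : {set V}) z w : link X z w -> nonadj a z -> exists2 xy, square (a, z) xy &
    (nonadj a w -> square (a, w) xy).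
  move=> /linkP[x [y [_ /andP[ax ay] nxy /andP[zx zy] /andP[wx wy]]]] naz.
  by exists (x, y) => [|naw]; exact: squareI.
have lconn (X : {set V}) z w : link X z w -> nonadj a z -> nonadj a w -> connect square (a, z) (a, w).
  move=> l naz naw; have [xy s1 /(_ naw) s2] := lsq _ _ _ l naz.
  by apply: connect_trans (connect1 s1) _; apply/connect1/square_sym.
have srcP (X : {set V}) z : a \notin [set z] -> z \notin X -> source X [set z].
  move=> az zX; apply/and4P; split=> //; rewrite ?cards1 //.
  by rewrite disjoints1.
have Z0 : 0 < #|Z| by apply: leq_trans tauZ; rewrite muln_gt0 tau0.
have /card_gt0P[z0 z0Z] := Z0.
have notin12 z : z \in Z -> z \notin V1 /\ z \notin V2.
  move=> /Zin[z3 _]; split; apply/negP => zi.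
    by have := disjointFr V13 zi; rewrite z3.
  by have := disjointFr V23 zi; rewrite z3.
have az v : nonadj a v -> a \notin [set v] by rewrite inE => /andP[].
have [xy0 sq0] : exists f, square (a, z0) f.
  have [t [s [_ _ /set1P-> l]]] := source_link many1 hit1
    (srcP V1 z0 (az _ (naZ _ z0Z)) (proj1 (notin12 _ z0Z))).
  by have [f sf _] := lsq _ _ _ l (naZ _ z0Z); exists f.
pose C := [set z in Z | connect square (a, z0) (a, z)].
have CE z : (z \in C) = (z \in Z) && connect square (a, z0) (a, z) by rewrite inE.
have Cclosed (X : {set V}) z w : z \in C -> w \in Z -> link X z w -> w \in C.
  rewrite !CE => /andP[zZ cz] wZ l; rewrite wZ /=.
  by apply: connect_trans cz _; apply: lconn l _ _; exact: naZ.
have allC : C = Z.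
  apply/eqP; rewrite finset.eqEsubset; apply/andP; split.
    by apply/fintype.subsetP => z; rewrite CE => /andP[].
  rewrite -finset.setD_eq0; apply: contraT => D0.
  set D := Z :\: C in D0.
  have CZ : C \subset Z by apply/fintype.subsetP => z; rewrite CE => /andP[].
  have DZ : D \subset Z by exact: finset.subsetDl.
  have C0 : C != finset.set0 by apply/finset.set0Pn; exists z0; rewrite CE z0Z connect0.
  have Dclosed (X : {set V}) z w : z \in D -> w \in Z -> link X z w -> w \in D.
    move=> /finset.setDP[zZ nzC] wZ l; apply/finset.setDP; split=> //; apply: contra nzC => wC.
    by apply: (Cclosed X w z wC zZ); rewrite link_sym.
  (* [s0] vertices of [S] yield a matching in [V2], a vertex of the large set [T] hits it, and this
     is a link from [S] to [T]. The claim is applied to [C] and its complement [D] in [Z], in the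
     order that puts a set with at least [tau] elements second. *)
  have key (S T : {set V}) : S \subset Z -> T \subset Z -> S != finset.set0 ->
      (forall (X : {set V}) z w, z \in S -> w \in Z -> link X z w -> w \in S) ->
      (forall (X : {set V}) z w, z \in T -> w \in Z -> link X z w -> w \in T) ->
      [disjoint S & T] -> tau <= #|T| -> False.
    move=> SZ TZ S0 cS cT ST tauT.
    have s0S : s0 < #|S|.
      apply: (closed_largeP many1 hit1) => //; apply/closed_inP => z w; exact: cS.
    have [S' S'S S's0] : exists2 S' : {set V}, S' \subset S & #|S'| = s0.
      exact: subset_of_card (ltnW s0S).
    have src : source V2 S'.
      have S'Z := fintype.subset_trans S'S SZ.
      apply/and4P; split; rewrite ?S's0 //.
        apply: contra aV3 => /(fintype.subsetP S'Z)/Zin[] //.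
      by apply/pred0P => z /=; apply/negP => /andP[/(fintype.subsetP S'Z)/notin12[_ /negP]].
    have [M MX HM] := source_matching many2 src.
    have cT' : closed_in Z (link V1) T by apply/closed_inP => z w; exact: cT.
    have MX' : matching_in V2 (s0 * c1) M by rewrite -S's0.
    have [t tT /hasP[xy xyM txy]] := large T M TZ cT' tauT MX'.
    have [axy nxy [s sS' sxy]] := HM xy xyM.
    have l : link V2 s t.
      apply/linkP; exists xy.1, xy.2; split=> //.
      case/and3P: MX => _ _ /allP allX; split; apply: allX; apply/flattenP;
        exists [:: xy.1; xy.2]; rewrite ?inE ?eqxx ?orbT //; exact: map_f.
    have tS : t \in S by apply: cS l; [exact: (fintype.subsetP S'S) | exact: (fintype.subsetP TZ)].
    by have := disjointFr ST tS; rewrite tT.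
  have CD : [disjoint C & D].
    by apply/pred0P => z /=; apply/negP => /andP[zC /finset.setDP[_]]; rewrite zC.
  have cardCD : #|C| + #|D| = #|Z| by rewrite addnC -(cardsID C Z) addnC (finset.setIidPr CZ).
  case: (leqP tau #|D|) => tauD; first by case: (key C D).
  case: (key D C) => //; first by rewrite fintype.disjoint_sym.
  by move: tauD tauZ; rewrite -cardCD; clear; lia.
have Zconn z : z \in Z -> connect square (a, z0) (a, z).
  by rewrite -allC CE => /andP[].
have swap v f : square (a, v) f -> connect square (a, v) (v, a).
  move=> sf; apply: connect_trans (connect1 sf) _.
  exact/connect1/square_sym/(square_swap sf).
exists (a, z0); split; first by exists xy0.
move=> v; have [->|va] := eqVneq v a; first by exists z0; exact: connect0.
have [av|nav] := boolP (adj a v).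
  (* A neighbour [v] of [a] forms no diagonal with [a]; it enters through the square whose diagonals
     are [(a, z)] and [(v, y)]. *)
  have [z [z3 zv vz naz]] := near v va.
  have [y [y1 yv ay zy nvy]] := nonnb v z va z3 zv.
  have zZ : z \in Z by rewrite inE z3.
  exists y; apply: connect_trans (Zconn z zZ) (connect1 _).
  apply: squareI => //; [exact: naZ | | by rewrite adj_sym].
  by apply/andP; rewrite eq_sym.
have nav' : nonadj a v by rewrite nonadjE eq_sym va.
have [t [tZ [X l]]] : exists t, t \in Z /\ exists X, link X v t.
  case/or3P: (V_cover va) => vi.
  - have v2 : v \notin V2 by rewrite (disjointFr V12).
    have [t [s [tZ _ /set1P-> l]]] := source_link many2 hit2 (srcP _ _ (az _ nav') v2).
    by exists t; split=> //; exists V2.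
  - have v1 : v \notin V1 by rewrite (disjointFl V12).
    have [t [s [tZ _ /set1P-> l]]] := source_link many1 hit1 (srcP _ _ (az _ nav') v1).
    by exists t; split=> //; exists V1.
  have v1 : v \notin V1 by rewrite (disjointFl V13).
  have [t [s [tZ _ /set1P-> l]]] := source_link many1 hit1 (srcP _ _ (az _ nav') v1).
  by exists t; split=> //; exists V1.
exists a; have [f sf _] := lsq _ _ _ l nav'.
apply: connect_trans (Zconn t tZ) _; apply: connect_trans (swap v f sf).
by apply: lconn nav'; [rewrite link_sym; exact: l | exact: naZ].
Qed.

End Sparse.

(** * Probabilities of the exceptional events *)

Section Star.
Variables (R : realType) (n : nat) (p : R).
Local Open Scope ring_scope.
Hypothesis p01 : 0 <= p <= 1.
Local Notation graph := (sgraph 'I_n).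
Local Notation expect := (@expect R n p).
Local Notation prob := (@prob R n p).
Implicit Types (y u v a : 'I_n) (Y U A B S : {set 'I_n}) (G : graph).

(** The stars of distinct vertices outside [U] are disjoint sets of edges; this is where the
    independence in the estimates below comes from. *)
Definition star y U : pred {set 'I_n} := fun e => [exists u in U, e == [set y; u]%SET].

Lemma star_disj Y U y y' e : [disjoint Y & U] -> y \in Y -> y' \in Y ->
  star y U e -> star y' U e -> y = y'.
Proof.
move=> YU yY y'Y /exists_inP[u uU /eqP ->] /exists_inP[u' u'U /eqP E].
have : y \in [set y; u]%SET by rewrite !inE eqxx.
rewrite E !inE => /orP[/eqP//|/eqP yu']; move: u'U; rewrite -yu'.
by rewrite (disjointFr YU yY).
Qed.

Lemma adj_star (G G' : graph) y U u : u \in U ->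
  (forall e, star y U e -> (e \in edges G) = (e \in edges G')) ->
  sgraph_adj G y u = sgraph_adj G' y u.
Proof. by move=> uU H; apply: H; apply/exists_inP; exists u. Qed.

Lemma expect_star Y U (F : 'I_n -> graph -> R) : [disjoint Y & U] ->
  (forall y, y \in Y -> depends (star y U) (F y)) ->
  expect (fun G => \prod_(y in Y) F y G) = \prod_(y in Y) expect (F y).
Proof.
move=> YU dep; rewrite -[RHS]big_enum -(expect_prod_indep p (A := fun y => star y U)).
- by apply: expect_ext => G; rewrite -big_enum.
- exact: enum_uniq.
- by move=> y; rewrite mem_enum; exact: dep.
by move=> y y' e; rewrite !mem_enum; exact: star_disj YU.
Qed.

Lemma prob_bool (H : graph -> bool) : prob (fun G => H G) = expect (fun G => (H G)%:R).
Proof. by rewrite probE; apply: expect_ext => G; case: asboolP => [->//|/negP/negbTE->]. Qed.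

Lemma expect_compl (H : graph -> bool) :
  expect (fun G => 1 - (H G)%:R) = 1 - expect (fun G => (H G)%:R).
Proof. by rewrite expectB expect1. Qed.

Lemma onem_exp (x : R) : 1 - x <= expR (- x).
Proof. exact: expR_ge1Dx. Qed.

Lemma prod_onem_exp Y (x : R) (f : 'I_n -> R) :
  (forall y, y \in Y -> 0 <= f y <= 1 - x) ->
  \prod_(y in Y) f y <= expR (- x * #|Y|%:R).
Proof.
move=> Hf; apply: (@le_trans _ _ (\prod_(y in Y) expR (- x))).
  apply: ler_prod => y /Hf /andP[-> H] /=; exact: le_trans H (onem_exp x).
by rewrite prodr_const -expRM_natr.
Qed.

Lemma star_none Y U (H : 'I_n -> graph -> bool) (x : R) : [disjoint Y & U] ->
  (forall y, y \in Y -> depends (star y U) (fun G => (H y G)%:R : R)) ->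
  (forall y, y \in Y -> x <= expect (fun G => (H y G)%:R)) ->
  prob (fun G => forall y, y \in Y -> ~~ H y G) <= expR (- x * #|Y|%:R).
Proof.
move=> YU dep Hx; rewrite probE.
apply: (@le_trans _ _ (expect (fun G => \prod_(y in Y) (1 - (H y G)%:R)))).
  apply: expect_le => // G; case: asboolP => [none|_]; last first.
    by apply: prodr_ge0 => y _; case: (H y G); rewrite ?subr0 ?subrr ?ler01.
  by rewrite big1 // => y /none/negbTE ->; rewrite subr0.
rewrite (expect_star YU); last first.
  by move=> y yY G G' GG'; congr (1 - _); exact: dep.
apply: prod_onem_exp => y yY; rewrite expect_compl; apply/andP; split.
  by rewrite subr_ge0 -prob_bool prob_le1.
by rewrite lerB // Hx.
Qed.

(** Markov's inequality for [2] to the power of minus the count, whose expectation factors over the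
    stars. *)
Lemma star_count Y U (H : 'I_n -> graph -> bool) (x : R) k : [disjoint Y & U] ->
  (forall y, y \in Y -> depends (star y U) (fun G => (H y G)%:R : R)) ->
  (forall y, y \in Y -> x <= expect (fun G => (H y G)%:R)) ->
  prob (fun G => (#|[set y in Y | H y G]| < k)%N) <= 2 ^+ k * expR (- (x / 2) * #|Y|%:R).
Proof.
move=> YU dep Hx; rewrite probE.
have prodE G : \prod_(y in Y) (1 - (H y G)%:R / 2) = 2^-1 ^+ #|[set y in Y | H y G]| :> R.
  rewrite -prodr_const (bigID (fun y => H y G)) /= mulrC big1 ?mul1r; last first.
    by move=> y /andP[_ /negbTE ->]; rewrite mul0r subr0.
  apply: eq_big => [y|y /andP[_ ->]]; first by rewrite inE.
  by rewrite mul1r; lra.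
apply: (@le_trans _ _ (expect (fun G => 2 ^+ k * \prod_(y in Y) (1 - (H y G)%:R / 2)))).
  apply: expect_le => // G; rewrite prodE exprVn.
  case: asboolP => [lt|_]; last by rewrite divr_ge0 // exprn_ge0.
  by rewrite ler_pdivlMr ?exprn_gt0 // mul1r ler_weXn2l ?ler1n // ltnW.
rewrite expectZ ler_wpM2l ?exprn_ge0 // (expect_star YU); last first.
  by move=> y yY G G' GG'; congr (1 - _ / 2); exact: dep.
apply: prod_onem_exp => y yY.
have -> : expect (fun G => 1 - (H y G)%:R / 2) = 1 - expect (fun G => (H y G)%:R) / 2.
  rewrite expectB expect1 //; congr (_ - _).
  by rewrite mulrC -expectZ; apply: expect_ext => G; rewrite mulrC.
have e1 : expect (fun G => (H y G)%:R) <= 1 by rewrite -prob_bool prob_le1.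
by have := Hx y yY; apply: ltac:(move=> h; apply/andP; split; lra).
Qed.

Lemma cards2_neq y u : y != u -> #|[set y; u]%SET| == 2%N.
Proof. by rewrite cards2 => ->. Qed.

Lemma star_pattern y A B : y \notin A -> y \notin B -> [disjoint A & B] ->
  expect (fun G => ([forall u in A, sgraph_adj G y u] &&
                    [forall u in B, ~~ sgraph_adj G y u])%:R) = p ^+ #|A| * (1 - p) ^+ #|B|.
Proof.
move=> yA yB AB.
pose F u (G : graph) : R := if u \in A then (sgraph_adj G y u)%:R else 1 - (sgraph_adj G y u)%:R.
have yU u : u \in A :|: B -> y != u.
  by rewrite inE; apply: contraTneq => <-; rewrite negb_or yA.
transitivity (expect (fun G => \prod_(u in A :|: B) F u G)).
  apply: expect_ext => G; have [/andP[/forall_inP HA /forall_inP HB]|] := boolP (_ && _).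
    rewrite big1 // => u; rewrite /F inE; case: (boolP (u \in A)) => [/HA ->//|_ /= /HB/negbTE ->].
    by rewrite subr0.
  rewrite negb_and !negb_forall_in => /orP[/exists_inP[u uA nu]|/exists_inP[u uB nu]].
    by rewrite (bigD1 u) ?inE ?uA //= /F uA (negbTE nu) mul0r.
  rewrite (bigD1 u) ?inE ?uB ?orbT //= /F (disjointFl AB uB).
  by rewrite negbK in nu; rewrite nu subrr mul0r.
have -> : (fun G => \prod_(u in A :|: B) F u G) =
          (fun G => \prod_(u <- enum (A :|: B)) F u G).
  by apply/funext => G; rewrite big_enum.
rewrite (expect_prod_indep p (A := fun u => pred1 [set y; u]%SET)) ?enum_uniq //; last 2 first.
- move=> u _ G G' GG'; rewrite /F /sgraph_adj.
  by rewrite (GG' [set y; u]%SET) //=.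
- move=> u v e; rewrite !mem_enum => uU vU /eqP -> /eqP E.
  have : u \in [set y; v]%SET by rewrite -E !inE eqxx orbT.
  by rewrite !inE eq_sym (negbTE (yU u uU)) => /eqP.
have EF u : u \in A :|: B -> expect (F u) = if u \in A then p else 1 - p.
  move=> uU; rewrite /F; case: ifP => _.
    by apply: expect_edge; exact/cards2_neq/yU.
  by rewrite expect_compl; congr (1 - _); apply: expect_edge; exact/cards2_neq/yU.
rewrite big_enum (eq_bigr (fun u => if u \in A then p else 1 - p)) //.
rewrite (bigID [in A]) /=; congr (_ * _).
  rewrite -prodr_const; apply: eq_big => [u|u /andP[_ ->]//].
  by rewrite inE; case: (u \in A); rewrite ?andbF.
rewrite -prodr_const; apply: eq_big => [u|u /andP[_ /negbTE ->]//].
rewrite inE; have [uA|] := boolP (u \in A); last by rewrite andbT.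
by rewrite (disjointFr AB uA).
Qed.

Lemma edges_present (E : {set {set 'I_n}}) :
  (forall e : {set 'I_n}, e \in E -> #|e| == 2%N) ->
  prob (fun G => forall e : {set 'I_n}, e \in E -> e \in edges G) = p ^+ #|E|.
Proof.
move=> E2; rewrite probE.
transitivity (expect (fun G => \prod_(e <- enum E) ((e \in edges G)%:R : R))).
  apply: expect_ext => G; rewrite big_enum; case: asboolP => [H|nH].
    by rewrite big1 // => e /H ->.
  have [e eE ne] : exists2 e, e \in E & e \notin edges G.
    apply/exists_inP; apply: contra_notT nH; rewrite negb_exists_in => /forall_inP H e eE.
    by have := H e eE; rewrite negbK.
  by rewrite (bigD1 e) //= (negbTE ne) mul0r.
rewrite (expect_prod_indep p (A := fun e => pred1 e)) ?enum_uniq //; last 2 first.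
- by move=> e _ G G' GG'; rewrite (GG' e) //=.
- by move=> e e' f _ _ /eqP -> /eqP.
rewrite big_enum -prodr_const; apply: eq_bigr => e eE.
exact: expect_edge (E2 e eE).
Qed.

End Star.

Section Events.
Variables (R : realType) (n : nat) (p : R).
Local Open Scope ring_scope.
Hypothesis p01 : 0 <= p <= 1.
Local Notation graph := (sgraph 'I_n).
Local Notation expect := (@expect R n p).
Local Notation prob := (@prob R n p).
Local Notation q := (1 - p).
Implicit Types (y u v a t : 'I_n) (X Y U A B S T K : {set 'I_n}) (G : graph).
Implicit Types (M : seq ('I_n * 'I_n)).

Lemma mem_endpoints M xy v : xy \in M -> v \in [:: xy.1; xy.2] -> v \in endpoints M.
Proof.
move=> xyM vxy; apply/flattenP; exists [:: xy.1; xy.2] => //.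
exact: (map_f (fun z => [:: z.1; z.2])).
Qed.

Lemma endpoints_inj M xy uv v : uniq (endpoints M) -> xy \in M -> uv \in M ->
  v \in [:: xy.1; xy.2] -> v \in [:: uv.1; uv.2] -> xy = uv.
Proof.
elim: M => // st M IH uall; have {uall} : uniq ([:: st.1; st.2] ++ endpoints M) by [].
rewrite cat_uniq => /and3P[_ /hasPn dis uM]; rewrite !(in_cons st).
move=> /orP[/eqP->|xyM] /orP[/eqP->|uvM] // vxy vuv.
- by have := dis v (mem_endpoints uvM vuv); rewrite vxy.
- by have := dis v (mem_endpoints xyM vxy); rewrite vuv.
exact: IH.
Qed.

Lemma endpoints_uniq M : uniq (endpoints M) -> uniq M.
Proof.
elim: M => //= st M IH; rewrite /endpoints /= -/(endpoints M) inE negb_or.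
case/and3P => /andP[_ n1] _ /IH ->; rewrite andbT; apply: contra n1 => stM.
by rewrite (mem_endpoints stM) // inE eqxx.
Qed.

Lemma matching_sub X k M : matching_in X k M ->
  [/\ size M = k, uniq (endpoints M)
    & forall xy, xy \in M -> [/\ xy.1 \in X, xy.2 \in X & xy.1 != xy.2]].
Proof.
case/and3P => /eqP sM uM /allP XM; split=> // xy xyM; split.
- by apply: XM; rewrite (mem_endpoints xyM) // inE eqxx.
- by apply: XM; rewrite (mem_endpoints xyM) // !inE eqxx orbT.
have /rot_to[i s _] := xyM.
have sub : subseq [:: xy.1; xy.2] (endpoints M).
  elim: M xyM {sM uM XM} => // st M IH; rewrite inE => /orP[/eqP->|/IH H].
    by rewrite /endpoints /= !eqxx sub0seq.
  apply: subseq_trans H _; rewrite /endpoints /= -/(endpoints M).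
  exact: (suffix_subseq [:: st.1; st.2]).
by have := subseq_uniq sub uM; rewrite /= inE andbT.
Qed.

Lemma hits_depends X k M t : matching_in X k M ->
  depends (star t X) (fun G => (hits G M t)%:R : R).
Proof.
case/matching_sub => _ _ XM G G' GG'; congr (nat_of_bool _)%:R.
apply: eq_in_has => xy /XM[x1 x2 _].
by rewrite (adj_star x1 GG') (adj_star x2 GG').
Qed.

Lemma expect_no_hit X k M t : matching_in X k M -> t \notin X ->
  expect (fun G => 1 - (hits G M t)%:R) = (1 - p ^+ 2) ^+ k.
Proof.
move=> MX tX; have [<- uM XM] := matching_sub MX.
have tne v : v \in X -> t != v by apply: contraTneq => <-.
pose F (xy : 'I_n * 'I_n) (G : graph) : R := 1 - (sgraph_adj G t xy.1 && sgraph_adj G t xy.2)%:R.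
transitivity (expect (fun G => \prod_(xy <- M) F xy G)).
  apply: expect_ext => G; rewrite /hits; elim: (M) => [|xy N IH].
    by rewrite big_nil subr0.
  rewrite big_cons -IH /F /=; case: (_ && _) => /=; first by rewrite subrr mul0r.
  by rewrite subr0 mul1r.
rewrite (expect_prod_indep p (A := fun xy => pred2 [set t; xy.1]%SET [set t; xy.2]%SET)).
- rewrite -[size M]/(size M) (eq_big_seq (fun=> 1 - p ^+ 2)); last first.
    move=> xy /XM[x1 x2 nxy]; rewrite /F expect_compl; congr (1 - _).
    have := @star_pattern R n p t [set xy.1; xy.2]%SET finset.set0.
    rewrite !inE negb_or tne ?tne // cards0 expr0 mulr1 cards2 nxy => <- //; last first.
      by rewrite disjoint_sym; exact: disjoints0_l || (by apply/pred0P => z /=; rewrite !inE).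
    apply: expect_ext => G; congr (nat_of_bool _)%:R.
    have -> : [forall u in finset.set0, ~~ sgraph_adj G t u] by apply/forall_inP => u; rewrite inE.
    rewrite andbT; apply/idP/idP => [/andP[h1 h2]|/forall_inP H].
      by apply/forall_inP => u; rewrite !inE => /orP[]/eqP ->.
    by apply/andP; split; apply: H; rewrite !inE eqxx ?orbT.
  by elim: (M) => [|xy N IH]; rewrite ?big_nil // big_cons IH -exprS.
- exact: endpoints_uniq.
- move=> xy _ G G' GG'; rewrite /F /sgraph_adj.
  by rewrite (GG' [set t; xy.1]%SET) ?(GG' [set t; xy.2]%SET) //= ?eqxx ?orbT.
move=> xy uv e xyM uvM; have [x1 x2 _] := XM _ xyM; have [u1 u2 _] := XM _ uvM.
have inj v w : v \in X -> [set t; v]%SET = [set t; w]%SET -> v = w.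
  move=> vX E; have : v \in [set t; w]%SET by rewrite -E !inE eqxx orbT.
  by rewrite !inE eq_sym (negbTE (tne v vX)) => /eqP.
have fin v : v \in [:: xy.1; xy.2] -> v \in [:: uv.1; uv.2] -> xy = uv.
  exact: endpoints_inj uM xyM uvM.
have vX v : v \in [:: xy.1; xy.2] -> v \in X by rewrite !inE => /orP[]/eqP ->.
move=> /pred2P exy /pred2P euv.
have [v [vxy ev]] : exists v, v \in [:: xy.1; xy.2] /\ e = [set t; v]%SET.
  by case: exy => ->; [exists xy.1|exists xy.2]; rewrite !inE eqxx ?orbT.
have [w [wuv ew]] : exists w, w \in [:: uv.1; uv.2] /\ e = [set t; w]%SET.
  by case: euv => ->; [exists uv.1|exists uv.2]; rewrite !inE eqxx ?orbT.
apply: (fin v vxy); have E : [set t; v]%SET = [set t; w]%SET by rewrite -ev.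
by rewrite (inj v w (vX v vxy) E).
Qed.

End Events.

Lemma disjoint_setU1 (T : finType) (A B : {set T}) x : x \notin A -> [disjoint A & B] ->
  [disjoint A & x |: B].
Proof.
move=> xA AB; apply/pred0P => y /=; rewrite !inE; apply/negP => /andP[yA /orP[/eqP E|yB]].
  by rewrite -E yA in xA.
by rewrite (disjointFr AB yA) in yB.
Qed.

Section EventBounds.
Variables (R : realType) (n : nat) (p : R).
Local Open Scope ring_scope.
Hypothesis p01 : 0 <= p <= 1.
Local Notation graph := (sgraph 'I_n).
Local Notation expect := (@expect R n p).
Local Notation prob := (@prob R n p).
Local Notation q := (1 - p).
Implicit Types (y u v a t : 'I_n) (X Y U A B S T K : {set 'I_n}) (G : graph).
Implicit Types (M : seq ('I_n * 'I_n)).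

Definition pattern G A B y :=
  [forall u in A, sgraph_adj G y u] && [forall u in B, ~~ sgraph_adj G y u].

Lemma pattern_depends A B y :
  depends (star y (A :|: B)) (fun G => (pattern G A B y)%:R : R).
Proof.
move=> G G' GG'; congr (nat_of_bool _)%:R; congr (_ && _); apply: eq_forallb_in => u uA.
  by rewrite (adj_star _ GG') // inE uA.
by rewrite (adj_star _ GG') // inE uA orbT.
Qed.

Lemma pattern_expect A B y : y \notin A :|: B -> [disjoint A & B] ->
  expect (fun G => (pattern G A B y)%:R) = p ^+ #|A| * q ^+ #|B|.
Proof. by rewrite inE negb_or => /andP[yA yB] AB; exact: star_pattern. Qed.

Lemma prob_no_pattern Y A B : [disjoint Y & A :|: B] -> [disjoint A & B] ->
  prob (fun G => forall y, y \in Y -> ~~ pattern G A B y) <=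
  expR (- (p ^+ #|A| * q ^+ #|B|) * #|Y|%:R).
Proof.
move=> YAB AB; apply: (star_none p01 YAB) => y yY; first exact: pattern_depends.
by rewrite pattern_expect // (disjointFr YAB yY).
Qed.

Lemma prob_few_patterns Y A B k : [disjoint Y & A :|: B] -> [disjoint A & B] ->
  prob (fun G => (#|[set y in Y | pattern G A B y]| < k)%N) <=
  2 ^+ k * expR (- (p ^+ #|A| * q ^+ #|B| / 2) * #|Y|%:R).
Proof.
move=> YAB AB; pose H y G := pattern G A B y; pose x := p ^+ #|A| * q ^+ #|B|.
have := @star_count R n p p01 Y (A :|: B) H x k YAB; apply => y yY; first exact: pattern_depends.
by rewrite /H pattern_expect // (disjointFr YAB yY).
Qed.

Lemma prob_few_neighbours X S a k : a \notin S -> a \notin X -> [disjoint S & X] ->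
  prob (fun G => (#|[set x in X | sgraph_adj G a x && [exists s in S, sgraph_adj G s x]]| < k)%N)
  <= 2 ^+ k * expR (- (p * (1 - q ^+ #|S|) / 2) * #|X|%:R).
Proof.
move=> aS aX SX.
have XU : [disjoint X & a |: S] by rewrite disjoint_setU1 // disjoint_sym.
pose H x G := sgraph_adj G x a && [exists s in S, sgraph_adj G x s].
have -> : (fun G => (#|[set x in X | sgraph_adj G a x
            && [exists s in S, sgraph_adj G s x]]| < k)%N : Prop) =
          (fun G => (#|[set x in X | H x G]| < k)%N : Prop).
  apply/funext => G; congr (is_true (_ < _)%N); apply: eq_card => x; rewrite !inE /H.
  congr (_ && (_ && _)); first by rewrite adj_sym.
  by apply: eq_existsb => s; rewrite adj_sym.
have := @star_count R n p p01 X (a |: S) H (p * (1 - q ^+ #|S|)) k XU; apply => x xX.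
  move=> G G' GG'; congr (nat_of_bool _)%:R; congr (_ && _).
    by rewrite (adj_star _ GG') // !inE eqxx.
  apply: eq_existsb => s; have [sS|//] := boolP (s \in S).
  by rewrite (adj_star _ GG') // !inE sS orbT.
have xa : x \notin [set a]%SET by rewrite inE; apply: contraNneq aX => <-.
have xS : x \notin S by rewrite (disjointFl SX xX).
have aS' : [disjoint [set a]%SET & S] by rewrite disjoints1.
have E1 := star_pattern p xa xS aS'.
have x0 : x \notin (finset.set0 : {set 'I_n}) by rewrite inE.
have a0 : [disjoint [set a]%SET & (finset.set0 : {set 'I_n})].
  by rewrite disjoints1 inE.
have E2 := star_pattern p xa x0 a0.
rewrite cards0 cards1 expr1 expr0 mulr1 in E2; rewrite cards1 expr1 in E1.
rewrite le_eqVlt; apply/orP; left; apply/eqP; rewrite mulrBr mulr1 -E1 -[X in X - _]E2.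
rewrite -expectB; apply: expect_ext => G.
have -> : [forall u in finset.set0, ~~ sgraph_adj G x u] by apply/forall_inP => u; rewrite inE.
have -> : [forall u in [set a]%SET, sgraph_adj G x u] = sgraph_adj G x a.
  apply/forall_inP/idP => [|xaG u]; first by apply; rewrite inE.
  by rewrite inE => /eqP ->.
rewrite /H -negb_exists_in; case: (sgraph_adj G x a); case: [exists _ in _, _] => /=; lra.
Qed.

Lemma prob_no_hit X Y k M : matching_in X k M -> [disjoint Y & X] ->
  prob (fun G => forall t, t \in Y -> ~~ hits G M t) <=
  expR (- (1 - (1 - p ^+ 2) ^+ k) * #|Y|%:R).
Proof.
move=> MX YX; apply: (star_none p01 YX) => t tY; first exact: hits_depends MX.
have := expect_no_hit p MX (_ : t \notin X); rewrite (disjointFr YX tY) => /(_ isT) <-.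
by rewrite expect_compl opprB addrC subrK.
Qed.

Lemma prob_no_far_hit X Y k M a : matching_in X k M -> [disjoint Y & X] ->
  a \notin X -> a \notin Y ->
  prob (fun G => forall t, t \in Y -> ~~ (~~ sgraph_adj G t a && hits G M t)) <=
  expR (- (q * (1 - (1 - p ^+ 2) ^+ k)) * #|Y|%:R).
Proof.
move=> MX YX aX aY.
have YU : [disjoint Y & a |: X] by exact: disjoint_setU1.
apply: (star_none p01 YU) => t tY.
  move=> G G' GG'; congr (nat_of_bool _)%:R; congr (~~ _ && _).
    by rewrite (adj_star _ GG') // !inE eqxx.
  have HG := @hits_depends R n X k M t MX G G'.
  have /eqP : ((hits G M t)%:R : R) = (hits G' M t)%:R.
    apply: HG => e /exists_inP[x xX /eqP ->]; apply: GG'; apply/exists_inP.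
    by exists x; rewrite // !inE xX orbT.
  by rewrite eqr_nat; case: (hits G M t); case: (hits G' M t).
have ta : t != a by apply: contraNneq aY => <-.
have tX : t \notin X by rewrite (disjointFr YX tY).
rewrite -[X in q * (X - _)](expect1 n p) -(expect_no_hit p MX tX) -expectB.
have e2 := cards2_neq ta.
rewrite -[X in X - p](expect1 n p) -[X in _ - X](expect_edge p e2) -expectB.
rewrite -(@expectM R n p (pred1 [set t; a]%SET)).
- apply: expect_le => // G; rewrite -/(sgraph_adj G t a).
  by case: (sgraph_adj G t a); case: (hits G M t) => /=; lra.
- by move=> G G' GG'; rewrite (GG' [set t; a]%SET) //=.
move=> G G' GG'; congr (1 - (1 - _)); apply: (hits_depends R MX) => e /exists_inP[x xX /eqP ->].
apply: GG'; apply/negP => /eqP E; have : x \in [set t; a]%SET by rewrite -E !inE eqxx orbT.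
by rewrite !inE => /orP[]/eqP xE; move: xX; rewrite xE; apply/negP.
Qed.

Definition inner_pairs K : {set {set 'I_n}} := [set e : {set 'I_n} | (e \subset K) && (#|e| == 2%N)].

Lemma prob_not_clique_free kappa :
  prob (fun G => ~ clique_free G kappa) <= 'C(n, kappa)%:R * p ^+ 'C(kappa, 2).
Proof.
apply: (@le_trans _ _ (prob (fun G => exists K, (#|K| == kappa) /\
   forall e : {set 'I_n}, e \in inner_pairs K -> e \in edges G))).
  apply: prob_le => // G ncf; apply: contrapT => none; apply: ncf => K kK.
  have [K' K'K cK'] := subset_of_card kK.
  apply: contrapT => nK; apply: none; exists K'; split; first exact/eqP.
  move=> e; rewrite inE => /andP[eK' /cards2P[x [y [xy eE]]]].
  have eK := fintype.subset_trans eK' K'K.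
  have xK : x \in K by apply: (fintype.subsetP eK); rewrite eE !inE eqxx.
  have yK : y \in K by apply: (fintype.subsetP eK); rewrite eE !inE eqxx orbT.
  apply: contrapT => ne; apply: nK; exists x, y; split=> //.
  by rewrite /sgraph_adj -eE; exact/negP.
apply: le_trans (prob_exists p01 _ _) _.
rewrite (eq_bigr (fun=> p ^+ 'C(kappa, 2))); last first.
  move=> K /eqP cK; rewrite edges_present // => [|e]; last by rewrite inE => /andP[].
  by rewrite cards_draws cK.
rewrite sumr_const (_ : #|_| = 'C(n, kappa)) ?mulr_natl //.
by rewrite -[in RHS](card_ord n) -card_draws; apply: eq_card => K; rewrite !inE.
Qed.

Definition cross_pairs S : {set {set 'I_n}} := [set [set s; t]%SET | s in S, t in ~: S].

Lemma card_cross_pairs S : #|cross_pairs S| = (#|S| * (n - #|S|))%N.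
Proof.
have -> : cross_pairs S = [set [set x.1; x.2]%SET | x in finset.setX S (~: S)].
  apply/setP => e; apply/imset2P/imsetP => [[s t sS tS ->]|[[s t]]].
    by exists (s, t); rewrite ?finset.in_setX ?sS.
  by rewrite finset.in_setX => /andP[sS tS] ->; exists s t.
rewrite card_in_imset.
  by rewrite cardsX [X in (_ * X)%N]cardsCs finset.setCK card_ord.
move=> [s t] [s' t'] /finset.setXP[/= sS]; rewrite inE => tS /finset.setXP[/= sS'].
rewrite inE => tS' E.
have : s \in [set s'; t']%SET by rewrite -E !inE eqxx.
have : t \in [set s'; t']%SET by rewrite -E !inE eqxx orbT.
rewrite !inE => /orP[/eqP ts|/eqP ->]; first by rewrite ts sS' in tS.
by move=> /orP[/eqP ->//|/eqP st]; rewrite -st sS in tS'.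
Qed.

(** If the complement is disconnected, a component or the union of the others has at most half of
    the vertices, and all edges between it and the rest are present. *)
Lemma prob_not_connected :
  prob (fun G => ~ forall s t, connect (nonadj G) s t) <=
  \sum_(S : {set 'I_n} | (0 < #|S|)%N && (#|S| * 2 <= n)%N) p ^+ (#|S| * (n - #|S|)).
Proof.
apply: (@le_trans _ _ (prob (fun G => exists S, ((0 < #|S|)%N && (#|S| * 2 <= n)%N) /\
   forall e : {set 'I_n}, e \in cross_pairs S -> e \in edges G))).
  apply: prob_le => // G; move/existsNP => [s /existsNP[t st]].
  pose C : {set 'I_n} := [set v | connect (nonadj G) s v].
  have sC : s \in C by rewrite inE.
  have tC : t \notin C by rewrite inE; exact/negP.
  have adjC x y : x \in C -> y \notin C -> [set x; y]%SET \in edges G.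
    move=> xC yC; apply: contraNT yC => nxy; move: xC; rewrite !inE => sx.
    have [<-//|xy] := eqVneq x y; apply: connect_trans sx (connect1 _).
    by rewrite /nonadj xy nxy.
  have [C2|C2] := leqP (#|C| * 2) n.
    exists C; split; first by rewrite C2 andbT; apply/card_gt0P; exists s.
    by move=> e /imset2P[x y xC]; rewrite inE => yC ->; exact: adjC.
  have Cc : (#|C| + #|~: C| = n)%N by rewrite cardsC card_ord.
  exists (~: C); split; first last.
    move=> e /imset2P[x y]; rewrite finset.setCK inE => xC yC ->.
    by rewrite finset.setUC; exact: adjC.
  rewrite (_ : (#|~: C| * 2 <= n)%N) ?andbT; last by move: C2 Cc; clear; lia.
  by apply/card_gt0P; exists t; rewrite inE.
apply: le_trans (prob_exists p01 _ _) _.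
apply: ler_sum => S _; rewrite edges_present ?card_cross_pairs //.
by move=> e /imset2P[s t sS]; rewrite inE => tS ->; apply: cards2_neq; apply: contraNneq tS => <-.
Qed.

End EventBounds.

(** * Elementary inequalities for the union bounds *)

Section RealBounds.
Variable R : realType.
Local Open Scope ring_scope.
Implicit Types (x y : R).

(** Bernoulli's inequality gives [(1 - x) ^+ k * (1 + w) <= (1 - x * x) ^+ k <= 1] with [w = k x],
    and [(1 - w / 2) * (1 + w) >= 1] for [w] between 0 and 1. *)
Lemma pow_onem_le x k : 0 <= x <= 1 -> k%:R * x <= 1 -> (1 - x) ^+ k <= 1 - k%:R * x / 2.
Proof.
move=> /andP[x0 x1] kx.
have kx0 : 0 <= k%:R * x by rewrite mulr_ge0.
have B : 1 + k%:R * x <= (1 + x) ^+ k.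
  elim: k {kx kx0} => [|k IH]; first by rewrite mul0r addr0 expr0.
  rewrite exprS; apply: le_trans (ler_wpM2l _ IH); last by lra.
  have kxx : 0 <= k%:R * (x * x) by rewrite !mulr_ge0.
  by rewrite -natr1; lra.
have C : (1 - x) ^+ k * (1 + x) ^+ k <= 1.
  rewrite -exprMn; have xx : 0 <= x * x by exact: mulr_ge0.
  by apply: exprn_ile1; [apply: mulr_ge0; lra | lra].
have D : 0 <= (1 - x) ^+ k by rewrite exprn_ge0; lra.
have E : (1 - x) ^+ k * (1 + k%:R * x) <= 1 by apply: le_trans C; exact: ler_wpM2l.
set z := (1 - x) ^+ k in D E *; set w := k%:R * x in kx kx0 E *.
rewrite -(ler_pM2r (_ : 0 < 1 + w)); last by lra.
by apply: le_trans E _; nra.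
Qed.

Lemma pow_onem_lb x k : 0 <= x <= 1 -> k%:R * x <= 1 -> k%:R * x / 2 <= 1 - (1 - x) ^+ k.
Proof. by move=> x01 kx; have := pow_onem_le x01 kx; lra. Qed.

Lemma pow2_expR k : 2 ^+ k <= expR (k%:R : R).
Proof.
rewrite -[k%:R]mulr1 expRM_natl lerXn2r ?nnegrE ?expR_ge0 //.
by have := @expR_ge1Dx R 1; lra.
Qed.

Lemma natr_expR n : (0 < n)%N -> n%:R = expR (ln (n%:R : R)).
Proof. by move=> n0; rewrite lnK // posrE ltr0n. Qed.

Lemma natr_pow_expR n k : (0 < n)%N -> n%:R ^+ k = expR (k%:R * ln (n%:R : R)).
Proof. by move=> n0; rewrite expRM_natl -natr_expR. Qed.

(** The sum is [(1 + x) ^+ n - 1] by the binomial theorem, and [expR y - 1 <= 2 y] for [y] between 0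
    and [1 / 2]. *)
Lemma sum_sets_pow (n : nat) x : 0 <= x -> n%:R * x <= 1 / 2 ->
  \sum_(S : {set 'I_n} | (0 < #|S|)%N) x ^+ #|S| <= 2 * (n%:R * x).
Proof.
move=> x0 nx; have nx0 : 0 <= n%:R * x by rewrite mulr_ge0.
have E : \sum_(S : {set 'I_n}) x ^+ #|S| = (x + 1) ^+ n.
  rewrite -[in RHS](card_ord n) -prodr_const bigA_distr; apply: eq_bigr => S _.
  by rewrite -big_mkcond prodr_const.
move: E; rewrite (bigD1 finset.set0) //= cards0 expr0 => E.
have -> : \sum_(S : {set 'I_n} | (0 < #|S|)%N) x ^+ #|S| = (x + 1) ^+ n - 1.
  by rewrite -E addrAC subrr add0r; apply: eq_bigl => S; rewrite lt0n cards_eq0.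
have D : (x + 1) ^+ n <= expR (n%:R * x).
  rewrite expRM_natl lerXn2r ?nnegrE ?expR_ge0 //; first lra.
  by rewrite addrC expR_ge1Dx.
have F : expR (n%:R * x) * (1 - n%:R * x) <= 1.
  rewrite -[leRHS](expRxMexpNx_1 (n%:R * x)) ler_wpM2l ?expR_ge0 //.
  exact: expR_ge1Dx.
by have := expR_ge0 (n%:R * x); nra.
Qed.

Lemma bin_le_pow (n k : nat) : 'C(n, k)%:R <= n%:R ^+ k :> R.
Proof.
rewrite -natrX ler_nat; apply: (@leq_trans (n ^_ k)%N).
  by rewrite -bin_ffact leq_pmulr // fact_gt0.
elim: k => [|k IH]; first by rewrite ffactn0 expn0.
by rewrite ffactnSr expnSr leq_mul // leq_subr.
Qed.

Lemma bin2_natr (k : nat) : 'C(k, 2)%:R = k%:R * (k%:R - 1) / 2 :> R.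
Proof.
case: k => [|k]; first by rewrite bin0n !mul0r.
have /(congr1 (fun i => i%:R : R)) : ('C(k.+1, 2) * 2 = k.+1 * k)%N.
  by have := bin_ffact k.+1 2; rewrite ffactnS ffactn1.
by rewrite !natrM -(natr1 k) addrK => <-; lra.
Qed.

End RealBounds.

Section UnionBounds.
Variables (R : realType) (n : nat) (p : R).
Local Open Scope ring_scope.
Hypothesis p01 : 0 <= p <= 1.
Local Notation graph := (sgraph 'I_n).
Local Notation expect := (@expect R n p).
Local Notation prob := (@prob R n p).
Implicit Types (S T : {set 'I_n}) (G : graph) (M : seq ('I_n * 'I_n)) (x : R).

Lemma prob_exists_seq k (C : pred (seq ('I_n * 'I_n))) (P : seq ('I_n * 'I_n) -> graph -> Prop) x :
  (forall M, C M -> size M = k) -> 0 <= x -> (forall M, C M -> prob (P M) <= x) ->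
  prob (fun G => exists M, C M /\ P M G) <= n%:R ^+ (k * 2) * x.
Proof.
move=> Ck x0 Cx; apply: (@le_trans _ _ (prob (fun G =>
    exists M : k.-tuple ('I_n * 'I_n), C M /\ P M G))).
  by apply: prob_le => // G [M [CM PM]]; exists (Tuple (introT eqP (Ck _ CM))).
apply: le_trans (prob_exists p01 _ _) _.
apply: (@le_trans _ _ (\sum_(M : k.-tuple ('I_n * 'I_n) | C M) x)).
  by apply: ler_sum => M /Cx.
apply: (@le_trans _ _ (\sum_(M : k.-tuple ('I_n * 'I_n)) x)).
  by rewrite [leRHS](bigID (fun M : k.-tuple _ => C M)) /= lerDl sumr_ge0.
by rewrite sumr_const card_tuple card_prod card_ord -[leLHS]mulr_natl -natrX mulnn -expnM mulnC.
Qed.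

Lemma prob_exists_set (C : pred {set 'I_n}) (P : {set 'I_n} -> graph -> Prop) x :
  0 <= x -> n%:R * x <= 1 / 2 -> (forall S, C S -> (0 < #|S|)%N) ->
  (forall S, C S -> prob (P S) <= x ^+ #|S|) ->
  prob (fun G => exists S, C S /\ P S G) <= 2 * (n%:R * x).
Proof.
move=> x0 nx C0 Cx; apply: le_trans (prob_exists p01 _ _) _.
apply: le_trans (sum_sets_pow x0 nx); apply: (@le_trans _ _ (\sum_(S : {set 'I_n} | C S) x ^+ #|S|)).
  by apply: ler_sum => S /Cx.
rewrite [leRHS](bigID C) /= [X in X + _](_ : _ = \sum_(S : {set 'I_n} | C S) x ^+ #|S|).
  by rewrite lerDl sumr_ge0 // => S _; rewrite exprn_ge0.
by apply: eq_bigl => S; apply/andP/idP => [[]//|CS]; rewrite CS C0.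
Qed.

End UnionBounds.

Section SparseBounds.
Variables (R : realType) (n : nat) (p : R).
Local Open Scope ring_scope.
Local Notation graph := (sgraph 'I_n).
Local Notation expect := (@expect R n p).
Local Notation prob := (@prob R n p).
Local Notation q := (1 - p).
Local Notation L := (ln (n%:R : R)).
Implicit Types (S T X Y : {set 'I_n}) (G : graph) (M : seq ('I_n * 'I_n)).
Variables (a : 'I_n) (c1 s0 kappa : nat).

Hypothesis n_gt0 : (0 < n)%N.
Hypothesis p_gt0 : 0 < p.
Hypothesis p_le4 : p <= 1 / 4.
Hypothesis mL : 1600 * L <= n%:R * p ^+ 2.
Hypothesis L2 : 2 <= L.

Let p01 : 0 <= p <= 1.
Proof. by apply/andP; split; have := p_gt0; have := p_le4; lra. Qed.

(* Summing the powers [x ^+ #|S|] over the nonempty sets [S] of vertices costs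
   [O(n x)], that is [O(1 / n)]. *)
Let x := expR (- (2 * L)).

Let nxE : n%:R * x = expR (- L).
Proof. by rewrite [X in X * _](natr_expR R n_gt0) /x -expRD; congr expR; lra. Qed.

Let nx_le : n%:R * x <= 1 / 2.
Proof.
rewrite nxE; have H := @expR_ge1Dx R L; have E := @expRxMexpNx_1 R L.
have e0 := expR_ge0 (- L).
have : expR L * expR (- L) >= 2 * expR (- L) by rewrite ler_wpM2r //; have := L2; lra.
by lra.
Qed.

(** As [p <= expR (- 1)], the expected number of cliques is at most
    [expR (kappa L - kappa (kappa - 1) / 2)], and [kappa - 1 >= 4 L] makes the second term twice the
    first. *)
Lemma prob_not_clique_free_le : 4 * L + 1 <= kappa%:R ->
  prob (fun G => ~ clique_free G kappa) <= expR (- L).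
Proof.
move=> kL; apply: le_trans (prob_not_clique_free n p01 kappa) _.
have pe : p <= expR (- 1).
  have E : expR (- (1 / 2)) ^+ 2 = expR (- 1) :> R.
    by rewrite -expRM_natl; congr expR; lra.
  have H := @expR_ge1Dx R (- (1 / 2)).
  by rewrite -E; apply: le_trans p_le4 _; rewrite expr2; nra.
have : p ^+ 'C(kappa, 2) <= expR (- 1) ^+ 'C(kappa, 2).
  by rewrite lerXn2r ?nnegrE ?expR_ge0 // ltW.
rewrite -expRM_natl bin2_natr => B.
apply: le_trans (ler_pM _ _ (bin_le_pow _ _ _) B) _ => //; first by rewrite exprn_ge0 ?ltW.
rewrite natr_pow_expR // -expRD ler_expR; have := L2; move: kL.
set k := (kappa%:R : R); set l := L => kL l2.
have : k * (4 * l) <= k * (k - 1) by apply: ler_wpM2l; lra.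
have : l <= k * l by nra.
by lra.
Qed.

(** The exponent is at least [s p^2 N / 16], that is [100 s l] by the constant 1600; [98 s l] of it
    pays for the factor [2 ^+ (s t)], and [2 s l] for summing over the sets [S]. *)
Lemma few_arith (s w y N l t : R) : 0 <= s -> s * p / 2 <= w -> N / 4 <= y -> 0 <= N ->
  1600 * l <= N * p ^+ 2 -> t <= 98 * l -> s * t + - (p * w / 2) * y <= s * - (2 * l).
Proof.
move=> s0' sw Ny N0 ml tl; have p0 := ltW p_gt0.
have sp : 0 <= s * p / 2 by rewrite divr_ge0 // mulr_ge0.
have A : p * (s * p / 2) / 2 * (N / 4) <= p * w / 2 * y.
  by apply: ler_pM; rewrite ?divr_ge0 ?mulr_ge0 // ler_pM2r // ler_wpM2l.
have B : s * (1600 * l) <= s * (N * p ^+ 2) by exact: ler_wpM2l.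
have C : s * t <= s * (98 * l) by exact: ler_wpM2l.
by move: A B C; rewrite expr2; lra.
Qed.

Lemma prob_few_many_neighbours X : a \notin X -> n%:R / 4 <= #|X|%:R :> R ->
  s0%:R * p <= 1 -> (c1 * 2 + kappa)%:R <= 98 * L ->
  prob (fun G => ~ many_neighbours G a kappa c1 s0 X) <= 2 * expR (- L).
Proof.
move=> aX X4 s0p tL; rewrite -nxE.
apply: le_trans (_ : prob (fun G => exists S, source a s0 X S /\
  (#|[set x in X | sgraph_adj G a x && [exists s in S, sgraph_adj G s x]]| <
    #|S| * (c1 * 2 + kappa))%N) <= _).
  apply: prob_le => // G /existsNP[S /not_implyP[srcS few]]; exists S; split=> //.
  by rewrite ltnNge; exact/negP.
apply: (prob_exists_set p01 (expR_ge0 _) nx_le).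
  by move=> S /and4P[].
move=> S /and4P[aS SX S0 Ss0].
apply: le_trans (prob_few_neighbours p01 _ aS aX SX) _.
rewrite /x -expRM_natl; apply: le_trans (ler_wpM2r (expR_ge0 _) (pow2_expR _ _)) _.
rewrite -expRD ler_expR natrM.
have Sp : #|S|%:R * p <= 1 by apply: le_trans s0p; rewrite ler_pM2r // ler_nat.
exact: (few_arith (ler0n _ _) (pow_onem_lb p01 Sp) X4 (ler0n _ _) mL tL).
Qed.

(** The exponent is at least [s c p^2 N / 32], that is [50 s c l]. It pays [2 s c l] for the choice
    of a matching with [s c] pairs and [2 s l] for the sum over [S]. *)
Lemma hit_arith (s w y N l c : R) : 0 <= s -> 1 <= c -> s * c * p ^+ 2 / 2 <= w ->
  N / 8 <= y -> 0 <= N -> 0 <= l ->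
  1600 * l <= N * p ^+ 2 -> s * c * 2 * l + - (q * w) * y <= s * - (2 * l).
Proof.
move=> s0' c1' sw Ny N0 l0 ml; have p0 := ltW p_gt0; have p4 := p_le4.
have sc : 0 <= s * c by rewrite mulr_ge0 //; lra.
have scp : 0 <= s * c * p ^+ 2 / 2 by rewrite divr_ge0 // mulr_ge0 // exprn_ge0.
have A : 1 / 2 * (s * c * p ^+ 2 / 2) * (N / 8) <= q * w * y.
  have h0 : (0 : R) <= 1 / 2 by lra.
  apply: ler_pM => //; [exact: mulr_ge0 | by rewrite divr_ge0 | apply: ler_pM => //].
  by lra.
have B : s * c * (1600 * l) <= s * c * (N * p ^+ 2) by exact: ler_wpM2l.
have C : s * l <= s * c * l by rewrite ler_wpM2r // ler_peMr.
have D : 0 <= s * c * l by exact: mulr_ge0.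
by lra.
Qed.

Lemma prob_not_matchings_hit X (V3 : {set 'I_n}) : a \notin X -> a \notin V3 -> [disjoint V3 & X] ->
  n%:R / 4 <= #|V3|%:R :> R -> (0 < c1)%N -> c1%:R * p <= 1 ->
  s0%:R * p <= 1 -> s0%:R <= n%:R / 8 :> R ->
  prob (fun G => ~ matchings_hit G a V3 c1 s0 X) <= 2 * expR (- L).
Proof.
move=> aX aV3 VX V4 c0 cp s0p s0n; rewrite -nxE.
apply: le_trans (_ : prob (fun G => exists S, source a s0 X S /\
  exists M, matching_in X (#|S| * c1) M /\
  forall t, t \in V3 :\: S -> ~~ (~~ sgraph_adj G t a && hits G M t)) <= _).
  apply: prob_le => // G /existsNP[S /existsNP[M /not_implyP[srcS /not_implyP[mM none]]]].
  exists S; split=> //; exists M; split=> // t; rewrite inE => /andP[tS tV].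
  by apply/negP => /andP[ta hM]; apply: none; exists t; rewrite adj_sym.
apply: (prob_exists_set p01 (expR_ge0 _) nx_le).
  by move=> S /and4P[].
move=> S /and4P[aS SX S0 Ss0].
have Sp : #|S|%:R * p <= 1 by apply: le_trans s0p; rewrite ler_pM2r // ler_nat.
apply: le_trans (prob_exists_seq p01 (k := #|S| * c1) (x :=
  expR (- (q * (1 - (1 - p ^+ 2) ^+ (#|S| * c1))) * #|V3 :\: S|%:R)) _ _ _) _.
- by move=> M /and3P[/eqP].
- exact: expR_ge0.
- move=> M mM; apply: (prob_no_far_hit p01 mM) => //.
    exact: disjointWl (subsetDl _ _) VX.
  by rewrite inE negb_and aV3 orbT.
rewrite natr_pow_expR // -expRD /x -expRM_natl ler_expR !natrM.
have p0 := ltW p_gt0; have p4 := p_le4.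
have p2 : 0 <= p ^+ 2 <= 1 by rewrite exprn_ge0 //= exprn_ile1 //; lra.
have Scp : (#|S| * c1)%:R * p ^+ 2 <= 1.
  by rewrite natrM expr2 mulrACA -[leRHS]mulr1 ler_pM // mulr_ge0.
have := pow_onem_lb p2 Scp; rewrite natrM => W.
apply: hit_arith W _ _ _ mL => //; first by rewrite ler1n.
  have : (#|V3| <= #|V3 :\: S| + #|S|)%N.
    by rewrite -(cardsID S V3) addnC leq_add2l subset_leq_card // subsetIr.
  rewrite -(ler_nat R) natrD; have : (#|S|%:R : R) <= s0%:R by rewrite ler_nat.
  by move: V4 s0n; lra.
by have := L2; lra.
Qed.

End SparseBounds.

Section LargeClosed.
Variables (R : realType) (n : nat) (p : R).
Local Open Scope ring_scope.
Local Notation graph := (sgraph 'I_n).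
Local Notation expect := (@expect R n p).
Local Notation prob := (@prob R n p).
Implicit Types (S T X Y : {set 'I_n}) (G : graph) (M : seq ('I_n * 'I_n)).
Variables (a : 'I_n) (V1 V2 V3 : {set 'I_n}) (c1 s0 tau : nat).
Hypothesis p01 : 0 <= p <= 1.
Hypothesis aV2 : a \notin V2.
Hypothesis V12 : [disjoint V1 & V2].
Hypothesis V23 : [disjoint V2 & V3].

Definition closed_part G T :=
  (T \subset far_part G a V3) && closed_in (far_part G a V3) (link G a V1) T.

Let cross : pred {set 'I_n} := fun e => [exists t in V3, star t V2 e].

Section Agree.
Variables (G G' : graph).
Hypothesis GG' : forall e, predC cross e -> (e \in edges G) = (e \in edges G').

Let adjE x y : x \notin V2 -> y \notin V2 -> sgraph_adj G x y = sgraph_adj G' x y.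
Proof.
move=> xV yV; apply: GG'; apply/negP => /exists_inP[t tV /exists_inP[u uV /eqP E]].
have : u \in [set x; y]%SET by rewrite E !inE eqxx orbT.
by rewrite !inE => /orP[]/eqP ux; move: uV; rewrite ux; apply/negP.
Qed.

Let V1n x : x \in V1 -> x \notin V2.
Proof. by move=> xV; rewrite (disjointFr V12 xV). Qed.

Let V3n x : x \in V3 -> x \notin V2.
Proof. by move=> xV; rewrite (disjointFl V23 xV). Qed.

Let linkE z w : z \in V3 -> w \in V3 -> link G a V1 z w = link G' a V1 z w.
Proof.
move=> /V3n zV /V3n wV; rewrite /link; apply: eq_existsb => x; apply: eq_existsb => y.
have [/V1n xV|//] := boolP (x \in V1); have [/V1n yV|//] := boolP (y \in V1).
by rewrite /nonadj !adjE.
Qed.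

Let farE : far_part G a V3 = far_part G' a V3.
Proof.
apply/setP => z; rewrite !inE; have [/V3n zV|//] := boolP (z \in V3).
by rewrite adjE.
Qed.

Lemma closed_part_agree T : T \subset V3 -> closed_part G T = closed_part G' T.
Proof.
move=> TV; apply: (congr2 andb (congr1 (fun A : {set 'I_n} => T \subset A) farE)).
apply: etrans (congr1 (fun A => closed_in A (link G' a V1) T) farE).
apply: eq_forallb_in => z zT; apply: eq_forallb_in => w; rewrite inE => /andP[wV _].
by rewrite linkE // (fintype.subsetP TV).
Qed.

Lemma closed_large_agree : closed_large G a V1 V3 s0 -> closed_large G' a V1 V3 s0.
Proof.
move=> cl S SF S0 Sc.
have SV : S \subset V3.
  by apply/fintype.subsetP => s /(fintype.subsetP SF); rewrite inE => /andP[].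
have /andP[SF' Sc'] : closed_part G S by rewrite closed_part_agree // /closed_part SF.
exact: cl.
Qed.

End Agree.

(** With [closed_large] built into the event, the bound of [count_closed] holds graph by graph, so
    it also bounds the expected number of sets [T] in [sum_F]. *)
Let F T G : bool := closed_part G T && `[< closed_large G a V1 V3 s0 >].

Let F_depends T : T \subset V3 -> depends (predC cross) (fun G => (F T G)%:R : R).
Proof.
move=> TV G G' GG'; apply: (congr1 (fun b : bool => b%:R)).
apply: (congr2 andb (closed_part_agree GG' TV)).
by apply/asboolP/asboolP; apply: closed_large_agree => // e /GG'.
Qed.

Let sum_F : \sum_(T : {set 'I_n} | (T \subset V3) && (tau <= #|T|)%N)
   expect (fun G => (F T G)%:R) <= 2 ^+ (n %/ s0.+1).
Proof.
rewrite -expect_sum; set N := leRHS; have -> : N = expect (fun=> N * 1).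
  by rewrite expectZ expect1 mulr1.
apply: (expect_le p01) => G /=; rewrite mulr1 -natr_sum /N -natrX ler_nat.
have [cl|ncl] := pselect (closed_large G a V1 V3 s0); last first.
  by rewrite big1 // => T _; rewrite /F (asboolF ncl) andbF.
have := count_closed (link_sym G a V1) cl; rewrite card_ord.
apply: leq_trans; rewrite -sum1_card big_mkcond [leqRHS]big_mkcond leq_sum // => T _.
rewrite inE /F -/(closed_part G T); case: (closed_part G T) => //=; last by case: ifP.
by case: ifP => // _; rewrite leq_b1.
Qed.

(* Whether [T] is closed does not depend on the edges between [V2] and [V3], while
   whether a vertex of [T] is hit by [M] depends only on them. *)
Lemma prob_not_large_closed_hit :
  prob (fun G => closed_large G a V1 V3 s0 /\ ~ large_closed_hit G a V1 V2 V3 c1 s0 tau) <=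
  n%:R ^+ (s0 * c1 * 2) * expR (- (1 - (1 - p ^+ 2) ^+ (s0 * c1)) * tau%:R) * 2 ^+ (n %/ s0.+1).
Proof.
set w := 1 - _; set x := expR _.
have w0 : 0 <= w.
  rewrite subr_ge0 exprn_ile1 // ?subr_ge0 ?gerBl ?exprn_ge0 ?exprn_ile1 //; by case/andP: p01.
apply: le_trans (_ : prob (fun G => exists T, ((T \subset V3) && (tau <= #|T|)%N) /\
  exists M, matching_in V2 (s0 * c1) M /\ (F T G /\ forall t, t \in T -> ~~ hits G M t)) <= _).
  apply: prob_le => // G [cl /existsNP[T /existsNP[M]]].
  move=> /not_implyP[TF /not_implyP[Tc /not_implyP[tT /not_implyP[mM none]]]].
  exists T; split.
    rewrite tT andbT; apply: fintype.subset_trans TF _.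
    by apply/fintype.subsetP => t; rewrite inE => /andP[].
  exists M; split=> //; split; first by rewrite /F /closed_part TF Tc; exact/asboolP.
  by move=> t tT'; apply/negP => hM; apply: none; exists t.
apply: le_trans (prob_exists p01 _ _) _.
apply: (@le_trans _ _ (\sum_(T : {set 'I_n} | (T \subset V3) && (tau <= #|T|)%N)
   n%:R ^+ (s0 * c1 * 2) * (x * expect (fun G => (F T G)%:R)))); last first.
  rewrite -mulr_sumr -mulr_sumr mulrA; apply: ler_wpM2l sum_F.
  by rewrite mulr_ge0 ?exprn_ge0 ?expR_ge0.
apply: ler_sum => T /andP[TV tT].
have EF : 0 <= expect (fun G => (F T G)%:R).
  by rewrite -prob_bool prob_ge0.
apply: (prob_exists_seq p01) => [M /and3P[/eqP]//||M mM].
  by rewrite mulr_ge0 ?expR_ge0.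
rewrite probE (expect_ext p (g := fun G => (F T G)%:R *
  (`[< forall t, t \in T -> ~~ hits G M t >])%:R)); last first.
  move=> G; rewrite -natrM mulnb; congr (nat_of_bool _)%:R.
  by apply/asboolP/andP => [[-> /asboolP->]|[-> /asboolP]].
rewrite (expectM p (A := predC cross)); last first.
- move=> G G' GG'; congr (nat_of_bool _)%:R.
  have E t : t \in T -> hits G M t = hits G' M t.
    move=> tT'; have /eqP : ((hits G M t)%:R : R) = (hits G' M t)%:R.
      apply: (hits_depends R mM) => e es; apply: GG'; rewrite /= negbK.
      by apply/exists_inP; exists t => //; exact: (fintype.subsetP TV).
    by rewrite eqr_nat; case: (hits G M t); case: (hits G' M t).
  by apply/asboolP/asboolP => none t tT'; have := none t tT'; rewrite E.
- exact: F_depends.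
rewrite mulrC; apply: ler_wpM2r => //; rewrite -probE.
apply: le_trans (prob_no_hit p01 mM _) _; first by rewrite disjoint_sym (disjointWr TV).
by rewrite ler_expR -/w; have : (tau%:R : R) <= #|T|%:R; [rewrite ler_nat|nra].
Qed.

End LargeClosed.

Lemma card_interval (n l d : nat) : (l + d < n)%N ->
  (d <= #|[set i : 'I_n | (l < i <= l + d)%N]|)%N.
Proof.
move=> ldn; have lt (i : 'I_d) : (l + i.+1 < n)%N.
  by apply: leq_ltn_trans ldn; rewrite leq_add2l.
rewrite -[leqLHS]card_ord -(card_imset (f := fun i : 'I_d => Ordinal (lt i))) //.
  apply/subset_leq_card/fintype.subsetP => i /imsetP[j _ ->]; rewrite inE /=.
  by have := ltn_ord j; lia.
by move=> i j /(congr1 val) /= /eqP; rewrite eqn_add2l eqSS => /eqP/val_inj.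
Qed.

Section SparseBoundsPattern.
Variables (R : realType) (n : nat) (p : R).
Local Open Scope ring_scope.
Local Notation graph := (sgraph 'I_n).
Local Notation expect := (@expect R n p).
Local Notation prob := (@prob R n p).
Local Notation q := (1 - p).
Local Notation L := (ln (n%:R : R)).
Implicit Types (S T X Y : {set 'I_n}) (G : graph) (M : seq ('I_n * 'I_n)).

Lemma prob_exists_card (I : finType) (C : pred I) (P : I -> graph -> Prop) (x : R) :
  0 <= p <= 1 -> 0 <= x -> (forall i, C i -> prob (P i) <= x) ->
  prob (fun G => exists i, C i /\ P i G) <= #|I|%:R * x.
Proof.
move=> p01 x0 Cx; apply: le_trans (prob_exists p01 _ _) _.
apply: (@le_trans _ _ (\sum_(i | C i) x)); first by apply: ler_sum => i /Cx.
by rewrite sumr_const -[leLHS]mulr_natl ler_wpM2r // ler_nat max_card.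
Qed.

Variables (a : 'I_n) (c1 s0 : nat) (V1 V2 V3 : {set 'I_n}).

Hypothesis n_gt0 : (0 < n)%N.
Hypothesis p_gt0 : 0 < p.
Hypothesis p_le4 : p <= 1 / 4.
Hypothesis mL : 1600 * L <= n%:R * p ^+ 2.
Hypothesis L2 : 2 <= L.
Hypothesis V1_n : n%:R / 4 <= #|V1|%:R :> R.
Hypothesis V3_n : n%:R / 4 <= #|V3|%:R :> R.
Hypothesis aV1 : a \notin V1.
Hypothesis aV2 : a \notin V2.
Hypothesis aV3 : a \notin V3.
Hypothesis V12 : [disjoint V1 & V2].
Hypothesis V13 : [disjoint V1 & V3].
Hypothesis V23 : [disjoint V2 & V3].

Let p01 : 0 <= p <= 1.
Proof. by apply/andP; split; have := p_gt0; have := p_le4; lra. Qed.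

Let p2_le : p ^+ 2 <= p / 4.
Proof. by rewrite expr2; have := p_gt0; have := p_le4; nra. Qed.

Let n_ge : 100 * L <= n%:R.
Proof.
have p2 : p ^+ 2 <= 1 / 16 by have := p2_le; have := p_le4; lra.
have : n%:R * p ^+ 2 <= n%:R * (1 / 16) by exact: ler_wpM2l.
by have := mL; have := L2; lra.
Qed.

Let npL : 1600 * L <= n%:R * p.
Proof.
have : n%:R * p ^+ 2 <= n%:R * (p / 4) by apply: ler_wpM2l p2_le.
by have := mL; have := L2; lra.
Qed.

Lemma card_rem_ge Y (v : 'I_n) : n%:R / 4 <= #|Y|%:R :> R -> n%:R / 8 <= #|Y :\ v|%:R :> R.
Proof.
move=> Y4; have : (#|Y| <= #|Y :\ v| + 1)%N by rewrite (cardsD1 v Y) addnC leq_add2l leq_b1.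
by rewrite -(ler_nat R) natrD; have := n_ge; have := L2; move: Y4; lra.
Qed.

Lemma prob_no_far_neighbour :
  prob (fun G => ~ forall v, v != a ->
    exists z, [/\ z \in V3, z != v, sgraph_adj G v z & ~~ sgraph_adj G a z]) <= expR (- L).
Proof.
apply: le_trans (_ : prob (fun G => exists v, v != a /\
   forall z, z \in V3 :\ v -> ~~ pattern G [set v]%SET [set a]%SET z) <= _).
  apply: prob_le => // G /existsNP[v /not_implyP[va none]]; exists v; split=> // z.
  rewrite !inE => /andP[zv zV]; apply/negP => /andP[/forall_inP av /forall_inP aa].
  apply: none; exists z; rewrite adj_sym av ?inE // adj_sym; split=> //.
  by apply: aa; rewrite inE.
apply: le_trans (prob_exists_card (x := expR (- (100 * L))) p01 (expR_ge0 _) _) _.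
  move=> v va; apply: le_trans (prob_no_pattern p01 _ _) _.
  - apply/pred0P => z /=; rewrite !inE; apply/negP => /andP[/andP[zv zV]].
    rewrite (negPf zv) /= => /eqP za; by move: aV3; rewrite -za zV.
  - by rewrite disjoints1 inE.
  rewrite !cards1 !expr1 ler_expR mulNr lerN2.
  have Y8 := card_rem_ge v V3_n; have p0 := ltW p_gt0; have p4 := p_le4.
  have : p * (1 / 2) * (n%:R / 8) <= p * q * #|V3 :\ v|%:R.
    apply: ler_pM => //; first by rewrite mulr_ge0.
    by apply: ler_wpM2l => //; lra.
  by have := npL; have := L2; lra.
rewrite card_ord [X in X * _](natr_expR R n_gt0) -expRD ler_expR.
by have := L2; lra.
Qed.

Lemma prob_no_separating_neighbour :
  prob (fun G => ~ forall v z, v != a -> z \in V3 -> z != v ->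
    exists y, [/\ y \in V1, y != v, sgraph_adj G a y, sgraph_adj G z y & ~~ sgraph_adj G v y])
  <= expR (- L).
Proof.
apply: le_trans (_ : prob (fun G => exists vz : 'I_n * 'I_n,
   [&& vz.1 != a, vz.2 \in V3 & vz.2 != vz.1] /\
   forall y, y \in V1 :\ vz.1 -> ~~ pattern G [set a; vz.2]%SET [set vz.1]%SET y) <= _).
  apply: prob_le => // G /existsNP[v /existsNP[z]].
  move=> /not_implyP[va /not_implyP[zV /not_implyP[zv none]]].
  exists (v, z); split=> [|y /=]; first by rewrite /= va zV zv.
  rewrite !inE => /andP[yv yV]; apply/negP => /andP[/forall_inP av /forall_inP vy].
  apply: none; exists y; rewrite (adj_sym G a) (adj_sym G z) (adj_sym G v).
  by split=> //; [apply: av | apply: av | apply: vy]; rewrite !inE eqxx ?orbT.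
apply: le_trans (prob_exists_card (x := expR (- (100 * L))) p01 (expR_ge0 _) _) _.
  move=> [v z] /= /and3P[va zV zv]; apply: le_trans (prob_no_pattern p01 _ _) _.
  - apply/pred0P => y /=; rewrite !inE; apply/negP => /andP[/andP[yv yV]].
    rewrite (negPf yv) orbF => /orP[]/eqP E; first by move: aV1; rewrite -E yV.
    by rewrite E (disjointFl V13 zV) in yV.
  - by rewrite disjoint_sym disjoints1 !inE negb_or va eq_sym zv.
  have az : a != z by apply: contraNneq aV3 => ->.
  rewrite cards2 az !cards1 expr1 ler_expR mulNr lerN2.
  have Y8 := card_rem_ge v V1_n; have p0 := ltW p_gt0; have p4 := p_le4.
  have p2 : 0 <= p ^+ 2 by exact: exprn_ge0.
  have : p ^+ 2 * (1 / 2) * (n%:R / 8) <= p ^+ 2 * q * #|V1 :\ v|%:R.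
    apply: ler_pM => //; first by rewrite mulr_ge0.
    by apply: ler_wpM2l => //; lra.
  by have := mL; have := L2; lra.
rewrite card_prod card_ord natrM [X in X * X * _](natr_expR R n_gt0) -!expRD ler_expR.
by have := L2; lra.
Qed.

Lemma prob_small_far_part tau : tau%:R <= n%:R / 32 :> R ->
  prob (fun G => (#|far_part G a V3| < tau)%N) <= expR (- L).
Proof.
move=> tn; apply: le_trans (_ : prob (fun G =>
   (#|[set y in V3 | pattern G finset.set0 [set a]%SET y]| < tau)%N) <= _).
  apply: prob_le => // G; apply: leq_ltn_trans; apply: subset_leq_card.
  apply/fintype.subsetP => y; rewrite !inE => /andP[-> /andP[_ /forall_inP ya]].
  by rewrite adj_sym ya // inE.
apply: le_trans (prob_few_patterns p01 _ _ _) _.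
- by rewrite finset.set0U disjoint_sym disjoints1.
- by rewrite disjoint_sym disjoints1 inE.
rewrite cards0 expr0 cards1 expr1 mul1r.
apply: le_trans (ler_wpM2r (expR_ge0 _) (pow2_expR _ _)) _.
rewrite -expRD ler_expR.
have : 3 / 8 * (n%:R / 4) <= q / 2 * #|V3|%:R.
  by apply: ler_pM => //; have := p_le4; lra.
by have := n_ge; have := L2; move: tn; lra.
Qed.

Lemma prob_not_large_closed_hit_le tau : n%:R / 128 <= tau%:R :> R ->
  64 * 64 <= c1%:R :> R -> c1%:R * p <= 1 -> s0%:R * p <= 1 -> 1 / 2 <= s0%:R * p ->
  1 <= (s0.+1)%:R * p ->
  prob (fun G => closed_large G a V1 V3 s0 /\ ~ large_closed_hit G a V1 V2 V3 c1 s0 tau) <=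
  expR (- L).
Proof.
move=> tn c4 cp sp sp2 Sp; apply: le_trans (prob_not_large_closed_hit c1 s0 tau p01 aV2 V12 V23) _.
have p0 := ltW p_gt0; have p4 := p_le4.
have p2 : 0 <= p ^+ 2 <= 1 by rewrite exprn_ge0 //= exprn_ile1 //; lra.
have kp : (s0 * c1)%:R * p ^+ 2 <= 1.
  by rewrite natrM expr2 mulrACA -[leRHS]mulr1 ler_pM // mulr_ge0.
have W := pow_onem_lb p2 kp; set w := 1 - _ in W *.
have jp : (n %/ s0.+1)%:R <= n%:R * p.
  have : (n %/ s0.+1 * s0.+1 <= n)%N by exact: leq_divM.
  rewrite -(ler_nat R) natrM => J; apply: le_trans (ler_wpM2r p0 J); rewrite -mulrA.
  by rewrite -[leLHS]mulr1 ler_wpM2l.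
apply: le_trans (ler_wpM2l _ (pow2_expR _ _)) _; first by rewrite mulr_ge0 ?exprn_ge0 ?expR_ge0.
rewrite natr_pow_expR // -!expRD ler_expR natrM.
(* Half of the exponent [s0 c1 p^2 n / 256] pays, through 1600, for the choice of the matching and
   for the final factor; the other half pays, through [c1 >= 64 * 64] and [s0 p >= 1 / 2], for the
   at most [2 ^ (n p)] closed sets. *)
have A : (s0 * c1)%:R * p ^+ 2 / 2 * (n%:R / 128) <= w * tau%:R.
  by apply: ler_pM => //; rewrite ?divr_ge0 // mulr_ge0 //; case/andP: p2.
have B : (s0 * c1)%:R * (1600 * L) <= (s0 * c1)%:R * (n%:R * p ^+ 2) by exact: ler_wpM2l.
have C : 1 / 2 * (64 * 64 * (n%:R * p)) <= s0%:R * p * (c1%:R * (n%:R * p)).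
  by apply: ler_pM => //; rewrite ?ler_wpM2r ?mulr_ge0 //; lra.
have D : L <= (s0 * c1)%:R * L.
  rewrite ler_peMl //; first by have := L2; lra.
  rewrite ler1n muln_gt0; apply/andP; split; rewrite lt0n; apply/negP => /eqP E.
    by move: sp2; rewrite E mul0r; lra.
  by move: c4; rewrite E; lra.
move: A B C D; rewrite natrM; have := npL; have := L2; have := jp; set l := L.
set j := (_ %/ _)%:R; set N := n%:R; set s := s0%:R; set c := c1%:R; set t := tau%:R.
by lra.
Qed.

End SparseBoundsPattern.

(** * The sparse and the dense regimes *)

Section SparseRegime.
Variables (R : realType) (n : nat) (p : R).
Local Open Scope ring_scope.
Local Notation prob := (@prob R n p).
Local Notation L := (ln (n%:R : R)).

Lemma prob_or_le (P Q : sgraph 'I_n -> Prop) (x y : R) : 0 <= p <= 1 ->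
  prob P <= x -> prob Q <= y -> prob (fun G => P G \/ Q G) <= x + y.
Proof. by move=> p01 Px Qy; apply: le_trans (prob_or p01 P Q) _; exact: lerD. Qed.

Lemma prob_not_cfs_sparse (c1 : nat) : 0 < p -> 64 * 64 <= c1%:R :> R -> c1%:R * p <= 1 ->
  1600 * L <= n%:R * p ^+ 2 -> 2 <= L -> c1%:R <= L ->
  prob (fun G => ~ cfs G) <= 13 * expR (- L).
Proof.
move=> p0 c4 cp mL L2 cL.
have n0 : (0 < n)%N by rewrite lt0n; apply/negP => /eqP n0; move: L2; rewrite n0 ln0 //; lra.
have p4 : p <= 1 / 4 by nra.
have p01 : 0 <= p <= 1 by apply/andP; split; lra.
have nL : 100 * L <= n%:R.
  have p2 : p ^+ 2 <= 1 / 16 by rewrite expr2; nra.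
  have : n%:R * p ^+ 2 <= n%:R * (1 / 16) by exact: ler_wpM2l.
  by lra.
have c0 : (0 < c1)%N by rewrite lt0n; apply/negP => /eqP E; move: c4; rewrite E; lra.
have Vp0 : 0 <= p^-1 by rewrite invr_ge0 ltW.
(* [1 / p] is the limit of linear expansion: [1 - (1 - p) ^+ s >= s p / 2] requires [s p <= 1]. *)
pose s0 := Num.truncn p^-1; have /andP[s0l s0u] := truncn_itv Vp0.
rewrite -/s0 in s0l s0u.
have pV : p^-1 * p = 1 by rewrite mulVf // gt_eqF.
have s0p : s0%:R * p <= 1 by rewrite -[leRHS]pV ler_pM2r.
have Sp : 1 <= (s0.+1)%:R * p by rewrite -[leLHS]pV ler_pM2r // ltW.
have pV1 : 1 <= p^-1 by rewrite invf_ge1 //; lra.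
have s0_gt0 : (0 < s0)%N by rewrite truncn_gt_nat.
have s0p2 : 1 / 2 <= s0%:R * p.
  have : (s0.+1)%:R <= 2 * s0%:R :> R by rewrite -natrM ler_nat mul2n -addnn -addn1 leq_add2l.
  by move=> /(ler_wpM2r (ltW p0)); lra.
have s0n : s0%:R <= n%:R / 8 :> R.
  apply: le_trans s0l _; rewrite -(ler_pM2r (_ : 0 < p * p)) ?mulr_gt0 // mulrA pV.
  by move: mL; rewrite expr2; lra.
pose kappa := (Num.truncn (4 * L)).+2.
have /andP[kl ku] : 4 * L + 1 <= kappa%:R <= 4 * L + 2.
  have L0 : 0 <= 4 * L by lra.
  by have /andP[] := truncn_itv L0; rewrite /kappa -!natr1; lra.
have tL : (c1 * 2 + kappa)%:R <= 98 * L by rewrite natrD natrM; lra.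
have nn : (100 <= n)%N by rewrite -(ler_nat R); lra.
pose tau := (n %/ 64)%N; have [t1 t2] : (tau * 2 * 32 <= n)%N /\ (n <= tau * 128)%N.
  by rewrite /tau; move: nn; clear; lia.
have tau_gt0 : (0 < tau)%N by move: t2 nn; clear; lia.
pose d := (n.-1 %/ 3)%N; have [d1 d2] : (d * 2 + d < n)%N /\ (n <= d * 4)%N.
  by rewrite /d; move: nn; clear; lia.
pose a := Ordinal n0.
pose V1 : {set 'I_n} := [set i : 'I_n | (0 < i <= 0 + d)%N].
pose V2 : {set 'I_n} := [set i : 'I_n | (d < i <= d + d)%N].
pose V3 : {set 'I_n} := [set i : 'I_n | (d * 2 < i)%N].
have aV1 : a \notin V1 by rewrite inE.
have aV2 : a \notin V2 by rewrite inE.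
have aV3 : a \notin V3 by rewrite inE.
have V12 : [disjoint V1 & V2].
  by apply/pred0P => i; rewrite /= !inE; apply/negP; clear; lia.
have V13 : [disjoint V1 & V3].
  by apply/pred0P => i; rewrite /= !inE; apply/negP; clear; lia.
have V23 : [disjoint V2 & V3].
  by apply/pred0P => i; rewrite /= !inE; apply/negP; clear; lia.
have V_cover v : v != a -> [|| v \in V1, v \in V2 | v \in V3].
  rewrite -val_eqE /= !inE; move: (nat_of_ord v) => i; clear; lia.
have nd (X : {set 'I_n}) : (d <= #|X|)%N -> n%:R / 4 <= #|X|%:R :> R.
  move=> dX; have : (n <= #|X| * 4)%N by apply: leq_trans d2 _; rewrite leq_mul2r dX orbT.
  by clear; rewrite -(ler_nat R) natrM; lra.
have V1n : n%:R / 4 <= #|V1|%:R :> R by apply/nd/card_interval; move: d1; clear; lia.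
have V2n : n%:R / 4 <= #|V2|%:R :> R by apply/nd/card_interval; move: d1; clear; lia.
have V3n : n%:R / 4 <= #|V3|%:R :> R.
  apply/nd; apply: leq_trans (card_interval d1) _; apply/subset_leq_card/fintype.subsetP => i.
  by rewrite !inE => /andP[].
have tn : (tau * 2)%:R <= n%:R / 32 :> R by move: t1; clear; rewrite -(ler_nat R) natrM; lra.
have tn' : n%:R / 128 <= tau%:R :> R by move: t2; clear; rewrite -(ler_nat R) natrM; lra.
have B1 := prob_not_clique_free_le n0 p0 p4 L2 kl.
have B2 := prob_few_many_neighbours n0 p0 p4 mL L2 aV1 V1n s0p tL.
have B3 := prob_few_many_neighbours n0 p0 p4 mL L2 aV2 V2n s0p tL.
have V31 : [disjoint V3 & V1] by rewrite disjoint_sym.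
have V32 : [disjoint V3 & V2] by rewrite disjoint_sym.
have B4 := prob_not_matchings_hit n0 p0 p4 mL L2 aV1 aV3 V31 V3n c0 cp s0p s0n.
have B5 := prob_not_matchings_hit n0 p0 p4 mL L2 aV2 aV3 V32 V3n c0 cp s0p s0n.
have B6 := prob_not_large_closed_hit_le n0 p0 p4 mL L2 aV2 V12 V23 tn' c4 cp s0p s0p2 Sp.
have B7 := prob_small_far_part p0 p4 mL L2 V3n aV3 tn.
have B8 := prob_no_far_neighbour n0 p0 p4 mL L2 V3n aV3.
have B9 := prob_no_separating_neighbour n0 p0 p4 mL L2 V1n aV1 aV3 V13.
have E (z : R) : 13 * z = z + (2 * z + (2 * z + (2 * z + (2 * z + (z + (z + (z + z))))))).
  by ring.
rewrite E; apply: le_trans (prob_or_le p01 B1 (prob_or_le p01 B2 (prob_or_le p01 B3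
  (prob_or_le p01 B4 (prob_or_le p01 B5 (prob_or_le p01 B6 (prob_or_le p01 B7
  (prob_or_le p01 B8 B9)))))))).
apply: prob_le => // G; apply: contra_notP.
move=> /not_orP[/contrapT H1 /not_orP[/contrapT H2 /not_orP[/contrapT H3 /not_orP[/contrapT H4]]]].
move=> /not_orP[/contrapT H5 /not_orP[H6 /not_orP[H7 /not_orP[/contrapT H8 /contrapT H9]]]].
have cl : closed_large G a V1 V3 s0 by exact: closed_largeP H2 H4.
have lch : large_closed_hit G a V1 V2 V3 c1 s0 tau by apply: contrapT => h; exact: H6.
apply: (sparse_cfs H1 V_cover aV3 V12 V13 V23 s0_gt0 H2 H3 H4 H5 lch tau_gt0 _ H8 H9).
by rewrite leqNgt; exact/negP.
Qed.

End SparseRegime.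

Lemma card_sets_le n (C : pred {set 'I_n}) : (#|C| <= 2 ^ n)%N.
Proof.
rewrite -[n in leqRHS]card_ord -cardsT -card_powerset.
by apply/subset_leq_card/fintype.subsetP => S _; rewrite powersetE finset.subsetT.
Qed.

(** * Dense graphs and connectedness of the complement *)

Section DenseRegime.
Variables (R : realType) (n : nat) (p : R).
Local Open Scope ring_scope.
Hypothesis p01 : 0 <= p <= 1.
Local Notation prob := (@prob R n p).
Local Notation q := (1 - p).
Local Notation L := (ln (n%:R : R)).
Implicit Types (G : sgraph 'I_n) (S : {set 'I_n}).

Lemma pow_expR k : p ^+ k <= expR (- (q * k%:R)).
Proof.
rewrite -mulNr mulrC expRM_natl lerXn2r ?nnegrE ?expR_ge0 //; first by case/andP: p01.
by have := @expR_ge1Dx R (- q); lra.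
Qed.

Lemma bin_le_expR k : 'C(n, k)%:R <= expR n%:R :> R.
Proof.
apply: le_trans (pow2_expR R n); rewrite -natrX ler_nat -[n in leqLHS]card_ord -card_draws.
exact: card_sets_le.
Qed.

Definition common_nonadj G := forall a b c, exists x y,
  [/\ nonadj G x y, sgraph_adj G a x && sgraph_adj G a y, sgraph_adj G b x && sgraph_adj G b y
    & sgraph_adj G c x && sgraph_adj G c y].

(** With [th] about [2 g n], any three vertices have [th] common neighbours and no [th] vertices
    form a clique. The latter survives [1 - p] of order [log n / n]: there are at most [expR n]
    candidates, and [q th (th - 1) / 2 >= L g^2 n / 2 >= 2 n]. *)
Lemma prob_not_common_nonadj (g : R) : 0 < g -> 16 * g <= p ^+ 3 -> 6 <= n%:R :> R ->
  2 <= L -> 2 * L <= g * n%:R -> L <= q * n%:R -> 4 <= L * g ^+ 2 -> L <= n%:R ->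
  prob (fun G => ~ common_nonadj G) <= 2 * expR (- L).
Proof.
move=> g0 gp n6 L2 gL qL g2L Ln.
have n0 : (0 < n)%N by rewrite lt0n; apply/negP => /eqP E; move: n6; rewrite E; lra.
have gn0 : 0 <= 2 * g * n%:R by lra.
pose th := Num.truncn (2 * g * n%:R); have /andP[th1 th2] := truncn_itv gn0.
rewrite -/th -natr1 in th1 th2.
have q0 : 0 <= q by case/andP: p01; lra.
have B1 : prob (fun G => ~ clique_free G th) <= expR (- L).
  apply: le_trans (prob_not_clique_free n p01 th) _.
  apply: le_trans (ler_pM _ _ (bin_le_expR th) (pow_expR _)) _ => //.
    by rewrite exprn_ge0 //; case/andP: p01.
  rewrite -expRD ler_expR bin2_natr.
  have A : (g * n%:R) * (g * n%:R) <= th%:R * (th%:R - 1) by apply: ler_pM; lra.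
  have B : L * (g * (g * n%:R)) <= q * n%:R * (g * (g * n%:R)).
    by apply: ler_wpM2r qL; rewrite !mulr_ge0 // ltW.
  have C : q * ((g * n%:R) * (g * n%:R)) <= q * (th%:R * (th%:R - 1)) by exact: ler_wpM2l.
  have D : 4 * n%:R <= L * g ^+ 2 * n%:R by exact: ler_wpM2r.
  by lra.
have B2 : prob (fun G => exists abc : 'I_n * 'I_n * 'I_n, true /\
    let A := [set abc.1.1; abc.1.2; abc.2]%SET in
    (#|[set y in ~: A | pattern G A finset.set0 y]| < th)%N) <= expR (- L).
  apply: le_trans (prob_exists_card (x := expR (- (4 * L))) p01 (expR_ge0 _) _) _.
    move=> [[a b] c] _ /=; set A := [set a; b; c]%SET.
    have A3 : (#|A| <= 3)%N by apply: leq_trans (leq_card_setU _ _) _; rewrite cards1 cards2; case: eqP.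
    apply: le_trans (prob_few_patterns p01 _ _ _) _.
    - by rewrite finset.setU0 -finset.setI_eq0 finset.setIC finset.setICr.
    - by rewrite disjoint_sym; apply/pred0P => y; rewrite /= inE.
    rewrite cards0 expr0 mulr1.
    apply: le_trans (ler_wpM2r (expR_ge0 _) (pow2_expR _ _)) _.
    rewrite -expRD ler_expR.
    have Ac : n%:R - 3 <= #|~: A|%:R :> R.
      have : (n <= #|~: A| + 3)%N by rewrite -[leqLHS](card_ord n) -(cardsC A) addnC leq_add2l.
      by rewrite -(ler_nat R) natrD; lra.
    have p3 : p ^+ 3 <= p ^+ #|A| by case/andP: p01 => ? ?; rewrite ler_wiXn2l.
    have : 8 * g * (n%:R / 2) <= p ^+ #|A| / 2 * #|~: A|%:R by apply: ler_pM; lra.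
    by lra.
  rewrite !card_prod card_ord !natrM [X in X * X * X * _](natr_expR R n0) -!expRD ler_expR.
  lra.
have := prob_or_le p01 B1 B2; set B := (_ + _) => HB.
have -> : 2 * expR (- L) = B by rewrite /B; lra.
apply: le_trans (prob_le p01 _) HB => G; apply: contra_notP => /not_orP[/contrapT cf none] a b c.
set A := [set a; b; c]%SET; set Y := [set y in ~: A | pattern G A finset.set0 y].
have /cf[x [y [xY yY xy nxy]]] : (th <= #|Y|)%N.
  by rewrite leqNgt; apply/negP => few; apply: none; exists (a, b, c).
have PY u z : z \in Y -> u \in A -> sgraph_adj G u z.
  by rewrite inE => /andP[_ /andP[/forall_inP h _]] uA; rewrite adj_sym h.
exists x, y; split; first by rewrite /nonadj xy nxy.
- by rewrite !PY // !inE eqxx.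
- by rewrite !PY // !inE eqxx orbT.
- by rewrite !PY // !inE eqxx orbT.
Qed.

(** For [S] up to [eps n / 4] each element contributes a factor [n] to the power [- (1 + eps / 2)],
    because [(1 + eps) (1 - eps / 4) >= 1 + eps / 2] when [eps <= 1]. For larger [S] the bound [y]
    is small enough to beat the [2 ^ n] choices. *)
Lemma prob_not_connected_le (eps : R) : 0 < eps <= 1 -> (1 + eps) * L <= q * n%:R ->
  16 <= eps * L -> L <= n%:R ->
  prob (fun G => ~ forall s t, connect (nonadj G) s t) <= 3 * expR (- (eps / 2 * L)).
Proof.
move=> /andP[e0 e1] qL eL Ln.
have L0 : 0 < L by rewrite -(pmulr_rgt0 _ e0); lra.
have L16 : 16 <= L by have := ler_wpM2r (ltW L0) e1; lra.
have n0 : (0 < n)%N by rewrite lt0n; apply/negP => /eqP E; move: L16; rewrite E ln0 //; lra.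
have q0 : 0 <= q by case/andP: p01; lra.
pose x := expR (- ((1 + eps / 2) * L)); pose y := expR (- (eps / 8 * L * n%:R)).
have nxE : n%:R * x = expR (- (eps / 2 * L)).
  by rewrite [X in X * _](natr_expR R n0) /x -expRD; congr expR; lra.
have nx2 : n%:R * x <= 1 / 2.
  rewrite nxE; set u := eps / 2 * L; have u1 : 1 <= u by rewrite /u; lra.
  have A := @expR_ge1Dx R u; have B := @expRxMexpNx_1 R u; have := expR_ge0 (- u).
  by nra.
apply: le_trans (prob_not_connected n p01) _.
apply: (@le_trans _ _ (\sum_(S : {set 'I_n} | (0 < #|S|)%N && (#|S| * 2 <= n)%N) (x ^+ #|S| + y))).
  apply: ler_sum => S /andP[S0 S2]; apply: le_trans (pow_expR _) _.
  have sn : (#|S| <= n)%N by apply: leq_trans S2; rewrite leq_pmulr.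
  rewrite natrM natrB //; move: S2; rewrite -(ler_nat R) natrM; set s := #|S|%:R => S2.
  have s0 : 0 <= s by exact: ler0n.
  have [sd|sd] := leP s (eps / 4 * n%:R).
    apply: (@le_trans _ _ (x ^+ #|S|)); last by rewrite lerDl expR_ge0.
    rewrite /x -expRM_natl ler_expR -/s mulrN lerN2.
    have A : q * s * ((1 - eps / 4) * n%:R) <= q * s * (n%:R - s).
      by apply: ler_wpM2l; rewrite ?mulr_ge0 //; lra.
    have e4 : 0 <= s * (1 - eps / 4) by rewrite mulr_ge0 //; lra.
    have B := ler_wpM2l e4 qL.
    have C : 0 <= s * L * (eps * (1 - eps)) by rewrite !mulr_ge0 //; lra.
    by lra.
  apply: (@le_trans _ _ y); last by rewrite lerDr exprn_ge0 // expR_ge0.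
  rewrite /y ler_expR lerN2.
  have A : eps / 4 * n%:R * (n%:R / 2) <= s * (n%:R - s).
    by apply: ler_pM; rewrite ?mulr_ge0 //; lra.
  have B := ler_wpM2l q0 A.
  have e8 : 0 <= eps / 8 * n%:R by rewrite mulr_ge0 //; lra.
  have C := ler_wpM2l e8 qL.
  have D : 0 <= eps / 8 * n%:R * (eps * L) by rewrite mulr_ge0 //; lra.
  by lra.
rewrite big_split /=.
have S1 : \sum_(S : {set 'I_n} | (0 < #|S|)%N && (#|S| * 2 <= n)%N) x ^+ #|S| <= 2 * (n%:R * x).
  apply: le_trans (sum_sets_pow (expR_ge0 _) nx2).
  rewrite [leRHS](bigID (fun S : {set 'I_n} => (#|S| * 2 <= n)%N)) /= lerDl.
  by apply: sumr_ge0 => S _; rewrite exprn_ge0 // expR_ge0.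
have S2 : \sum_(S : {set 'I_n} | (0 < #|S|)%N && (#|S| * 2 <= n)%N) y <= expR (- (eps / 2 * L)).
  rewrite sumr_const -[leLHS]mulr_natl.
  apply: (@le_trans _ _ (expR n%:R * y)).
    apply: ler_wpM2r; first exact: expR_ge0.
    apply: le_trans (pow2_expR R n); rewrite -natrX ler_nat.
    exact: card_sets_le.
  rewrite /y -expRD ler_expR.
  have A : 16 * n%:R <= eps * L * n%:R by exact: ler_wpM2r.
  have B : eps * L <= 1 * L by apply: ler_wpM2r => //; lra.
  by lra.
by rewrite -nxE in S2 *; lra.
Qed.

End DenseRegime.

(** * Assembling the two regimes *)

Section Asymptotics.
Variable R : realType.
Local Open Scope ring_scope.

Lemma ln_half_sqr (n : nat) : (0 < n)%N -> ln (n%:R : R) ^+ 2 / 4 <= n%:R.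
Proof.
move=> n0; set l := ln _.
have [l0|l0] := leP 0 l; last first.
  have n1 : 1 <= (n%:R : R) by rewrite ler1n.
  by have := ln_ge0 n1; rewrite -/l leNgt l0.
have E : (n%:R : R) = expR (l / 2) ^+ 2.
  by rewrite [LHS](natr_expR R n0) -expRM_natl -/l; congr expR; lra.
rewrite E; have := @expR_ge1Dx R (l / 2); rewrite !expr2 => H; nra.
Qed.

Lemma prob_racg_le (n c1 : nat) (p eps : R) :
  64 * 64 <= c1%:R :> R -> 0 < p < 1 -> 0 < eps <= 1 ->
  Num.sqrt (1600 * ln n%:R / n%:R) <= p <= 1 - (1 + eps) * ln n%:R / n%:R ->
  16 / eps + c1%:R + 64 * 16 * c1%:R ^+ 6 <= ln (n%:R : R) ->
  prob p (fun Gam : sgraph 'I_n => ~ (thick_exactly_one (racg Gam) /\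
     quadratic_divergence R (racg Gam))) <= 18 * expR (- (eps / 2 * ln n%:R)).
Proof.
set L := ln _ => c4 /andP[p0 p1] /andP[e0 e1] /andP[pl pu] HL.
have c1_gt0 : 0 < c1%:R :> R by lra.
have e16 : 0 < 16 / eps by rewrite divr_gt0.
have c6 : 0 < c1%:R ^+ 6 :> R by exact: exprn_gt0.
have L1 : 64 * 64 <= L by lra.
have n0 : (0 < n)%N by rewrite lt0n; apply/negP => /eqP E; move: L1; rewrite /L E ln0 //; lra.
have N0 : 0 < n%:R :> R by rewrite ltr0n.
have p01 : 0 <= p <= 1 by rewrite !ltW.
have Ln : L <= n%:R.
  by apply: le_trans (ln_half_sqr n0); rewrite -/L expr2; nra.
have eL : 16 <= eps * L.
  have : eps * (16 / eps) <= eps * L by apply: ler_wpM2l; [exact: ltW | lra].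
  by rewrite mulrCA divff ?mulr1 // gt_eqF.
have qL : (1 + eps) * L <= (1 - p) * n%:R.
  by rewrite -ler_pdivrMr //; lra.
have mL : 1600 * L <= n%:R * p ^+ 2.
  have h0 : 0 <= 1600 * L / n%:R by apply: divr_ge0; [move: L1; clear; lra | exact: ltW].
  have : Num.sqrt (1600 * L / n%:R) ^+ 2 <= p ^+ 2.
    by apply: lerXn2r; rewrite ?nnegrE ?sqrtr_ge0 ?(ltW p0).
  by rewrite sqr_sqrtr // ler_pdivrMr // [p ^+ 2 * _]mulrC.
have e01 : 0 < eps <= 1 by rewrite e0.
have BC := prob_not_connected_le p01 e01 qL eL Ln.
have LE : expR (- L) <= expR (- (eps / 2 * L)) by rewrite ler_expR; nra.
have n2 : (1 < n)%N by rewrite -(ltr_nat R); lra.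
have L2 : 2 <= L by lra.
have cL : c1%:R <= L by lra.
have c6L : 64 * 16 * c1%:R ^+ 6 <= L by move: HL c1_gt0 e16; clear; lra.
have {}HL := isT.
have BF : prob p (fun Gam : sgraph 'I_n => ~ (co_connected Gam -> cfs Gam)) <= 13 * expR (- L).
  have [cp|cp] := leP (c1%:R * p) 1.
    apply: le_trans (prob_not_cfs_sparse p0 c4 cp mL L2 cL).
    by apply: prob_le => // G; apply: contra_not.
  (* In this range [p > 1 / c1], which gives [16 g <= p ^+ 3]; the term in [c1 ^ 6] of the lower
     bound on [L] is what makes [L * g ^+ 2 >= 4]. *)
  pose g : R := (c1%:R ^+ 3)^-1 / 16.
  have c3 : 0 < c1%:R ^+ 3 :> R by exact: exprn_gt0.
  have g0 : 0 < g by rewrite /g divr_gt0 // invr_gt0.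
  have gp : 16 * g <= p ^+ 3.
    rewrite /g mulrCA divff // mulr1 -exprVn lerXn2r ?nnegrE ?invr_ge0 ?ltW //.
    by rewrite -div1r ltr_pdivrMr // mulrC.
  have gc : g ^+ 2 * (16 * 16 * c1%:R ^+ 6) = 1.
    rewrite /g expr_div_n exprVn -exprM; field; exact: lt0r_neq0.
  have g2L : 4 <= L * g ^+ 2.
    have : (64 * 16 * c1%:R ^+ 6) * g ^+ 2 <= L * g ^+ 2 by apply: ler_wpM2r c6L; exact: sqr_ge0.
    by move: gc; clear; lra.
  have g1 : g <= 1 / 16.
    have p3 : p ^+ 3 <= 1 by rewrite exprn_ile1 // ltW.
    by move: gp p3 g0; clear; lra.
  have gL : 2 * L <= g * n%:R.
    have A := ln_half_sqr n0; rewrite -/L in A.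
    have B : 64 <= L * g.
      have Lg : 0 <= L * g by apply: mulr_ge0 (ltW g0); move: L2; clear; lra.
      by have := ler_wpM2l Lg g1; rewrite -mulrA -expr2; move: g2L; clear; lra.
    have D := ler_wpM2l (ltW g0) A.
    have : 64 * L <= L * g * L by apply: ler_wpM2r => //; move: L2; clear; lra.
    by move: D L2; clear; lra.
  have qL' : L <= (1 - p) * n%:R.
    by move: qL eL; clear; lra.
  apply: le_trans (_ : 2 * expR (- L) <= _); last by have := expR_ge0 (- L); lra.
  have n6 : 6 <= n%:R :> R by lra.
  apply: le_trans (prob_not_common_nonadj p01 g0 gp n6 L2 gL qL' g2L Ln).
  by apply: prob_le => // G; apply: contra_not => cn co; exact: dense_cfs.
have := prob_or_le p01 BC BF; set B := _ + _ => HB.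
apply: (@le_trans _ _ B); last by rewrite /B; have := expR_ge0 (- (eps / 2 * L)); lra.
apply: le_trans HB; apply: prob_le => // G; apply: contra_notP => /not_orP[/contrapT con /contrapT cf].
have co : co_connected G by split; rewrite ?card_ord.
by apply: racg_quadratic => //; exact: cf.
Qed.

End Asymptotics.

Unset Implicit Arguments.
Set Strict Implicit.
Set Printing Implicit Defensive.
Local Open Scope classical_set_scope.
Local Open Scope ring_scope.

Theorem corollary2p2 (R : realType) :
  exists2 k : R, 0 < k &
    forall (p : nat -> R) (eps : R),
      (forall n, 0 < p n < 1) ->
      0 < eps ->
      (\forall n \near \oo,
         Num.sqrt (k * ln n%:R / n%:R) <= p n
           <= 1 - (1 + eps) * ln n%:R / n%:R) ->
      gnp_aas p (fun n Gam =>
        thick_exactly_one (racg Gam) /\ quadratic_divergence R (racg Gam)).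
Proof.
exists 1600; first by rewrite ltr0n.
move=> p eps p01 e0 near_p.
have [c1 c4] : exists c1 : nat, 64 * 64 <= c1%:R :> R by exists (64 * 64)%N; rewrite natrM lexx.
(* Decreasing [eps] only relaxes the upper bound on [p], and the estimate for connectedness is
   stated for [eps] at most 1. *)
pose e := Num.min eps 1.
have e01 : 0 < e <= 1 by rewrite /e lt_min e0 ltr01 ge_min lexx orbT.
have ee : e <= eps by rewrite /e ge_min lexx.
have near_ln (A : R) : \forall n \near \oo, A <= ln (n%:R : R).
  near=> n; have An : expR A <= n%:R by near: n; exact: nbhs_infty_ger.
  by rewrite -(expRK A) ler_ln ?posrE ?expR_gt0 // (lt_le_trans _ An) ?expR_gt0.
apply/cvgrPdist_le => eta eta0; near=> n.
have p01' : 0 <= p n <= 1 by have /andP[/ltW -> /ltW ->] := p01 n.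
have L0 : 0 <= ln (n%:R : R) by near: n; exact: near_ln.
have pn : Num.sqrt (1600 * ln n%:R / n%:R) <= p n <= 1 - (1 + e) * ln n%:R / n%:R.
  have /andP[-> /=] : Num.sqrt (1600 * ln n%:R / n%:R) <= p n <= 1 - (1 + eps) * ln n%:R / n%:R.
    by near: n.
  move=> /le_trans; apply; rewrite lerD2l lerN2 ler_wpM2r ?invr_ge0 // ler_wpM2r //; lra.
have HL : 16 / e + c1%:R + 64 * 16 * c1%:R ^+ 6 <= ln (n%:R : R) by near: n; exact: near_ln.
(* With [u = e / 2 * ln n] this says [18 <= eta * u]; since [u * expR (- u) <= 1], it follows that
   [18 * expR (- u) <= eta]. *)
have HE : 36 / (e * eta) <= ln (n%:R : R) by near: n; exact: near_ln.
have B := prob_racg_le c4 (p01 n) e01 pn HL.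
rewrite -/(prob (p n) _) (prob_not (p n)) opprB addrC subrK ger0_norm ?prob_ge0 //.
apply: le_trans B _; set u := e / 2 * _.
have eeta : 0 < e * eta by rewrite mulr_gt0 //; case/andP: e01.
have U : 18 <= eta * u.
  move: HE; rewrite ler_pdivrMr // /u; lra.
have A := @expR_ge1Dx R u; have C := @expRxMexpNx_1 R u; have D := expR_ge0 (- u).
have F : u * expR (- u) <= expR u * expR (- u) by apply: ler_wpM2r => //; lra.
have G : 18 * expR (- u) <= eta * u * expR (- u) by exact: ler_wpM2r.
have H : eta * (u * expR (- u)) <= eta * 1 by apply: ler_wpM2l; [exact: ltW | rewrite -C].
by lra.
Unshelve. all: by end_near.
Qed.
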